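(* Let $0<p<\infty$ and $\varphi\in\mathcal{G}_p$, and suppose there exist $\varepsilon_0>0$ and $c_0>0$ such that $t^{\varepsilon_0-d/p}\varphi(t)\le c_0\,r^{\varepsilon_0-d/p}\varphi(r)$ for all $t\ge r>0$. (i) If $1\le p<\infty$, then $$B_{p,1}^{0,\varphi}(\mathbb{R}^d)\hookrightarrow F_{p,1}^{0,\varphi}(\mathbb{R}^d)\hookrightarrow L^p_\varphi(\mathbb{R}^d).$$ (ii) If $0<p<1$, then $$B_{p,p}^{\sigma_p,\varphi}(\mathbb{R}^d)=F_{p,p}^{\sigma_p,\varphi}(\mathbb{R}^d)\hookrightarrow\big(L^1_\varphi(\mathbb{R}^d)\cap L^p_\varphi(\mathbb{R}^d)\big).$$
   Context: $X\hookrightarrow Y$ means $X\subset Y$ with continuous natural embedding; embedding of a space of distributions into a space of locally integrable functions means that its elements are regular distributions represented by such functions. $\mathcal{F}$ is the Fourier transform on $\mathcal{S}'(\mathbb{R}^d)$. $\sigma_p=d\max(\frac1p-1,0)$. Class $\mathcal{G}_p$: all nondecreasing $\varphi:(0,\infty)\to(0,\infty)$ such that $t^{-d/p}\varphi(t)\ge s^{-d/p}\varphi(s)$ for all $0<t\le s<\infty$. $\mathcal{Q}$ is the set of dyadic cubes $2^{-j}([0,1)^d+k)$, $j\in\mathbb{Z}$, $k\in\mathbb{Z}^d$; $\ell(P)$ is the side length and $|P|=\ell(P)^d$ the volume of $P$; $j_P=-\log_2\ell(P)$; $j_P\vee0=\max(j_P,0)$. For an exponent $0<u<\infty$, $L^u_\varphi(\mathbb{R}^d)$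 is the set of all locally $u$-integrable $f:\mathbb{R}^d\to\mathbb{C}$ with $$\|f\mid L^u_\varphi(\mathbb{R}^d)\|=\sup_{P\in\mathcal{Q},\,|P|\ge1}\frac1{\varphi(\ell(P))}\Big(\int_P|f(x)|^u\,dx\Big)^{1/u}<\infty.$$ Resolution of unity: $\theta_0\in\mathcal{S}(\mathbb{R}^d)$ with $\theta_0(x)=1$ for $|x|\le1$ and $\theta_0(x)=0$ for $|x|\ge3/2$; $\theta_k(x)=\theta_0(2^{-k}x)-\theta_0(2^{-k+1}x)$, $k\in\mathbb{N}$. For $s\in\mathbb{R}$, $0<q<\infty$ and $f_j=\mathcal{F}^{-1}(\theta_j\mathcal{F}f)$, the spaces consist of all $f\in\mathcal{S}'(\mathbb{R}^d)$ with finite quasi-norm $$\|f\mid B_{p,q}^{s,\varphi}(\mathbb{R}^d)\|=\sup_{P\in\mathcal{Q}}\frac1{\varphi(\ell(P))}\Big\{\sum_{j=j_P\vee0}^\infty\Big(\int_P|2^{js}f_j(x)|^p\,dx\Big)^{q/p}\Big\}^{1/q},$$ $$\|f\mid F_{p,q}^{s,\varphi}(\mathbb{R}^d)\|=\sup_{P\in\mathcal{Q}}\frac1{\varphi(\ell(P))}\Big\{\int_P\Big(\sum_{j=j_P\vee0}^\infty|2^{js}f_j(x)|^q\Big)^{p/q}dx\Big\}^{1/p}.$$ *)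

(* Defs.v *)
From HB Require Import structures.
From mathcomp Require Import all_boot all_order all_algebra.
From mathcomp Require Import complex.
From mathcomp Require Import all_classical all_reals all_analysis.

Set Implicit Arguments.
Unset Strict Implicit.
Unset Printing Implicit Defensive.

Import Order.TTheory GRing.Theory Num.Theory.
Import numFieldNormedType.Exports.

Local Open Scope classical_set_scope.
Local Open Scope complex_scope.
Local Open Scope ring_scope.

(** * Lebesgue measure on R^d *)

(* R^d is ['rV[R]_d]; its sigma-algebra is the one generated by the coordinate
   maps, which is the Borel sigma-algebra. *)
Definition rV_display : measure_display.
Proof. exact: default_measure_display. Qed.

Section measurable_rV.
Context (R : realType) (n : nat).

Definition rV_coord (i : 'I_n) (x : 'rV[R]_n) : measurableTypeR R := x ord0 i.

Let rV_set0 : g_sigma_preimage rV_coord set0.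
Proof. exact: sigma_algebra0. Qed.

Let rV_setC A :
  g_sigma_preimage rV_coord A -> g_sigma_preimage rV_coord (~` A).
Proof. exact: sigma_algebraC. Qed.

Let rV_bigcup (F : (set 'rV[R]_n)^nat) :
  (forall i, g_sigma_preimage rV_coord (F i)) ->
  g_sigma_preimage rV_coord (\bigcup_i (F i)).
Proof. exact: sigma_algebra_bigcup. Qed.

HB.instance Definition _ := @isMeasurable.Build rV_display
  'rV[R]_n (g_sigma_preimage rV_coord) rV_set0 rV_setC rV_bigcup.

Lemma measurable_rV_coord (i : 'I_n) : measurable_fun setT (rV_coord i).
Proof.
move=> _ Y mY; rewrite setTI; apply: sub_sigma_algebra => /=.
rewrite -bigcup_seq/=; exists i => /=; first by rewrite mem_index_enum.
by exists Y => //; rewrite setTI.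
Qed.

Lemma measurable_fun_rVP d (T : measurableType d) (f : T -> 'rV[R]_n) :
  (forall i, measurable_fun setT (rV_coord i \o f)) -> measurable_fun setT f.
Proof.
move=> mf; suff H : g_sigma_preimage (fun i => rV_coord i \o f) `<=` measurable.
  move=> _ A mA; apply: H; rewrite g_sigma_preimage_comp.
  by exists A.
apply: smallest_sub; first exact: sigma_algebra_measurable.
rewrite -bigcup_seq; apply: bigcup_sub => i _.
by move=> A [B mB <-]; exact: mf.
Qed.

End measurable_rV.

Section cons_rV.
Context (R : realType) (n : nat).

Definition cons_rV (p : measurableTypeR R * 'rV[R]_n) : 'rV[R]_n.+1 :=
  \row_i oapp (fun j => p.2 ord0 j) p.1 (unlift ord0 i).

Definition uncons_rV (x : 'rV[R]_n.+1) : measurableTypeR R * 'rV[R]_n :=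
  (x ord0 ord0, \row_j x ord0 (lift ord0 j)).

Lemma cons_rVK : cancel cons_rV uncons_rV.
Proof.
move=> [a v]; rewrite /uncons_rV /cons_rV mxE unlift_none /=; congr pair.
by apply/rowP => j; rewrite !mxE liftK.
Qed.

Lemma uncons_rVK : cancel uncons_rV cons_rV.
Proof.
move=> x; apply/rowP => i; rewrite !mxE.
by case: unliftP => [j ->|->] //=; rewrite mxE.
Qed.

Lemma measurable_cons_rV : measurable_fun setT cons_rV.
Proof.
apply: measurable_fun_rVP => i.
have [j ij|i0] := unliftP ord0 i.
- rewrite (_ : _ \o _ = rV_coord j \o snd); last first.
    by apply/funext => p /=; rewrite /rV_coord mxE ij liftK.
  by apply: measurableT_comp => //; exact: measurable_rV_coord.
- rewrite (_ : _ \o _ = fst) //.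
  by apply/funext => p /=; rewrite /rV_coord mxE i0 unlift_none.
Qed.

Lemma measurable_uncons_rV : measurable_fun setT uncons_rV.
Proof.
apply/measurable_fun_pairP; split; first exact: measurable_rV_coord.
apply: measurable_fun_rVP => i.
rewrite (_ : _ \o _ = rV_coord (lift ord0 i)); first exact: measurable_rV_coord.
by apply/funext => x /=; rewrite /rV_coord /= mxE.
Qed.

End cons_rV.

Section lebesgue_rV.
Context (R : realType).
Local Open Scope ereal_scope.

Section base.

Definition lebesgue_rV0 : set 'rV[R]_0 -> \bar R := \d_(0%R : 'rV[R]_0).
HB.instance Definition _ := Measure.on lebesgue_rV0.

Let lebesgue_rV0_sigma_finite : sigma_finite setT lebesgue_rV0.
Proof.
exists (fun=> setT); first by rewrite bigcup_const.
by move=> _; split => //; rewrite /lebesgue_rV0 diracT ltry.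
Qed.

HB.instance Definition _ := Measure_isSigmaFinite.Build _ _ _
  lebesgue_rV0 lebesgue_rV0_sigma_finite.

End base.

Section step.
Context (n : nat) (mu : {sigma_finite_measure set 'rV[R]_n -> \bar R}).

Definition lebesgue_rVS : set 'rV[R]_n.+1 -> \bar R :=
  pushforward (lebesgue_measure \x mu) (@cons_rV R n).

Let lebesgue_rVS0 : lebesgue_rVS set0 = 0.
Proof. by rewrite /lebesgue_rVS /pushforward preimage_set0 measure0. Qed.

Let lebesgue_rVS_ge0 A : 0 <= lebesgue_rVS A.
Proof. by rewrite /lebesgue_rVS /pushforward; exact: measure_ge0. Qed.

Let lebesgue_rVS_sigma_additive : semi_sigma_additive lebesgue_rVS.
Proof.
have mc A : measurable A -> measurable (@cons_rV R n @^-1` A).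
  by move=> mA; rewrite -[X in measurable X]setTI; exact: measurable_cons_rV.
move=> F mF tF mUF; rewrite /lebesgue_rVS /pushforward preimage_bigcup.
apply: measure_semi_sigma_additive.
- by move=> k; exact: mc.
- apply/trivIsetP => /= i j _ _ ij; rewrite -preimage_setI.
  by move/trivIsetP : tF => /(_ _ _ _ _ ij) ->//; rewrite preimage_set0.
- by rewrite -preimage_bigcup; exact: mc.
Qed.

HB.instance Definition _ := isMeasure.Build _ _ _ lebesgue_rVS
  lebesgue_rVS0 lebesgue_rVS_ge0 lebesgue_rVS_sigma_additive.

Let lebesgue_rVS_sigma_finite : sigma_finite setT lebesgue_rVS.
Proof.
have /sigma_finiteP[F [TF ndF Foo]] := sigma_finiteT (@lebesgue_measure R).
have /sigma_finiteP[G [TG ndG Goo]] := sigma_finiteT mu.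
exists (fun k => @uncons_rV R n @^-1` (F k `*` G k)).
  apply/seteqP; split=> // x _; set p := uncons_rV x.
  have : setT p.1 by [].
  have : setT p.2 by [].
  rewrite TF TG => -[j _ Gj] [i _ Fi]; exists (maxn i j) => //; split.
  - by move: (p.1) Fi; exact/subsetPset/ndF/leq_maxl.
  - by move: (p.2) Gj; exact/subsetPset/ndG/leq_maxr.
move=> k; have [mF Fk] := Foo k; have [mG Gk] := Goo k; split.
  rewrite -[X in measurable X]setTI; apply: measurable_uncons_rV => //.
  exact: measurableX.
rewrite /lebesgue_rVS /pushforward -comp_preimage.
rewrite (_ : _ \o _ = id); last by apply/funext => p /=; rewrite cons_rVK.
by rewrite preimage_id product_measure1E// lte_mul_pinfty// ge0_fin_numE.
Qed.

HB.instance Definition _ := Measure_isSigmaFinite.Build _ _ _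
  lebesgue_rVS lebesgue_rVS_sigma_finite.

End step.

Fixpoint lebesgue_rV (n : nat) : {sigma_finite_measure set 'rV[R]_n -> \bar R} :=
  match n with
  | 0 => lebesgue_rV0
  | m.+1 => lebesgue_rVS (lebesgue_rV m)
  end.

End lebesgue_rV.

(** * Tempered distributions and the Fourier transform *)

Section distributions.
Context (R : realType) (d : nat).
Local Notation E := ('rV[R]_d).
Local Notation C := (R[i]).
Local Notation mu := (lebesgue_rV R d).

Definition cmod (z : C) : R := ComplexField.Normc.normc z.

Definition dotp (x y : E) : R := \sum_(i < d) x ord0 i * y ord0 i.

(* The library norm on ['rV[R]_d] is the maximum norm. *)
Definition enorm (x : E) : R := Num.sqrt (\sum_(i < d) x ord0 i ^+ 2).

Definition cintegrable (D : set E) (f : E -> C) : Prop :=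
  mu.-integrable D (EFin \o (@complex.Re R \o f)) /\
  mu.-integrable D (EFin \o (@complex.Im R \o f)).

Definition cintegral (D : set E) (f : E -> C) : C :=
  Rintegral mu D (@complex.Re R \o f) +i* Rintegral mu D (@complex.Im R \o f).

Definition partial (i : 'I_d) (f : E -> C) : E -> C := fun x =>
  'D_(delta_mx ord0 i) (@complex.Re R \o f) x +i*
  'D_(delta_mx ord0 i) (@complex.Im R \o f) x.

Definition partials (l : seq 'I_d) (f : E -> C) : E -> C := foldr partial f l.

Definition smooth (f : E -> C) : Prop := forall l x,
  differentiable (@complex.Re R \o partials l f) x /\
  differentiable (@complex.Im R \o partials l f) x.

Definition schwartz_seminorm (N : nat) (f : E -> C) : \bar R :=
  ereal_sup [set ((1 + enorm lx.2) ^+ N * cmod (partials lx.1 f lx.2))%:E |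
             lx in [set lx : seq 'I_d * E | (size lx.1 <= N)%N]].

Definition schwartz (f : E -> C) : Prop :=
  smooth f /\ forall N, (schwartz_seminorm N f < +oo)%E.

(* A distribution is a functional on all functions of which only the values at
   Schwartz functions are relevant. *)
Definition dist : Type := (E -> C) -> C.

Definition tempered (T : dist) : Prop :=
  (forall (a : C) (f g : E -> C), schwartz f -> schwartz g ->
     T (fun x => a * f x + g x) = a * T f + T g) /\
  (exists (N : nat) (c : R), 0 <= c /\ forall f, schwartz f ->
     ((cmod (T f))%:E <= c%:E * schwartz_seminorm N f)%E).

Definition expi (t : R) : C := cos t +i* sin t.

Definition fourier (f : E -> C) : E -> C := fun xi =>
  ((2 * pi) `^ (- (d%:R / 2)))%:C *
  cintegral setT (fun x => f x * expi (- dotp x xi)).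

Definition inv_fourier (f : E -> C) : E -> C := fun x =>
  ((2 * pi) `^ (- (d%:R / 2)))%:C *
  cintegral setT (fun xi => f xi * expi (dotp x xi)).

Definition dist_fourier (T : dist) : dist := fun f => T (fourier f).
Definition dist_inv_fourier (T : dist) : dist := fun f => T (inv_fourier f).
Definition dist_mul (m : E -> C) (T : dist) : dist :=
  fun f => T (fun x => m x * f x).

Definition loc_integrable (u : R) (g : E -> C) : Prop :=
  [/\ measurable_fun setT (@complex.Re R \o g),
      measurable_fun setT (@complex.Im R \o g) &
      forall K : set E, compact K ->
        (\int[mu]_(x in K) (cmod (g x) `^ u)%:E < +oo)%E].

(* [T] is the regular distribution given by the function [g]. *)
Definition represents (T : dist) (g : E -> C) : Prop :=
  loc_integrable 1 g /\
  forall f, schwartz f -> cintegrable setT (fun x => g x * f x) /\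
    T f = cintegral setT (fun x => g x * f x).

End distributions.

(** * Function spaces *)

(* A quasi-normed space, given by its elements and its quasi-norm. *)
Record qnspace (R : realType) (T : zmodType) := QNSpace {
  qset : set T ;
  qnorm : T -> \bar R }.

(* Inclusion with continuous identity map. *)
Definition embeds (R : realType) (T : zmodType) (X Y : qnspace R T) : Prop :=
  qset X `<=` qset Y /\
  forall f0, qset X f0 -> forall e : R, 0 < e ->
    exists2 r : R, 0 < r & forall f, qset X f ->
      (qnorm X (f - f0) < r%:E)%E -> (qnorm Y (f - f0) < e%:E)%E.

(* Equality of the underlying sets, with equivalent quasi-norms. *)
Definition same_space (R : realType) (T : zmodType) (X Y : qnspace R T) : Prop :=
  qset X = qset Y /\
  exists c1 c2 : R, [/\ 0 < c1, 0 < c2 & forall f, qset X f ->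
    (c1%:E * qnorm X f <= qnorm Y f)%E /\ (qnorm Y f <= c2%:E * qnorm X f)%E].

Definition qcap (R : realType) (T : zmodType) (X Y : qnspace R T) : qnspace R T :=
  QNSpace (qset X `&` qset Y) (fun f => maxe (qnorm X f) (qnorm Y f)).

Section spaces.
Context (R : realType) (d : nat).
Local Notation E := ('rV[R]_d).
Local Notation C := (R[i]).
Local Notation mu := (lebesgue_rV R d).

(* The elements of [X] are regular distributions whose densities, which are
   unique up to null sets, lie in [Y] and depend continuously on them. *)
Definition embeds_fun (X : qnspace R (dist R d)) (Y : qnspace R (E -> C)) :
    Prop :=
  (forall f, qset X f -> exists2 g, qset Y g & represents f g) /\
  forall f0 g0, qset X f0 -> qset Y g0 -> represents f0 g0 ->
    forall e : R, 0 < e ->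
    exists2 r : R, 0 < r & forall f g, qset X f -> qset Y g -> represents f g ->
      (qnorm X (f - f0) < r%:E)%E -> (qnorm Y (g - g0) < e%:E)%E.

Definition class_G (p : R) (phi : R -> R) : Prop :=
  [/\ forall t, 0 < t -> 0 < phi t,
      forall t s, 0 < t -> t <= s -> phi t <= phi s &
      forall t s, 0 < t -> t <= s ->
        s `^ (- (d%:R / p)) * phi s <= t `^ (- (d%:R / p)) * phi t].

(* [(j, k)] stands for the dyadic cube 2^-j ([0,1)^d + k). *)
Definition dyadic : Type := (int * ('I_d -> int))%type.

Definition cube_side (P : dyadic) : R := 2 ^ (- P.1).

Definition cube_vol (P : dyadic) : R := cube_side P ^+ d.

Definition cube_set (P : dyadic) : set E := [set x | forall i,
  cube_side P * (P.2 i)%:~R <= x ord0 i < cube_side P * ((P.2 i)%:~R + 1)].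

(* j_P \/ 0 *)
Definition cube_level (P : dyadic) : nat := `|Num.max P.1 0|%N.

Definition L_norm (u : R) (phi : R -> R) (g : E -> C) : \bar R :=
  ereal_sup [set (((phi (cube_side P))^-1)%:E *
      (\int[mu]_(x in cube_set P) (cmod (g x) `^ u)%:E) `^ u^-1)%E |
    P in [set P | 1 <= cube_vol P]].

Definition L_space (u : R) (phi : R -> R) : qnspace R (E -> C) :=
  QNSpace [set g | loc_integrable u g /\ (L_norm u phi g < +oo)%E]
          (L_norm u phi).

Definition resolution (theta0 : E -> C) : Prop :=
  [/\ schwartz theta0,
      forall x, enorm x <= 1 -> theta0 x = 1 &
      forall x, 3 / 2 <= enorm x -> theta0 x = 0].

Definition theta (theta0 : E -> C) (k : nat) : E -> C :=
  if k is 0 then theta0 else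
  fun x => theta0 (2 ^- k *: x) - theta0 ((2 * 2 ^- k) *: x).

(* F^-1 (theta_j F f), as a distribution *)
Definition piece (theta0 : E -> C) (f : dist R d) (j : nat) : dist R d :=
  dist_inv_fourier (dist_mul (theta theta0 j) (dist_fourier f)).

(* Functions representing the distributions F^-1 (theta_j F f).  By the
   Paley-Wiener-Schwartz theorem they exist for every tempered f, and they are
   unique up to null sets, so that the infima over them in [B_space] and
   [F_space] are infima of a single value. *)
Definition pieces (theta0 : E -> C) (f : dist R d) : set (nat -> E -> C) :=
  [set g | forall j, represents (piece theta0 f j) (g j)].

Section norms.
Context (p q s : R) (phi : R -> R) (theta0 : E -> C).

Definition weighted (g : nat -> E -> C) (j : nat) (x : E) : R :=
  cmod (((2 `^ (j%:R * s))%:C) * g j x).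

Definition B_norm_of (g : nat -> E -> C) : \bar R :=
  ereal_sup [set (((phi (cube_side P))^-1)%:E *
      (\sum_(cube_level P <= j <oo)
         (\int[mu]_(x in cube_set P) (weighted g j x `^ p)%:E) `^ (q / p))
        `^ q^-1)%E | P in [set: dyadic]].

Definition F_norm_of (g : nat -> E -> C) : \bar R :=
  ereal_sup [set (((phi (cube_side P))^-1)%:E *
      (\int[mu]_(x in cube_set P)
         (\sum_(cube_level P <= j <oo) (weighted g j x `^ q)%:E) `^ (p / q))
        `^ p^-1)%E | P in [set: dyadic]].

Definition B_norm (f : dist R d) : \bar R :=
  ereal_inf [set B_norm_of g | g in pieces theta0 f].

Definition F_norm (f : dist R d) : \bar R :=
  ereal_inf [set F_norm_of g | g in pieces theta0 f].

Definition B_space : qnspace R (dist R d) :=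
  QNSpace [set f | tempered f /\ (B_norm f < +oo)%E] B_norm.

Definition F_space : qnspace R (dist R d) :=
  QNSpace [set f | tempered f /\ (F_norm f < +oo)%E] F_norm.

End norms.

Definition sigma_ (p : R) : R := d%:R * Num.max (p^-1 - 1) 0.

End spaces.

(* Main.v *)
Require Import Defs.
From HB Require Import structures.
From mathcomp Require Import all_boot all_order all_algebra.
From mathcomp Require Import complex ring lra zify.
From mathcomp Require Import all_classical all_reals all_analysis.
From mathcomp Require Import measurable_realfun.

(** Everything comes from one fact: for [f] in one of the spaces on the left,
    the series of its Littlewood-Paley pieces [g j] converges absolutely
    almost everywhere, and its sum is a density of [f]. Once the sum is known
    to be a density, both embeddings into function spaces reduce to an
    estimate of its norm by the norm of [f], for a single distribution at a
    time; densities are unique up to null sets, so that the estimate for a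
    difference of two distributions is the continuity of the embedding.

    The sum is a density ([csum_represents]) as soon as the series of the
    [cmod (g j x)] has uniformly bounded integrals over the unit cubes: the
    partial sums act on a Schwartz function as low frequency cutoffs of [f],
    which converge to [f] because the cutoffs of a Schwartz function converge
    in the Schwartz topology ([cutoff_fourier]), and dominated convergence
    identifies the limit, a Schwartz function being dominated by a weight that
    is a superposition of indicators of boxes made of unit cubes. Uniqueness
    of densities ([test_unique]) uses the products of a Gaussian with logistic
    functions of the coordinates, which are Schwartz functions and approximate
    the indicators of intersections of half-spaces, a pi-system that generates
    the Borel sets. The two Fourier transforms in the definition of the pieces
    are undone by Fourier inversion on Schwartz functions, proved by Gaussian
    regularisation.

    For [1 <= p] the embedding of B into F is Minkowski's inequality in
    countably many terms, and the norm of the sum in L^p is bounded trivially,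
    since the modulus of the sum is at most the sum of the moduli, whose norm
    is the norm in F.

    For [p < 1] the norms in B and F agree by Tonelli's theorem, and the L^p
    estimate follows from the subadditivity of the [p]-th power. The L^1
    estimate is a local form of Bernstein's inequality ([band_L1]). Up to a
    null set the [j]-th piece is an entire function of exponential type
    ([band]), which is reproduced by convolution with a Schwartz kernel
    dilated to the scale [2 ^- j]. A maximal inequality of Peetre's type
    ([maximal_bound]) bounds its [p]-th power pointwise by [2 ^ (j * d)] times
    a weighted integral of that same [p]-th power, and writing [cmod g = cmod
    g `^ p * cmod g `^ (1 - p)] turns this into a bound for the integral over
    a cube [P] by [2 ^ (j * sigma)] times the [1/p]-th power of a weighted
    integral concentrated around [P]. As [1/p] exceeds 1, these bounds can be
    summed over [j] inside the power ([nneseries_powR]), which leaves the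
    weighted integral of the integrand of the F-norm. The weight decays fast
    enough for a sum over the cubes of the size of [P] to be controlled by
    their supremum ([integral_cube_weight]).

    The large cubes of the norm in L^p are exactly those on which the sums in
    the norms of B and F start at [j = 0], so that the normalisation by [phi]
    is the same on both sides and passes through all estimates. *)

Set Implicit Arguments.
Unset Strict Implicit.
Unset Printing Implicit Defensive.

Import Order.TTheory GRing.Theory Num.Theory.
Import numFieldNormedType.Exports.

Local Open Scope classical_set_scope.
Local Open Scope ring_scope.

(** * The modulus of a complex number *)

Section complex_modulus.
Context {R : realType}.
Local Notation C := R[i].
Implicit Types z w : C.

Lemma Re_add z w : complex.Re (z + w) = complex.Re z + complex.Re w.
Proof. by case: z w => [? ?] [? ?]. Qed.
Lemma Im_add z w : complex.Im (z + w) = complex.Im z + complex.Im w.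
Proof. by case: z w => [? ?] [? ?]. Qed.
Lemma Re_opp z : complex.Re (- z) = - complex.Re z.
Proof. by case: z. Qed.
Lemma Im_opp z : complex.Im (- z) = - complex.Im z.
Proof. by case: z. Qed.
Lemma Re_mul z w : complex.Re (z * w) =
  complex.Re z * complex.Re w - complex.Im z * complex.Im w.
Proof. by case: z w => [? ?] [? ?]. Qed.
Lemma Im_mul z w : complex.Im (z * w) =
  complex.Re z * complex.Im w + complex.Im z * complex.Re w.
Proof. by case: z w => [? ?] [? ?]. Qed.
Lemma Re_real (a : R) : complex.Re (a%:C)%C = a. Proof. by []. Qed.
Lemma Im_real (a : R) : complex.Im (a%:C)%C = 0. Proof. by []. Qed.
Lemma complex_ext z w : complex.Re z = complex.Re w ->
  complex.Im z = complex.Im w -> z = w.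
Proof. by case: z w => [? ?] [? ?] /= -> ->. Qed.
Lemma Re_sum I (r : seq I) (P : pred I) (F : I -> C) :
  complex.Re (\sum_(i <- r | P i) F i) = \sum_(i <- r | P i) complex.Re (F i).
Proof. by apply: (big_morph _ Re_add). Qed.
Lemma Im_sum I (r : seq I) (P : pred I) (F : I -> C) :
  complex.Im (\sum_(i <- r | P i) F i) = \sum_(i <- r | P i) complex.Im (F i).
Proof. by apply: (big_morph _ Im_add). Qed.

Lemma cmodE z : cmod z = Num.sqrt (complex.Re z ^+ 2 + complex.Im z ^+ 2).
Proof. by case: z. Qed.
Lemma cmod_ge0 z : 0 <= cmod z. Proof. by rewrite cmodE sqrtr_ge0. Qed.
Lemma cmod0 : cmod (0 : C) = 0.
Proof. by rewrite cmodE /= expr0n addr0 sqrtr0. Qed.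
Lemma cmod_eq0 z : cmod z = 0 -> z = 0.
Proof. exact: ComplexField.Normc.eq0_normc. Qed.
Lemma cmodM z w : cmod (z * w) = cmod z * cmod w.
Proof. exact: ComplexField.Normc.normcM. Qed.
Lemma cmodD z w : cmod (z + w) <= cmod z + cmod w.
Proof. exact: le_normcD. Qed.
Lemma cmodN z : cmod (- z) = cmod z.
Proof. by rewrite !cmodE Re_opp Im_opp !sqrrN. Qed.
Lemma cmodB z w : cmod (z - w) <= cmod z + cmod w.
Proof. by rewrite -(cmodN w) cmodD. Qed.
Lemma cmodC z w : cmod (z - w) = cmod (w - z).
Proof. by rewrite -cmodN opprB. Qed.
Lemma cmod_real (a : R) : cmod (a%:C)%C = `|a|.
Proof. by rewrite cmodE /= expr0n addr0 sqrtr_sqr. Qed.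
Lemma cmod_sum I (r : seq I) (P : pred I) (F : I -> C) :
  cmod (\sum_(i <- r | P i) F i) <= \sum_(i <- r | P i) cmod (F i).
Proof.
elim/big_ind2 : _ => //; first by rewrite cmod0.
by move=> z a w b za wb; rewrite (le_trans (cmodD _ _))// lerD.
Qed.
Lemma Re_le_cmod z : `|complex.Re z| <= cmod z.
Proof. by rewrite cmodE -sqrtr_sqr ler_wsqrtr// lerDl sqr_ge0. Qed.
Lemma Im_le_cmod z : `|complex.Im z| <= cmod z.
Proof. by rewrite cmodE -sqrtr_sqr ler_wsqrtr// lerDr sqr_ge0. Qed.
Lemma cmod_le z : cmod z <= `|complex.Re z| + `|complex.Im z|.
Proof.
have {1}-> : z = ((complex.Re z)%:C)%C + ((complex.Im z)%:C)%C * Complex 0 1.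
  by apply: complex_ext; rewrite ?Re_add ?Im_add ?Re_mul ?Im_mul /=; ring.
rewrite (le_trans (cmodD _ _))// cmodM !cmod_real [cmod (Complex _ _)]cmodE /=.
by rewrite expr0n add0r expr1n sqrtr1 mulr1.
Qed.
Lemma cmod_expi (t : R) : cmod (expi t) = 1.
Proof. by rewrite cmodE /= cos2Dsin2 sqrtr1. Qed.
Lemma expiD (s t : R) : expi (s + t) = expi s * expi t.
Proof.
by apply: complex_ext; rewrite ?Re_mul ?Im_mul /= ?cosD ?sinD // [RHS]addrC.
Qed.
Lemma expi0 : expi 0 = 1 :> C.
Proof. by rewrite /expi cos0 sin0. Qed.
End complex_modulus.

(** * A submultiplicative weight *)

Section weights.
Context (R : realType) (d : nat).
Local Notation E := ('rV[R]_d).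
Local Notation C := (R[i]).
Implicit Types x y v : E.

(** The l^1 norm takes the place of the Euclidean one: its triangle inequality
    holds coordinate by coordinate, and as the two norms are equivalent they
    define the same Schwartz functions. *)
Definition n1 x : R := \sum_(i < d) `|x ord0 i|.
Definition wt x : R := 1 + n1 x.

Lemma n1_ge0 x : 0 <= n1 x. Proof. exact: sumr_ge0. Qed.
Lemma n1_coord x i : `|x ord0 i| <= n1 x.
Proof. by rewrite /n1 (bigD1 i)//= lerDl sumr_ge0. Qed.
Lemma n1D x y : n1 (x + y) <= n1 x + n1 y.
Proof. by rewrite /n1 -big_split/= ler_sum// => i _; rewrite mxE ler_normD. Qed.
Lemma n1N x : n1 (- x) = n1 x.
Proof. by apply: eq_bigr => i _; rewrite mxE normrN. Qed.
Lemma n1Z (a : R) x : n1 (a *: x) = `|a| * n1 x.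
Proof. by rewrite /n1 mulr_sumr; apply: eq_bigr => i _; rewrite mxE normrM. Qed.
Lemma n1_0 : n1 0 = 0.
Proof. by rewrite /n1 big1// => i _; rewrite mxE normr0. Qed.

Lemma wt_ge1 x : 1 <= wt x. Proof. by rewrite lerDl n1_ge0. Qed.
Lemma wt_gt0 x : 0 < wt x. Proof. exact: lt_le_trans (wt_ge1 x). Qed.
Lemma wt_ge0 x : 0 <= wt x. Proof. exact: ltW (wt_gt0 x). Qed.
Hint Resolve wt_ge1 wt_gt0 wt_ge0 : core.
Lemma wtD x y : wt (x + y) <= wt x * wt y.
Proof.
rewrite /wt; have := n1D x y; have := n1_ge0 x; have := n1_ge0 y; nra.
Qed.
Lemma wtN x : wt (- x) = wt x. Proof. by rewrite /wt n1N. Qed.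
Lemma wtB x y : wt (x - y) <= wt x * wt y.
Proof. by rewrite -(wtN y) wtD. Qed.
Lemma wt_coord x i : `|x ord0 i| <= wt x.
Proof. by rewrite (le_trans (n1_coord x i))// lerDr. Qed.
Lemma wtX_ge1 n x : 1 <= wt x ^+ n. Proof. exact: exprn_ege1. Qed.
Lemma wtX_gt0 n x : 0 < wt x ^+ n. Proof. exact: exprn_gt0. Qed.
Lemma wtX_ge0 n x : 0 <= wt x ^+ n. Proof. exact: exprn_ge0. Qed.
Lemma ler_wtX m n x : (m <= n)%N -> wt x ^+ m <= wt x ^+ n.
Proof. by move=> mn; rewrite ler_weXn2l. Qed.

Lemma norm_coord x i : `|x ord0 i| <= `|x|.
Proof.
rewrite [leRHS]/Num.norm /= mx_normrE; apply/bigmax_geP; right.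
by exists (ord0, i).
Qed.
Lemma n1_le_norm x : n1 x <= d%:R * `|x|.
Proof.
rewrite /n1; apply: (@le_trans _ _ (\sum_(i < d) `|x|)).
  by apply: ler_sum => i _; exact: norm_coord.
by rewrite sumr_const card_ord mulr_natl.
Qed.
End weights.

#[global] Hint Extern 0 (is_true (@Order.lt _ _ _ (wt _))) =>
  solve [exact: wt_gt0] : core.
#[global] Hint Extern 0 (is_true (@Order.le _ _ _ (wt _))) =>
  solve [exact: wt_ge0 | exact: wt_ge1] : core.
#[global] Hint Extern 0 (is_true (@Order.le _ _ _ (n1 _))) =>
  solve [exact: n1_ge0] : core.
#[global] Hint Extern 0 (is_true (@Order.le _ _ _ (cmod _))) =>
  solve [exact: cmod_ge0] : core.

(** * Total differentiability and Taylor's formula *)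

Section directional.
Context (R : realType) (d : nat).
Local Notation E := ('rV[R]_d).
Local Notation C := (R[i]).
Implicit Types x y v : E.
Local Notation e_ i := (delta_mx ord0 i : E).

(** A quadratic bound of the first-order remainder is stronger than
    differentiability, but it is what Taylor's formula, the exponential series
    and integrals of such functions deliver directly, with no epsilon. *)
Lemma quad_differentiable (f : E -> R) x (a : 'I_d -> R) (K : R) :
  (forall v, n1 v <= 1 ->
     `|f (x + v) - f x - \sum_i v ord0 i * a i| <= K * n1 v ^+ 2) ->
  differentiable f x /\ forall i, 'D_(e_ i) f x = a i.
Proof.
move=> hK.
have llin : linear (fun v : E => \sum_i v ord0 i * a i : R).
  move=> k u w; rewrite /= scaler_sumr -big_split/=; apply: eq_bigr => i _.
  by rewrite !mxE mulrDl -mulrA.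
pose lL := GRing.isLinear.Build _ _ _ _ _ llin.
pose L : {linear E -> R} := HB.pack (fun v : E => \sum_i v ord0 i * a i : R) lL.
have Lc : continuous L.
  move=> u; apply: (@differentiable_continuous _ _ _ u (L : E -> R)).
  rewrite (_ : (L : E -> R) =
    \sum_(i < d) ((fun v : E => v ord0 i : R) * cst (a i))).
    apply: differentiable_sum => i; apply: differentiableM => //.
    exact: differentiable_coord.
  by apply/funext => v; rewrite fct_sumE.
have H (eps : R) : 0 < eps -> \forall v \near (0 : E),
    `|(f \o shift x - (cst (f x) + L)) v| <= eps * `|v|.
  move=> eps0.
  pose K' := `|K| * d%:R ^+ 2 + 1.
  have K'0 : 0 < K' by rewrite ltr_wpDl// mulr_ge0// exprn_ge0.
  near=> v.
  have n1v : n1 v <= d%:R * `|v| by exact: n1_le_norm.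
  have v1 : n1 v <= 1.
    rewrite (le_trans n1v)//.
    have : `|v| < (d%:R + 1)^-1.
      by near: v; apply: (@nbhs0_lt R E); rewrite invr_gt0 ltr_wpDl.
    rewrite -[_^-1]mul1r ltr_pdivlMr ?ltr_wpDl// => /ltW.
    by apply: le_trans; rewrite mulrC ler_wpM2l// lerDl.
  have v2 : `|v| <= eps / K'.
    by near: v; apply: (@nbhs0_le R E); rewrite divr_gt0.
  rewrite (_ : (_ - _) v = f (x + v) - f x - \sum_i v ord0 i * a i); last first.
    by rewrite /= !fctE /= opprD addrA (addrC v x).
  rewrite (le_trans (hK v v1))//.
  rewrite (@le_trans _ _ (K' * `|v| * `|v|))//; last first.
    by rewrite ler_wpM2r// -ler_pdivlMl// mulrC.
  rewrite -mulrA -expr2 (@le_trans _ _ (`|K| * n1 v ^+ 2))//.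
    by rewrite ler_wpM2r ?sqr_ge0// ler_norm.
  rewrite (@le_trans _ _ (`|K| * (d%:R * `|v|) ^+ 2))//.
    by rewrite ler_wpM2l// lerXn2r// nnegrE ?n1_ge0// mulr_ge0.
  by rewrite exprMn mulrA ler_wpM2r ?sqr_ge0// /K' lerDl.
(* The remainder is [o(v)], hence [L] is the differential. *)
have dL : 'd f x = L :> (E -> R).
  by apply: diff_unique => //; apply/eqaddoP; exact: H.
have df : differentiable f x.
  by apply/diff_locallyP; rewrite dL; split=> //; apply/eqaddoP; exact: H.
split=> // i; rewrite deriveE// dL /= (bigD1 i)//= big1 => [|j ji].
  by rewrite !mxE !eqxx mul1r addr0.
by rewrite !mxE (negbTE ji) mul0r.
Unshelve. all: by end_near. Qed.

Lemma derive_coord (f : E -> R) x v : differentiable f x ->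
  'D_v f x = \sum_i v ord0 i * 'D_(e_ i) f x.
Proof.
move=> df; rewrite deriveE// {1}[v]row_sum_delta linear_sum.
by apply: eq_bigr => i _; rewrite linearZ /= deriveE.
Qed.

Lemma line_is_derive (f : E -> R) x v (t : R) : differentiable f (x + t *: v) ->
  is_derive t 1 (fun s : R => f (x + s *: v)) ('D_v f (x + t *: v)).
Proof.
move=> df; have := diff_derivable (v := v) df.
have E : (fun h => h^-1 *: (((fun s : R => f (x + s *: v)) \o shift t) (h *: 1) -
    f (x + t *: v))) = (fun h => h^-1 *: ((f \o shift (x + t *: v)) (h *: v) -
    f (x + t *: v))).
  apply/funext => h /=; congr (_ *: (f _ - _)).
  by rewrite scalerDl -[h *: 1]/(h * 1) mulr1 addrCA addrC.
by move=> dv; apply: DeriveDef; rewrite /derivable /derive E.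
Qed.

Lemma taylor1 (f : E -> R) x v : (forall y, differentiable f y) ->
  exists2 t : R, 0 <= t <= 1 &
    f (x + v) - f x = \sum_i v ord0 i * 'D_(e_ i) f (x + t *: v).
Proof.
move=> df.
have D (t : R) := line_is_derive (df (x + t *: v)).
have cf : {within `[0, 1], continuous (fun s : R => f (x + s *: v))}.
  apply/continuous_subspaceT => t; apply: differentiable_continuous.
  by apply/derivable1_diffP; exact: (@ex_derive _ _ _ _ _ _ _ (D t)).
have [c] := @MVT_segment R (fun s : R => f (x + s *: v))
  (fun t => 'D_v f (x + t *: v)) 0 1 ler01 (fun t _ => D t) cf.
 rewrite in_itv/= => c01; rewrite scale1r scale0r addr0 subr0 mulr1.
by rewrite derive_coord// => ->; exists c.
Qed.

(** The mean value theorem along the segment from [x] to [x + v], applied to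
    [f] and then to its partial derivatives. *)
Lemma taylor2 (f : E -> R) x v (B : R) : (forall y, differentiable f y) ->
  (forall i y, differentiable ('D_(e_ i) f) y) ->
  (forall t i j, 0 <= t <= 1 -> `|'D_(e_ j) ('D_(e_ i) f) (x + t *: v)| <= B) ->
  `|f (x + v) - f x - \sum_i v ord0 i * 'D_(e_ i) f x| <= B * n1 v ^+ 2.
Proof.
move=> df ddf hB; have [c /andP[c0 c1] ->] := taylor1 x v df.
rewrite -sumrB (le_trans (ler_norm_sum _ _ _))//.
rewrite expr2 mulrA {2}/n1 mulr_sumr; apply: ler_sum => i _.
rewrite -mulrBr normrM mulrC ler_wpM2r//.
have [t /andP[t0 t1] ->] := taylor1 x (c *: v) (ddf i).
rewrite (le_trans (ler_norm_sum _ _ _))// /n1 mulr_sumr.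
apply: ler_sum => j _; rewrite normrM mulrC scalerA ler_pM//.
  by apply: hB; rewrite mulr_ge0//= mulr_ile1.
by rewrite mxE normrM ger0_norm// ler_piMl.
Qed.
End directional.

(** * Weighted bounds for partial derivatives *)

Section partial_derivatives.
Context (R : realType) (d : nat).
Local Notation E := ('rV[R]_d).
Local Notation C := (R[i]).
Implicit Types (x y v : E) (f g : E -> C).
Local Notation e_ i := (delta_mx ord0 i : E).

Definition cdiff f x : Prop := differentiable (@complex.Re R \o f) x /\
  differentiable (@complex.Im R \o f) x.

Lemma Re_addfun f g : @complex.Re R \o (fun x => f x + g x) =
  (@complex.Re R \o f) + (@complex.Re R \o g).
Proof. by apply/funext => x; exact: Re_add. Qed.
Lemma Im_addfun f g : @complex.Im R \o (fun x => f x + g x) =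
  (@complex.Im R \o f) + (@complex.Im R \o g).
Proof. by apply/funext => x; exact: Im_add. Qed.
Lemma Re_mulfun f g : @complex.Re R \o (fun x => f x * g x) =
  (@complex.Re R \o f) * (@complex.Re R \o g) -
  (@complex.Im R \o f) * (@complex.Im R \o g).
Proof. by apply/funext => x; exact: Re_mul. Qed.
Lemma Im_mulfun f g : @complex.Im R \o (fun x => f x * g x) =
  (@complex.Re R \o f) * (@complex.Im R \o g) +
  (@complex.Im R \o f) * (@complex.Re R \o g).
Proof. by apply/funext => x; exact: Im_mul. Qed.

Lemma cdiffD f g x : cdiff f x -> cdiff g x -> cdiff (fun x => f x + g x) x.
Proof.
move=> [rf imf] [rg img]; split; rewrite ?Re_addfun ?Im_addfun;
  exact: differentiableD.
Qed.

Lemma partialD i f g x : cdiff f x -> cdiff g x ->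
  partial i (fun x => f x + g x) x = partial i f x + partial i g x.
Proof.
move=> [rf imf] [rg img]; apply: complex_ext; rewrite ?Re_add ?Im_add /=.
  by rewrite Re_addfun deriveD//; exact: diff_derivable.
by rewrite Im_addfun deriveD//; exact: diff_derivable.
Qed.

Lemma cdiffM f g x : cdiff f x -> cdiff g x -> cdiff (fun x => f x * g x) x.
Proof.
move=> [rf imf] [rg img]; split; rewrite ?Re_mulfun ?Im_mulfun.
  by apply: differentiableB; exact: differentiableM.
by apply: differentiableD; exact: differentiableM.
Qed.

Lemma derive_mulB (V : normedModType R) (u1 u2 w1 w2 : V -> R) (x v : V) :
  derivable u1 x v -> derivable u2 x v -> derivable w1 x v -> derivable w2 x v ->
  'D_v (u1 * w1 - u2 * w2) x = ('D_v u1 x * w1 x - 'D_v u2 x * w2 x) +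
    (u1 x * 'D_v w1 x - u2 x * 'D_v w2 x).
Proof.
move=> d1 d2 e1 e2.
rewrite (deriveB (derivableM d1 e1) (derivableM d2 e2)) (deriveM d1 e1).
rewrite (deriveM d2 e2) /GRing.scale/=.
by move: ('D_v u1 x) ('D_v u2 x) ('D_v w1 x) ('D_v w2 x) (u1 x) (u2 x) (w1 x)
  (w2 x) => *; ring.
Qed.

Lemma derive_mulD (V : normedModType R) (u1 u2 w1 w2 : V -> R) (x v : V) :
  derivable u1 x v -> derivable u2 x v -> derivable w1 x v -> derivable w2 x v ->
  'D_v (u1 * w1 + u2 * w2) x = ('D_v u1 x * w1 x + 'D_v u2 x * w2 x) +
    (u1 x * 'D_v w1 x + u2 x * 'D_v w2 x).
Proof.
move=> d1 d2 e1 e2.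
rewrite (deriveD (derivableM d1 e1) (derivableM d2 e2)) (deriveM d1 e1).
rewrite (deriveM d2 e2) /GRing.scale/=.
by move: ('D_v u1 x) ('D_v u2 x) ('D_v w1 x) ('D_v w2 x) (u1 x) (u2 x) (w1 x)
  (w2 x) => *; ring.
Qed.

Lemma partialM i f g x : cdiff f x -> cdiff g x ->
  partial i (fun x => f x * g x) x = partial i f x * g x + f x * partial i g x.
Proof.
move=> [rf imf] [rg img].
have [drf dif] := (diff_derivable (v := e_ i) rf, diff_derivable (v := e_ i) imf).
have [drg dig] := (diff_derivable (v := e_ i) rg, diff_derivable (v := e_ i) img).
apply: complex_ext.
  rewrite Re_add !Re_mul -[LHS]/('D_(e_ i) (@complex.Re R \o (fun x => f x * g x)) x).
  by rewrite Re_mulfun (derive_mulB drf dif drg dig).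
rewrite Im_add !Im_mul -[LHS]/('D_(e_ i) (@complex.Im R \o (fun x => f x * g x)) x).
by rewrite Im_mulfun (derive_mulD drf dif dig drg).
Qed.

Lemma cdiff_cst (c : C) x : cdiff (fun=> c) x.
Proof. by split; [exact: (@differentiable_cst _ _ _ (complex.Re c))|exact: (@differentiable_cst _ _ _ (complex.Im c))]. Qed.

Lemma partial_cst i (c : C) x : partial i (fun=> c) x = 0.
Proof.
apply: complex_ext => /=.
  by rewrite (_ : _ \o _ = cst (complex.Re c))// derive_cst.
by rewrite (_ : _ \o _ = cst (complex.Im c))// derive_cst.
Qed.

Lemma cdiff_real (f : E -> R) x : differentiable f x ->
  cdiff (fun x => (f x)%:C%C) x.
Proof. by move=> df; split=> //; exact: differentiable_cst. Qed.

Lemma partial_real i (f : E -> R) x :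
  partial i (fun x => (f x)%:C%C) x = ('D_(e_ i) f x)%:C%C.
Proof.
by apply: complex_ext => //=; rewrite (_ : _ \o _ = cst (0 : R))// derive_cst.
Qed.

Lemma quad_cdiff f x (a : 'I_d -> C) (K : R) :
  (forall v, n1 v <= 1 -> cmod (f (x + v) - f x -
     \sum_i (v ord0 i)%:C%C * a i) <= K * n1 v ^+ 2) ->
  cdiff f x /\ forall i, partial i f x = a i.
Proof.
move=> hK.
have [rf Rf] : differentiable (@complex.Re R \o f) x /\
    forall i, 'D_(e_ i) (@complex.Re R \o f) x = complex.Re (a i).
  apply: (@quad_differentiable R d _ x _ K) => v v1.
  apply: le_trans (hK v v1); rewrite (le_trans _ (Re_le_cmod _))//.
  rewrite !Re_add !Re_opp Re_sum.
  by under [in leRHS]eq_bigr do rewrite Re_mul Re_real Im_real mul0r subr0.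
have [jf If] : differentiable (@complex.Im R \o f) x /\
    forall i, 'D_(e_ i) (@complex.Im R \o f) x = complex.Im (a i).
  apply: (@quad_differentiable R d _ x _ K) => v v1.
  apply: le_trans (hK v v1); rewrite (le_trans _ (Im_le_cmod _))//.
  rewrite !Im_add !Im_opp Im_sum.
  by under [in leRHS]eq_bigr do rewrite Im_mul Re_real Im_real mul0r addr0.
by split=> // i; apply: complex_ext => /=.
Qed.

Lemma cdiff_continuous f x : cdiff f x ->
  {for x, continuous (@complex.Re R \o f)} /\
  {for x, continuous (@complex.Im R \o f)}.
Proof. by move=> [? ?]; split; exact: differentiable_continuous. Qed.

Definition aff (a : R) (b x : E) : E := a *: x + b.

Lemma derive_aff (f : E -> R) (a : R) b x v : differentiable f (aff a b x) ->
  differentiable (f \o aff a b) x /\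
  'D_v (f \o aff a b) x = a * 'D_v f (aff a b x).
Proof.
move=> df.
have da : differentiable (aff a b) x.
  by apply: differentiableD => //; exact: differentiableZ.
split; first exact: differentiable_comp.
have E0 : (fun h : R => h^-1 *: (((f \o aff a b) \o shift x) (h *: v) -
      (f \o aff a b) x)) =
    (fun h : R => h^-1 *: ((f \o shift (aff a b x)) (h *: (a *: v)) -
      f (aff a b x))).
  apply/funext => h /=; congr (_ *: (f _ - _)).
  by rewrite /aff /= scalerDr addrA !scalerA (mulrC a h).
have -> : 'D_v (f \o aff a b) x = 'D_(a *: v) f (aff a b x).
  by rewrite /derive E0.
by rewrite !deriveE// linearZ.
Qed.

Lemma cdiff_aff f (a : R) b x : cdiff f (aff a b x) -> cdiff (f \o aff a b) x.
Proof.
by move=> [rf jf]; split; [case: (derive_aff 0 rf)|case: (derive_aff 0 jf)].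
Qed.

Lemma partial_aff i f (a : R) b x : cdiff f (aff a b x) ->
  partial i (f \o aff a b) x = a%:C%C * partial i f (aff a b x).
Proof.
move=> [rf jf]; apply: complex_ext.
  rewrite Re_mul Re_real Im_real mul0r subr0 /=.
  by have [_ <-] := derive_aff (e_ i) rf.
rewrite Im_mul Re_real Im_real mul0r addr0 /=.
by have [_ <-] := derive_aff (e_ i) jf.
Qed.

Lemma chain1 (h : R -> R) (f : E -> R) x v : derivable h (f x) 1 ->
  differentiable f x ->
  differentiable (h \o f) x /\ 'D_v (h \o f) x = 'D_1 h (f x) * 'D_v f x.
Proof.
move=> dh df; have dh' : differentiable h (f x) by exact/derivable1_diffP.
split; first exact: differentiable_comp.
rewrite deriveE; last exact: differentiable_comp.
rewrite (diff_comp df dh') /= (deriveE (1 : R) dh') (deriveE v df) mulrC.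
have e (c : R) : 'd h (f x) c = c * 'd h (f x) (1 : R).
  by rewrite -[c in LHS]mulr1 -[c * 1]/(c *: (1 : R)) linearZ.
by rewrite e.
Qed.

Lemma partials_rcons l i f : partials (rcons l i) f = partials l (partial i f).
Proof. by rewrite /partials foldr_rcons. Qed.

(** In this form the recursion is over the innermost derivative
    ([partials_rcons]), for which the rules for sums, products and
    substitutions are inductive. *)
Definition smoothn (k : nat) f : Prop :=
  forall l x, (size l <= k)%N -> cdiff (partials l f) x.

Lemma smoothP f : smooth f <-> forall k, smoothn k f.
Proof. by split=> [sf k l x _|sf l x]; [exact: sf|exact: (sf (size l))]. Qed.

Lemma smoothn0 f : (forall x, cdiff f x) -> smoothn 0 f.
Proof. by move=> df [|//] x _; exact: df. Qed.

Lemma smoothnS k f : (forall x, cdiff f x) ->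
  (forall i, smoothn k (partial i f)) -> smoothn k.+1 f.
Proof.
move=> df sf; case/lastP => [x _|l i x]; first exact: df.
by rewrite size_rcons ltnS partials_rcons; exact: sf.
Qed.

Lemma smoothn_cdiff k f : smoothn k f -> forall x, cdiff f x.
Proof. by move=> sf x; exact: (sf [::] x (leq0n _)). Qed.

Lemma smoothn_partial k i f : smoothn k.+1 f -> smoothn k (partial i f).
Proof.
by move=> sf l x lk; rewrite -partials_rcons; apply: sf; rewrite size_rcons.
Qed.

Lemma smoothn_le k k' f : (k' <= k)%N -> smoothn k f -> smoothn k' f.
Proof. by move=> kk' sf l x lk; apply: sf; exact: leq_trans lk kk'. Qed.

Lemma smoothnD k f g : smoothn k f -> smoothn k g ->
  smoothn k (fun x => f x + g x).
Proof.
elim: k f g => [|k IH] f g sf sg.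
  by apply: smoothn0 => x; apply: cdiffD; [exact: (smoothn_cdiff sf)|exact: (smoothn_cdiff sg)].
apply: smoothnS => [x|i]; first by apply: cdiffD; [exact: (smoothn_cdiff sf)|exact: (smoothn_cdiff sg)].
rewrite (_ : partial i _ = (fun x => partial i f x + partial i g x)).
  by apply: IH; exact: smoothn_partial.
by apply/funext => x; apply: partialD; [exact: (smoothn_cdiff sf)|exact: (smoothn_cdiff sg)].
Qed.

Lemma smoothnM k f g : smoothn k f -> smoothn k g ->
  smoothn k (fun x => f x * g x).
Proof.
elim: k f g => [|k IH] f g sf sg.
  by apply: smoothn0 => x; apply: cdiffM; [exact: (smoothn_cdiff sf)|exact: (smoothn_cdiff sg)].
apply: smoothnS => [x|i]; first by apply: cdiffM; [exact: (smoothn_cdiff sf)|exact: (smoothn_cdiff sg)].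
rewrite (_ : partial i _ =
    (fun x => partial i f x * g x + f x * partial i g x)).
  by apply: smoothnD; apply: IH;
    by [exact: smoothn_partial|exact: smoothn_le (leqnSn _) _].
by apply/funext => x; apply: partialM; [exact: (smoothn_cdiff sf)|exact: (smoothn_cdiff sg)].
Qed.

Lemma smoothn_cst k (c : C) : smoothn k (fun=> c).
Proof.
elim: k c => [|k IH] c; first by apply: smoothn0 => x; exact: cdiff_cst.
apply: smoothnS => [x|i]; first exact: cdiff_cst.
by rewrite (_ : partial i _ = fun=> 0)//; apply/funext => x; exact: partial_cst.
Qed.

Lemma smoothn_aff k f (a : R) b : smoothn k f -> smoothn k (f \o aff a b).
Proof.
elim: k f => [|k IH] f sf.
  by apply: smoothn0 => x; apply: cdiff_aff; exact: (smoothn_cdiff sf).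
apply: smoothnS => [x|i]; first by apply: cdiff_aff; exact: (smoothn_cdiff sf).
rewrite (_ : partial i _ = (fun x => a%:C%C * (partial i f \o aff a b) x)).
  by apply: smoothnM; [exact: smoothn_cst|apply: IH; exact: smoothn_partial].
by apply/funext => x; apply: partial_aff; exact: (smoothn_cdiff sf).
Qed.

(** The exponent is an integer, so that Schwartz functions (all [z]) and
    functions of polynomial growth (some negative [z]) are treated alike and
    exponents simply add up in products. *)
Definition dbound (k : nat) (z : int) f (A : R) : Prop :=
  forall l x, (size l <= k)%N -> wt x ^ z * cmod (partials l f x) <= A.

Lemma wtz_gt0 z x : 0 < wt x ^ z. Proof. exact: exprz_gt0. Qed.
Lemma wtz_ge0 z x : 0 <= wt x ^ z. Proof. exact: ltW (wtz_gt0 z x). Qed.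
Local Hint Extern 0 (is_true (@Order.lt _ _ _ (wt _ ^ _))) =>
  solve [exact: wtz_gt0] : core.
Local Hint Extern 0 (is_true (@Order.le _ _ _ (wt _ ^ _))) =>
  solve [exact: wtz_ge0] : core.
Lemma wtzD z z' x : wt x ^ (z + z') = wt x ^ z * wt x ^ z'.
Proof. by rewrite expfzDr// gt_eqF//. Qed.
Lemma ler_wtz z z' x : z <= z' -> wt x ^ z <= wt x ^ z'.
Proof. by move=> zz'; rewrite ler_weXz2l. Qed.

Lemma dbound0 z f A : (forall x, wt x ^ z * cmod (f x) <= A) -> dbound 0 z f A.
Proof. by move=> h [|//] x _; exact: h. Qed.

Lemma dboundS k z f A : (forall x, wt x ^ z * cmod (f x) <= A) ->
  (forall i, dbound k z (partial i f) A) -> dbound k.+1 z f A.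
Proof.
move=> h h'; case/lastP => [x _|l i x]; first exact: h.
by rewrite size_rcons ltnS partials_rcons; exact: h'.
Qed.

Lemma dbound_val k z f A : dbound k z f A ->
  forall x, wt x ^ z * cmod (f x) <= A.
Proof. by move=> bf x; exact: (bf [::] x (leq0n _)). Qed.

Lemma dbound_partial k z i f A : dbound k.+1 z f A -> dbound k z (partial i f) A.
Proof.
by move=> bf l x lk; rewrite -partials_rcons; apply: bf; rewrite size_rcons.
Qed.

Lemma dbound_ge0 k z f A : dbound k z f A -> 0 <= A.
Proof. by move=> /dbound_val/(_ 0); apply: le_trans; rewrite mulr_ge0. Qed.

Lemma dbound_le k k' z z' f A A' : (k' <= k)%N -> z' <= z -> A <= A' ->
  dbound k z f A -> dbound k' z' f A'.
Proof.
move=> kk' zz' AA' bf l x lk; apply: le_trans AA'.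
by apply: le_trans (bf l x (leq_trans lk kk')); rewrite ler_wpM2r// ler_wtz.
Qed.

Lemma dboundD k z f g A B : smoothn k f -> smoothn k g ->
  dbound k z f A -> dbound k z g B -> dbound k z (fun x => f x + g x) (A + B).
Proof.
elim: k f g => [|k IH] f g sf sg bf bg.
  apply: dbound0 => x; apply: (@le_trans _ _ (wt x ^ z * (cmod (f x) + cmod (g x)))).
    by rewrite ler_wpM2l// cmodD.
  by rewrite mulrDr; apply: lerD; solve[exact: (dbound_val bf)|exact: (dbound_val bg)].
apply: dboundS => [x|i].
  apply: (@le_trans _ _ (wt x ^ z * (cmod (f x) + cmod (g x)))).
    by rewrite ler_wpM2l// cmodD.
  by rewrite mulrDr; apply: lerD; solve[exact: (dbound_val bf)|exact: (dbound_val bg)].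
rewrite (_ : partial i _ = (fun x => partial i f x + partial i g x)).
  by apply: IH; (exact: smoothn_partial || exact: dbound_partial).
by apply/funext => x; apply: partialD; [exact: (smoothn_cdiff sf)|exact: (smoothn_cdiff sg)].
Qed.

(** Each application of Leibniz' rule doubles the number of terms, whence the
    power of 2. *)
Lemma dboundM k z z' f g A B : smoothn k f -> smoothn k g ->
  dbound k z f A -> dbound k z' g B ->
  dbound k (z + z') (fun x => f x * g x) (2 ^+ k * (A * B)).
Proof.
have base h1 h2 x : dbound 0 z h1 A -> dbound 0 z' h2 B ->
    wt x ^ (z + z') * cmod (h1 x * h2 x) <= A * B.
  move=> b1 b2; rewrite wtzD cmodM mulrACA ler_pM ?mulr_ge0//.
    exact: (dbound_val b1).
  exact: (dbound_val b2).
elim: k f g => [|k IH] f g sf sg bf bg.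
  by apply: dbound0 => x; rewrite expr0 mul1r; exact: base.
have AB : 0 <= A * B.
  by rewrite mulr_ge0//; [exact: dbound_ge0 bf|exact: dbound_ge0 bg].
apply: dboundS => [x|i].
  apply: (@le_trans _ _ (A * B)).
    by apply: base; [exact: dbound_le bf|exact: dbound_le bg].
  by rewrite ler_peMl// exprn_ege1// ler1n.
rewrite (_ : partial i _ =
    (fun x => partial i f x * g x + f x * partial i g x)); last first.
  by apply/funext => x; apply: partialM; [exact: (smoothn_cdiff sf)|exact: (smoothn_cdiff sg)].
rewrite exprS -mulrA mulr_natl mulr2n.
have [sf' sg'] := (smoothn_le (leqnSn k) sf, smoothn_le (leqnSn k) sg).
have [sf'' sg''] := (smoothn_partial i sf, smoothn_partial i sg).
apply: dboundD; [exact: smoothnM|exact: smoothnM|..].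
  by apply: IH => //; [exact: dbound_partial|exact: dbound_le bg].
by apply: IH => //; [exact: dbound_le bf|exact: dbound_partial].
Qed.

Lemma dbound_cst k z (c : C) : z <= 0 -> dbound k z (fun=> c) (cmod c).
Proof.
move=> z0; have base (b : C) x : wt x ^ z * cmod b <= cmod b.
  rewrite ler_piMl// -[1](expr0z (wt x)); exact: ler_wtz.
have: cmod (0 : C) <= cmod c by rewrite cmod0.
elim: k c => [|k IH] c c0; first exact: dbound0.
apply: dboundS => // i; rewrite (_ : partial i _ = fun=> 0).
  by apply: (dbound_le (leqnn k) (lexx z) c0); apply: IH; rewrite cmod0.
by apply/funext => x; exact: partial_cst.
Qed.

Lemma dbound_cstM k z (c : C) f A : smoothn k f -> dbound k z f A ->
  dbound k z (fun x => c * f x) (cmod c * A).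
Proof.
elim: k f => [|k IH] f sf bf.
  apply: dbound0 => x; rewrite cmodM mulrCA ler_wpM2l//; exact: (dbound_val bf).
apply: dboundS => [x|i].
  rewrite cmodM mulrCA ler_wpM2l//; exact: (dbound_val bf).
rewrite (_ : partial i _ = (fun x => c * partial i f x)).
  by apply: IH; [exact: smoothn_partial|exact: dbound_partial].
apply/funext => x; rewrite partialM; [|exact: cdiff_cst|exact: (smoothn_cdiff sf)].
by rewrite partial_cst mul0r add0r.
Qed.

Lemma dbound_aff k z f (a rho M A : R) b : smoothn k f -> dbound k z f A ->
  `|a| <= rho -> 1 <= rho -> (forall x, wt x ^ z <= M * wt (aff a b x) ^ z) ->
  dbound k z (f \o aff a b) (rho ^+ k * (M * A)).
Proof.
move=> + + ar r1 hM.
have M0 : 0 <= M.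
  have := le_trans (wtz_ge0 z 0) (hM 0); rewrite pmulr_lge0//.
have base (h : E -> C) B x : dbound 0 z h B ->
    wt x ^ z * cmod ((h \o aff a b) x) <= M * B.
  move=> bh; apply: (@le_trans _ _ (M * (wt (aff a b x) ^ z * cmod (h (aff a b x))))).
    by rewrite mulrA ler_wpM2r.
  by rewrite ler_wpM2l//; exact: (dbound_val bh).
elim: k f A => [|k IH] f A sf bf.
  by apply: dbound0 => x; rewrite expr0 mul1r; exact: base.
have A0 := dbound_ge0 bf.
apply: dboundS => [x|i].
  rewrite (@le_trans _ _ (M * A))//; first by apply: base; exact: dbound_le bf.
  by rewrite ler_peMl ?mulr_ge0// exprn_ege1.
rewrite (_ : partial i _ = (fun x => a%:C%C * (partial i f \o aff a b) x)).
  rewrite exprS -mulrA.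
  have {}IH := IH _ _ (smoothn_partial i sf) (dbound_partial i bf).
  apply: (dbound_le (leqnn k) (lexx z) _ (dbound_cstM _ _ IH)).
    by rewrite cmod_real ler_wpM2r// !mulr_ge0// exprn_ge0// (le_trans ler01).
  by apply: smoothn_aff; exact: smoothn_partial.
by apply/funext => x; apply: partial_aff; exact: (smoothn_cdiff sf).
Qed.
End partial_derivatives.

#[global] Hint Extern 0 (is_true (@Order.lt _ _ _ (wt _ ^ _))) =>
  solve [exact: wtz_gt0] : core.
#[global] Hint Extern 0 (is_true (@Order.le _ _ _ (wt _ ^ _))) =>
  solve [exact: wtz_ge0] : core.

(** * Schwartz functions and their multipliers *)

Section schwartz_functions.
Context (R : realType) (d : nat).
Local Notation E := ('rV[R]_d).
Local Notation C := (R[i]).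
Implicit Types (x y v : E) (f g m : E -> C).
Local Notation e_ i := (delta_mx ord0 i : E).

Lemma enorm_ge0 x : 0 <= enorm x. Proof. exact: sqrtr_ge0. Qed.

Lemma coord_le_enorm x i : `|x ord0 i| <= enorm x.
Proof.
rewrite -sqrtr_sqr ler_wsqrtr// (bigD1 i)//= lerDl sumr_ge0// => j _.
exact: sqr_ge0.
Qed.

Lemma enorm_le_n1 x : enorm x <= n1 x.
Proof.
rewrite -[leRHS]ger0_norm// -sqrtr_sqr ler_wsqrtr// expr2 {1}/n1 mulr_suml.
apply: ler_sum => i _; rewrite -real_normK ?num_real// expr2.
by rewrite ler_wpM2l// n1_coord.
Qed.

Lemma n1_le_enorm x : n1 x <= d%:R * enorm x.
Proof.
rewrite /n1; apply: (@le_trans _ _ (\sum_(i < d) enorm x)).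
  by apply: ler_sum => i _; exact: coord_le_enorm.
by rewrite sumr_const card_ord mulr_natl.
Qed.

Lemma wt_le_enorm x : wt x <= d.+1%:R * (1 + enorm x).
Proof.
rewrite /wt; have := n1_le_enorm x; have := enorm_ge0 x.
have : 0 <= d%:R :> R by []; rewrite -natr1; nra.
Qed.

Lemma dbound_seminorm N f A : dbound N N%:Z f A ->
  (schwartz_seminorm N f <= A%:E)%E.
Proof.
move=> bA; apply: ub_ereal_sup => _ [[l x]/= lN <-]; rewrite lee_fin.
apply: le_trans (bA l x lN); rewrite ler_wpM2r//.
by rewrite -exprnP lerXn2r ?nnegrE ?addr_ge0 ?enorm_ge0// lerD2l enorm_le_n1.
Qed.

(** The weight [wt] may replace the one built on the Euclidean norm, and the
    order of the derivatives may be separated from the exponent of the weight.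
    *)
Lemma schwartzP f : schwartz f <->
  smooth f /\ forall k z, exists A, dbound k z f A.
Proof.
split=> -[sf bf]; split=> //.
  move=> k z; pose N := maxn k `|z|%N; have := bf N.
  set s := schwartz_seminorm N f => sfin.
  have h l x : (size l <= k)%N ->
      (1 + enorm x) ^+ N * cmod (partials l f x) <= fine s.
    move=> lk.
    have hs : (((1 + enorm x) ^+ N * cmod (partials l f x))%:E <= s)%E.
      by apply: ereal_sup_ubound; exists (l, x) => //=; exact: leq_trans (leq_maxl _ _).
    rewrite -lee_fin fineK// fin_numElt sfin andbT.
    by apply: lt_le_trans hs; rewrite ltNyr.
  exists (d.+1%:R ^+ N * fine s) => l x lk.
  apply: (@le_trans _ _ (wt x ^+ N * cmod (partials l f x))).
    rewrite ler_wpM2r// exprnP ler_wtz// (le_trans (ler_norm z))// -abszE lez_nat.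
    exact: leq_maxr.
  apply: (@le_trans _ _ ((d.+1%:R * (1 + enorm x)) ^+ N * cmod (partials l f x))).
    rewrite ler_wpM2r// lerXn2r// ?nnegrE ?mulr_ge0// ?wt_le_enorm//.
    by rewrite addr_ge0// enorm_ge0.
  by rewrite exprMn -mulrA ler_wpM2l// ?exprn_ge0// h.
move=> N; have [A bA] := bf N N%:Z.
by apply: le_lt_trans (dbound_seminorm bA) _; rewrite ltry.
Qed.

Lemma tempered_bound (T : dist R d) : tempered T -> exists N c, 0 <= c /\
  forall f A, schwartz f -> dbound N N%:Z f A -> cmod (T f) <= c * A.
Proof.
move=> [_ [N [c [c0 hT]]]]; exists N, c; split=> // f A sf bA.
rewrite -lee_fin EFinM; apply: le_trans (hT f sf) _.
by rewrite lee_wpmul2l ?lee_fin//; exact: dbound_seminorm.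
Qed.

Lemma schwartz_smoothn f k : schwartz f -> smoothn k f.
Proof. by move=> [sf _]; move: k; apply/smoothP. Qed.

Lemma schwartz_dbound f k z : schwartz f -> exists A, dbound k z f A.
Proof. by move=> /schwartzP[]. Qed.

(** The multipliers of the Schwartz space. Schwartz functions, plane waves,
    coordinates and smooth steps are all of this kind. *)
Definition slow m : Prop := smooth m /\ forall k, exists z A, dbound k z m A.

Lemma slow_smoothn k m : slow m -> smoothn k m.
Proof. by move=> [sf _]; move: k; apply/smoothP. Qed.

Lemma schwartz_slow f : schwartz f -> slow f.
Proof.
by move=> /schwartzP[sf bf]; split=> // k; have [A ?] := bf k 0; exists 0, A.
Qed.

Lemma slow_cst (c : C) : slow (fun=> c).
Proof.
split; first by apply/smoothP => k; exact: smoothn_cst.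
by move=> k; exists 0, (cmod c); exact: dbound_cst.
Qed.

Lemma slowD m g : slow m -> slow g -> slow (fun x => m x + g x).
Proof.
move=> sm sg; split.
  by apply/smoothP => k; apply: smoothnD; exact: slow_smoothn.
move=> k; have [[_ /(_ k)[z [A bA]]] [_ /(_ k)[z' [B bB]]]] := (sm, sg).
exists (Num.min z z'), (A + B); apply: dboundD; [exact: slow_smoothn..| |].
  by apply: dbound_le bA; rewrite // ge_min lexx.
by apply: dbound_le bB; rewrite // ge_min lexx orbT.
Qed.

Lemma slowM m g : slow m -> slow g -> slow (fun x => m x * g x).
Proof.
move=> sm sg; split.
  by apply/smoothP => k; apply: smoothnM; exact: slow_smoothn.
move=> k; have [[_ /(_ k)[z [A bA]]] [_ /(_ k)[z' [B bB]]]] := (sm, sg).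
by exists (z + z'), (2 ^+ k * (A * B)); apply: dboundM => //; exact: slow_smoothn.
Qed.

Lemma slow_partial i m : slow m -> slow (partial i m).
Proof.
move=> [sm bm]; split.
  by move=> l x; rewrite -partials_rcons; exact: sm.
move=> k; have [z [A bA]] := bm k.+1.
by exists z, A; exact: dbound_partial.
Qed.

Lemma schwartz_partial i f : schwartz f -> schwartz (partial i f).
Proof.
move=> /schwartzP[sm bm]; apply/schwartzP; split.
  by move=> l x; rewrite -partials_rcons; exact: sm.
by move=> k z; have [A bA] := bm k.+1 z; exists A; exact: dbound_partial.
Qed.

Lemma slow_schwartz m f : slow m -> schwartz f -> schwartz (fun x => m x * f x).
Proof.
move=> sm sf; apply/schwartzP; split.
  apply/smoothP => k; apply: smoothnM; first exact: slow_smoothn.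
  exact: schwartz_smoothn.
move=> k z; have [_ /(_ k)[z' [A bA]]] := sm.
have [B bB] := schwartz_dbound k (z - z') sf.
exists (2 ^+ k * (A * B)); rewrite -(subrK z' z) [z - z' + _]addrC.
by apply: dboundM => //; [exact: slow_smoothn|exact: schwartz_smoothn].
Qed.

Lemma schwartzD f g : schwartz f -> schwartz g -> schwartz (fun x => f x + g x).
Proof.
move=> sf sg; apply/schwartzP; split.
  by apply/smoothP => k; apply: smoothnD; exact: schwartz_smoothn.
move=> k z; have [A bA] := schwartz_dbound k z sf.
have [B bB] := schwartz_dbound k z sg.
by exists (A + B); apply: dboundD => //; exact: schwartz_smoothn.
Qed.

Lemma schwartzZ (c : C) f : schwartz f -> schwartz (fun x => c * f x).
Proof. by apply: slow_schwartz; exact: slow_cst. Qed.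

Lemma schwartz_aff f (a : R) b : a != 0 -> schwartz f -> schwartz (f \o aff a b).
Proof.
move=> a0 sf; apply/schwartzP; split.
  by apply/smoothP => k; apply: smoothn_aff; exact: schwartz_smoothn.
move=> k z; pose K := (1 + `|a|^-1) * wt b.
have K1 : 1 <= K.
  by rewrite -[1]mulr1 ler_pM// lerDl invr_ge0.
have hK x : wt x <= K * wt (aff a b x).
  have -> : x = a^-1 *: (aff a b x - b) by rewrite /aff addrK scalerA mulVf// scale1r.
  set y := aff a b _; apply: (@le_trans _ _ ((1 + `|a|^-1) * wt (y - b))).
    rewrite /wt n1Z normfV; have : 0 <= `|a|^-1 by rewrite invr_ge0.
    by have := n1_ge0 (y - b); nra.
  rewrite /K -mulrA ler_wpM2l ?addr_ge0 ?invr_ge0//.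
  by rewrite (le_trans (wtB _ _))// mulrC /y /aff scalerA divff// scale1r subrK.
have [B bB] := schwartz_dbound k `|z|%N sf.
exists ((1 + `|a|) ^+ k * (K ^+ `|z| * B)).
apply: (@dbound_le R d k k `|z|%N z _ _ _ (leqnn k) _ (lexx _)).
  by rewrite abszE ler_norm.
apply: dbound_aff => //; first exact: schwartz_smoothn.
- by rewrite lerDr.
- by rewrite lerDl.
move=> x; rewrite -!exprnP -exprMn lerXn2r// nnegrE// mulr_ge0//.
exact: le_trans ler01 K1.
Qed.

Lemma schwartz_opp_arg f : schwartz f -> schwartz (fun x => f (- x)).
Proof.
move=> sf; rewrite (_ : (fun x => f (- x)) = f \o aff (-1) 0).
  by apply: schwartz_aff => //; rewrite oppr_eq0 oner_eq0.
by apply/funext => x; rewrite /= /aff addr0 scaleN1r.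
Qed.

Lemma dbound_opp_arg f k z A : smoothn k f -> dbound k z f A ->
  dbound k z (fun x => f (- x)) A.
Proof.
move=> sf bf; rewrite (_ : (fun x => f (- x)) = f \o aff (-1) 0); last first.
  by apply/funext => x; rewrite /= /aff addr0 scaleN1r.
have -> : A = 1 ^+ k * (1 * A) by rewrite expr1n !mul1r.
apply: dbound_aff => //; first by rewrite normrN1.
by move=> x; rewrite /aff addr0 scaleN1r wtN mul1r.
Qed.

Lemma wt_segment x v (t : R) : 0 <= t <= 1 -> n1 v <= 1 ->
  wt x <= 2 * wt (x + t *: v).
Proof.
move=> /andP[t0 t1] v1; rewrite -{1}(addrK (t *: v) x) (le_trans (wtB _ _))//.
rewrite mulrC ler_wpM2r// /wt n1Z ger0_norm//.
by have := n1_ge0 v; nra.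
Qed.

Lemma ctaylor2 f (z : nat) (A : R) : smoothn 2 f -> dbound 2 z f A ->
  forall x v, n1 v <= 1 ->
  cmod (f (x + v) - f x - \sum_i (v ord0 i)%:C%C * partial i f x) <=
    2 * (2 ^+ z * A) * n1 v ^+ 2 / wt x ^+ z.
Proof.
move=> sf bf x v v1.
have sf1 i := smoothn_partial i sf.
pose B := 2 ^+ z * A / wt x ^+ z.
have hB (t : R) i j : 0 <= t <= 1 ->
    cmod (partial j (partial i f) (x + t *: v)) <= B.
  move=> t01; rewrite /B ler_pdivlMr ?wtX_gt0// mulrC.
  have := dbound_val (dbound_partial j (dbound_partial i bf)) (x + t *: v).
  rewrite -exprnP => H.
  apply: (@le_trans _ _ ((2 * wt (x + t *: v)) ^+ z * cmod (partial j (partial i f) (x + t *: v)))).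
    rewrite ler_wpM2r// lerXn2r// ?nnegrE//; first by rewrite mulr_ge0.
    exact: wt_segment.
  by rewrite exprMn -mulrA ler_wpM2l// exprn_ge0.
apply: le_trans (cmod_le _) _.
rewrite (_ : 2 * _ * _ / _ = B * n1 v ^+ 2 + B * n1 v ^+ 2); last first.
  by rewrite /B; field; rewrite gt_eqF// wtX_gt0.
rewrite !(Re_add, Im_add, Re_opp, Im_opp) Re_sum Im_sum.
apply: lerD.
- rewrite (eq_bigr (fun i => v ord0 i * 'D_(e_ i) (@complex.Re R \o f) x)); last first.
    by move=> i _; rewrite Re_mul Re_real Im_real mul0r subr0.
  apply: (taylor2 (f := @complex.Re R \o f)).
  + by move=> y; case: (smoothn_cdiff sf y).
  + by move=> i y; case: (smoothn_cdiff (sf1 i) y).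
  + by move=> t i j /(hB t i j); apply: le_trans; exact: (Re_le_cmod (partial j (partial i f) _)).
- rewrite (eq_bigr (fun i => v ord0 i * 'D_(e_ i) (@complex.Im R \o f) x)); last first.
    by move=> i _; rewrite Im_mul Re_real Im_real mul0r addr0.
  apply: (taylor2 (f := @complex.Im R \o f)).
  + by move=> y; case: (smoothn_cdiff sf y).
  + by move=> i y; case: (smoothn_cdiff (sf1 i) y).
  + by move=> t i j /(hB t i j); apply: le_trans; exact: (Im_le_cmod (partial j (partial i f) _)).
Qed.

Lemma ctaylor1 f (A : R) : smoothn 1 f -> dbound 1 0 f A ->
  forall x v, cmod (f (x + v) - f x) <= 2 * A * n1 v.
Proof.
move=> sf bf x v.
have hA i y : cmod (partial i f y) <= A.
  by have := dbound_val (dbound_partial i bf) y; rewrite expr0z mul1r.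
have main (h : E -> R) : (forall y, differentiable h y) ->
    (forall i y, `|'D_(e_ i) h y| <= A) -> `|h (x + v) - h x| <= A * n1 v.
  move=> dh bh; have [t _ ->] := taylor1 x v dh.
  rewrite (le_trans (ler_norm_sum _ _ _))// /n1 mulr_sumr.
  by apply: ler_sum => i _; rewrite normrM mulrC ler_wpM2r.
apply: le_trans (cmod_le _) _.
rewrite -mulrA mulr_natl mulr2n !(Re_add, Im_add, Re_opp, Im_opp).
apply: lerD.
- apply: (main (@complex.Re R \o f)) => [y|i y].
    by case: (smoothn_cdiff sf y).
  by apply: le_trans (hA i y); exact: (Re_le_cmod (partial i f y)).
- apply: (main (@complex.Im R \o f)) => [y|i y].
    by case: (smoothn_cdiff sf y).
  by apply: le_trans (hA i y); exact: (Im_le_cmod (partial i f y)).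
Qed.
End schwartz_functions.

(** * Plane waves and coordinate functions *)

Section plane_waves.
Context (R : realType) (d : nat).
Local Notation E := ('rV[R]_d).
Local Notation C := (R[i]).
Implicit Types (x y v : E) (f g m : E -> C).
Local Notation e_ i := (delta_mx ord0 i : E).

Lemma abs_sin_le (t : R) : `|sin t| <= `|t|.
Proof.
have pos (s : R) : 0 <= s -> `|sin s| <= s.
  move=> s0; have [|c _] := @MVT_segment R sin cos 0 s s0 (fun t _ => is_derive_sin t).
    by apply: continuous_subspaceT => u; exact: continuous_sin.
  rewrite sin0 !subr0 => ->; rewrite normrM (ger0_norm s0) ler_piMl//.
  by rewrite ler_norml cos_geN1 cos_le1.
have [t0|t0] := leP 0 t; first by rewrite (ger0_norm t0) pos.
by rewrite -normrN -sinN (ltr0_norm t0) pos// oppr_ge0 ltW.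
Qed.

Lemma abs_cosB1_le (t : R) : `|cos t - 1| <= t ^+ 2.
Proof.
have -> : cos t - 1 = - (sin (t / 2) ^+ 2 *+ 2).
  by rewrite [in LHS](splitr t) cosD -!expr2 cos2sin2; ring.
rewrite normrN normrMn normrX -[t ^+ 2]real_normK ?num_real//.
have := abs_sin_le (t / 2); rewrite normrM (ger0_norm (x := 2^-1))// => st.
have {}st : `|sin (t / 2)| ^+ 2 <= `|t| ^+ 2 / 4.
  rewrite (_ : _ / 4 = (`|t| / 2) ^+ 2); last by field.
  by rewrite lerXn2r// nnegrE// divr_ge0.
by rewrite mulr2n; have := sqr_ge0 `|t|; lra.
Qed.

Lemma abs_sinB_le (t : R) : `|sin t - t| <= t ^+ 2.
Proof.
have pos (s : R) : 0 <= s -> `|sin s - s| <= s ^+ 2.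
  move=> s0; have [|c] := @MVT_segment R sin cos 0 s s0 (fun t _ => is_derive_sin t).
    by apply: continuous_subspaceT => u; exact: continuous_sin.
  rewrite in_itv/= => /andP[c0 cs]; rewrite sin0 !subr0 => ->.
  have -> : cos c * s - s = (cos c - 1) * s by ring.
  have c2 : `|cos c - 1| <= s.
    have [//|] := @MVT_segment R cos (fun t => - sin t) 0 c c0 (fun t _ => is_derive_cos t).
      by apply: continuous_subspaceT => u; exact: continuous_cos.
    move=> b; rewrite in_itv/= => /andP[b0 bc]; rewrite cos0 subr0 => ->.
    rewrite normrM normrN (ger0_norm c0) (le_trans _ cs)// ler_piMl//.
    by rewrite ler_norml sin_geN1 sin_le1.
  by rewrite normrM (ger0_norm s0) expr2 ler_wpM2r.
have [t0|t0] := leP 0 t; first exact: pos.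
have e : sin (- t) - - t = - (sin t - t) by rewrite sinN; ring.
by have := pos (- t); rewrite e normrN sqrrN; apply; rewrite oppr_ge0 ltW.
Qed.

Lemma expi_taylor2 (t : R) : cmod (expi t - 1 - Complex 0 t) <= 2 * t ^+ 2.
Proof.
apply: le_trans (cmod_le _) _; rewrite /expi /= oppr0 !addr0.
by rewrite mulr_natl mulr2n lerD ?abs_cosB1_le ?abs_sinB_le.
Qed.

Lemma dotpDl x v y : dotp (x + v) y = dotp x y + dotp v y.
Proof. by rewrite /dotp -big_split/=; apply: eq_bigr => i _; rewrite mxE mulrDl. Qed.
Lemma dotpC x y : dotp x y = dotp y x.
Proof. by apply: eq_bigr => i _; rewrite mulrC. Qed.
Lemma dotpZl (a : R) x y : dotp (a *: x) y = a * dotp x y.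
Proof. by rewrite /dotp mulr_sumr; apply: eq_bigr => i _; rewrite mxE mulrA. Qed.
Lemma dotpNl x y : dotp (- x) y = - dotp x y.
Proof. by rewrite -scaleN1r dotpZl mulN1r. Qed.
Lemma dotp0l y : dotp 0 y = 0.
Proof. by rewrite /dotp big1// => i _; rewrite mxE mul0r. Qed.
Lemma dotpDr x v y : dotp y (x + v) = dotp y x + dotp y v.
Proof. by rewrite dotpC dotpDl !(dotpC y). Qed.
Lemma dotpZr (a : R) x y : dotp y (a *: x) = a * dotp y x.
Proof. by rewrite dotpC dotpZl (dotpC y). Qed.
Lemma dotpNr x y : dotp y (- x) = - dotp y x.
Proof. by rewrite dotpC dotpNl (dotpC y). Qed.
Lemma dotp_le x y : `|dotp x y| <= n1 x * n1 y.
Proof.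
rewrite (le_trans (ler_norm_sum _ _ _))// /n1 mulr_suml; apply: ler_sum => i _.
by rewrite normrM ler_wpM2l// n1_coord.
Qed.

Definition wave y : E -> C := fun x => expi (dotp x y).

Lemma wave_grad y x : cdiff (wave y) x /\
  forall i, partial i (wave y) x = Complex 0 (y ord0 i) * wave y x.
Proof.
apply: (@quad_cdiff _ _ _ _ _ (2 * n1 y ^+ 2)) => v v1.
rewrite (_ : _ - _ = (expi (dotp v y) - 1 - Complex 0 (dotp v y)) * wave y x).
  rewrite cmodM cmod_expi mulr1 (le_trans (expi_taylor2 _))//.
  rewrite -mulrA ler_wpM2l// -exprMn -real_normK ?num_real//.
  rewrite lerXn2r ?nnegrE ?mulr_ge0//.
  by rewrite mulrC dotp_le.
have -> : Complex 0 (dotp v y) = \sum_i (v ord0 i)%:C%C * Complex 0 (y ord0 i) :> C.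
  apply: complex_ext; rewrite ?Re_sum ?Im_sum /=.
    by rewrite big1// => i _; rewrite mulr0 mul0r subrr.
  by apply: eq_bigr => i _; rewrite mul0r addr0.
rewrite {1}/wave dotpDl expiD -/(wave y x) !mulrBl mulr_suml mul1r.
rewrite (mulrC (wave y x)); congr (_ - _).
by apply: eq_bigr => i _; rewrite mulrA.
Qed.

Lemma cmod_imag (t : R) : cmod (Complex 0 t) = `|t|.
Proof. by rewrite cmodE /= expr0n add0r sqrtr_sqr. Qed.

Lemma partial_wave y i : partial i (wave y) = fun x => Complex 0 (y ord0 i) * wave y x.
Proof. by apply/funext => x; have [_] := wave_grad y x. Qed.

Lemma smoothn_wave k y : smoothn k (wave y).
Proof.
elim: k => [|k IH]; first by apply: smoothn0 => x; case: (wave_grad y x).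
apply: smoothnS => [x|i]; first by case: (wave_grad y x).
by rewrite partial_wave; apply: smoothnM => //; exact: smoothn_cst.
Qed.

Lemma dbound_wave k y : dbound k 0 (wave y) (wt y ^+ k).
Proof.
elim: k => [|k IH].
  by apply: dbound0 => x; rewrite expr0z mul1r cmod_expi.
apply: dboundS => [x|i].
  by rewrite expr0z mul1r cmod_expi wtX_ge1.
rewrite partial_wave exprS.
have H := dbound_cstM (Complex 0 (y ord0 i)) (@smoothn_wave k y) IH.
apply: (dbound_le (leqnn k) (lexx 0) _ H).
by rewrite cmod_imag ler_wpM2r// ?wtX_ge0// wt_coord.
Qed.

Lemma slow_wave y : slow (wave y).
Proof.
split; first by apply/smoothP => k; exact: smoothn_wave.
by move=> k; exists 0, (wt y ^+ k); exact: dbound_wave.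
Qed.

Definition crd (i : 'I_d) : E -> C := fun x => (x ord0 i)%:C%C.

Lemma crd_grad i x : cdiff (crd i) x /\
  forall j, partial j (crd i) x = ((i == j)%:R : R)%:C%C.
Proof.
apply: (@quad_cdiff _ _ _ _ _ 0) => v _.
rewrite mul0r (bigD1 i)//= eqxx big1 ?addr0 => [|j ji]; last first.
  by rewrite eq_sym (negbTE ji) mulr0.
rewrite mulr1 /crd mxE rmorphD/= (_ : _ - _ = 0).
  by rewrite !(subr0, addr0, expr0n)/= ?addr0 sqrtr0.
by ring.
Qed.

Lemma partial_crd i j : partial j (crd i) = fun=> ((i == j)%:R : R)%:C%C.
Proof. by apply/funext => x; have [_] := crd_grad i x. Qed.

Lemma smoothn_crd k i : smoothn k (crd i).
Proof.
have c x : cdiff (crd i) x by case: (crd_grad i x).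
case: k => [|k]; first exact: smoothn0.
by apply: smoothnS => // j; rewrite partial_crd; exact: smoothn_cst.
Qed.

Lemma dbound_crd k i : dbound k (-1) (crd i) 1.
Proof.
have c x : wt x ^ (-1) * cmod (crd i x) <= 1.
  rewrite cmod_real exprN1 mulrC ler_pdivrMr// mul1r; exact: wt_coord.
case: k => [|k]; first exact: dbound0.
apply: dboundS => // j; rewrite partial_crd.
have n10 : (-1 : int) <= 0 by [].
have H := @dbound_cst R d k 0 ((i == j)%:R : R)%:C%C (lexx 0).
apply: (dbound_le (leqnn k) n10 _ H).
by rewrite cmod_real; case: eqP; rewrite ?normr1 ?normr0.
Qed.

Lemma slow_crd i : slow (crd i).
Proof.
split; first by apply/smoothP => k; exact: smoothn_crd.
by move=> k; exists (-1), 1; exact: dbound_crd.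
Qed.
End plane_waves.

(** * The Gaussian *)

Section gaussian.
Context (R : realType) (d : nat).
Local Notation E := ('rV[R]_d).
Local Notation C := (R[i]).
Implicit Types (x y v : E) (f g m : E -> C).
Local Notation e_ i := (delta_mx ord0 i : E).

Definition sqsum x : R := \sum_(i < d) x ord0 i ^+ 2.
Definition gauss x : R := expR (- (sqsum x / 2)).
Definition cgauss : E -> C := fun x => (gauss x)%:C%C.

Lemma gauss_ge0 x : 0 <= gauss x. Proof. exact: expR_ge0. Qed.
Lemma gauss_gt0 x : 0 < gauss x. Proof. exact: expR_gt0. Qed.

Lemma sqsum_grad x : differentiable (fun x => - (sqsum x / 2)) x /\
  forall i, 'D_(e_ i) (fun x => - (sqsum x / 2)) x = - x ord0 i.
Proof.
apply: (@quad_differentiable _ _ _ _ _ 1) => v _.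
have -> : - (sqsum (x + v) / 2) - - (sqsum x / 2) -
    \sum_(i < d) v ord0 i * - x ord0 i = - (sqsum v / 2).
  rewrite /sqsum -[_ / 2 in LHS]mulrC -[X in - - X]mulrC -[X in _ = - X]mulrC.
  rewrite !mulr_sumr -!sumrN -!big_split/=; apply: eq_bigr => i _.
  by rewrite !mxE; field.
rewrite normrN mul1r ger0_norm; last first.
  by rewrite divr_ge0// sumr_ge0// => i _; exact: sqr_ge0.
apply: (@le_trans _ _ (sqsum v)).
  rewrite ler_pdivrMr// ler_peMr// ?ler1n//.
  by apply: sumr_ge0 => i _; exact: sqr_ge0.
rewrite expr2 {1}/n1 mulr_suml; apply: ler_sum => i _.
by rewrite -real_normK ?num_real// expr2 ler_wpM2l// n1_coord.
Qed.

Lemma cgauss_grad x : cdiff cgauss x /\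
  forall i, partial i cgauss x = - crd i x * cgauss x.
Proof.
have [dq Dq] := sqsum_grad x.
have de (t : R) : derivable expR t 1 by exact: derivable_expR.
split; first by apply: cdiff_real; have [] := chain1 0 (de _) dq.
move=> i; rewrite partial_real.
have [_] := chain1 (e_ i) (de _) dq; rewrite -[_ \o _]/gauss => ->.
rewrite Dq (@derive_val _ _ _ _ _ _ _ (is_derive_expR _)).
by rewrite mulrC rmorphM/= rmorphN.
Qed.

(** Since [1 + t <= expR t], it suffices to bound [n * n1 x - sqsum x / 2],
    which is done by completing the square in each coordinate. *)
Lemma gauss_decay n : exists A, forall x, wt x ^+ n * gauss x <= A.
Proof.
exists (expR (\sum_(i < d) (n%:R ^+ 2 / 2))) => x.
apply: (@le_trans _ _ (expR (n1 x *+ n) * gauss x)).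
  rewrite ler_wpM2r ?gauss_ge0// -mulr_natr expRM_natr lerXn2r ?nnegrE ?expR_ge0//.
  exact: expR_ge1Dx.
rewrite /gauss -expRD ler_expR /n1 /sqsum -[(\sum_(i < d) `|_|) *+ n]mulr_natl mulr_sumr mulr_suml.
rewrite -sumrN -big_split/=; apply: ler_sum => i _.
rewrite -[x ord0 i ^+ 2]real_normK ?num_real//.
by have := sqr_ge0 (`|x ord0 i| - n%:R); nra.
Qed.

(** A derivative of [m * cgauss] is again a multiplier times the Gaussian,
    with the multiplier [partial i m - crd i * m]; hence the induction over
    all [m] at once. *)
Lemma slow_cgauss_aux k m : slow m -> smoothn k (fun x => m x * cgauss x) /\
  forall z, exists A, dbound k z (fun x => m x * cgauss x) A.
Proof.
elim: k m => [|k IH] m sm.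
  split.
    by apply: smoothn0 => x; apply: cdiffM;
      [exact: (smoothn_cdiff (slow_smoothn sm : smoothn 0 m))|case: (cgauss_grad x)].
  move=> z; have [_ /(_ 0%N)[z' [A bA]]] := sm.
  have [B hB] := gauss_decay `|z - z'|%N.
  exists (A * B); apply: dbound0 => x; rewrite cmodM cmod_real ger0_norm ?gauss_ge0//.
  rewrite -(subrK z' z) [z - z' + _]addrC wtzD mulrACA; apply: ler_pM.
  - by rewrite mulr_ge0.
  - by rewrite mulr_ge0 ?gauss_ge0.
  - exact: (dbound_val bA).
  - apply: le_trans (hB x); rewrite ler_wpM2r ?gauss_ge0// exprnP ler_wtz//.
    by rewrite abszE ler_norm.
have cd x : cdiff (fun x => m x * cgauss x) x.
  apply: cdiffM; last by case: (cgauss_grad x).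
  exact: (smoothn_cdiff (slow_smoothn sm : smoothn 0 m)).
have pe i : partial i (fun x => m x * cgauss x) =
    fun x => (partial i m x + (-1) * (crd i x * m x)) * cgauss x.
  apply/funext => x; have [cx px] := cgauss_grad x.
  rewrite partialM//; last exact: (smoothn_cdiff (slow_smoothn sm : smoothn 0 m)).
  by rewrite px; ring.
have sm' i : slow (fun x => partial i m x + (-1) * (crd i x * m x)).
  apply: slowD; first exact: slow_partial.
  by apply: slowM; [exact: slow_cst|apply: slowM => //; exact: slow_crd].
split; first by apply: smoothnS => // i; rewrite pe; have [] := IH _ (sm' i).
move=> z.
have /choice[A hA] : forall i, exists A, dbound k z (partial i (fun x => m x * cgauss x)) A.
  by move=> i; rewrite pe; have [_] := IH _ (sm' i).
have [_ /(_ z)[A0 bA0]] := IH _ sm.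
exists (A0 + \sum_i A i); have Ai i : 0 <= A i by exact: (dbound_ge0 (hA i)).
apply: dboundS => [x|i].
  by rewrite (le_trans (dbound_val bA0 x))// lerDl sumr_ge0.
apply: (dbound_le (leqnn k) (lexx z) _ (hA i)).
rewrite (bigD1 i)//= addrCA lerDl addr_ge0//; first exact: (dbound_ge0 bA0).
by rewrite sumr_ge0.
Qed.

Lemma slow_cgauss m : slow m -> schwartz (fun x => m x * cgauss x).
Proof.
move=> sm; apply/schwartzP; split.
  by apply/smoothP => k; have [] := slow_cgauss_aux k sm.
by move=> k z; have [_] := slow_cgauss_aux k sm.
Qed.

Lemma schwartz_cgauss : schwartz cgauss.
Proof.
rewrite (_ : cgauss = fun x => 1 * cgauss x); last first.
  by apply/funext => x; rewrite mul1r.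
by apply: slow_cgauss; exact: slow_cst.
Qed.
End gaussian.

(** * Smooth steps *)

Section sigmoids.
Context (R : realType) (d : nat).
Local Notation E := ('rV[R]_d).
Local Notation C := (R[i]).
Implicit Types (x y v : E).
Local Notation e_ i := (delta_mx ord0 i : E).

(** This sigmoid solves the autonomous equation s' = s (1 - s), so that its
    derivatives are polynomials in itself, hence bounded. *)
Definition logistic (t : R) : R := (1 + expR (- t))^-1.

Lemma logistic_gt0 t : 0 < logistic t.
Proof. by rewrite invr_gt0 addr_gt0 ?expR_gt0. Qed.
Lemma logistic_lt1 t : logistic t < 1.
Proof. by rewrite invf_lt1 ?ltrDl ?expR_gt0// addr_gt0 ?expR_gt0. Qed.

Lemma is_derive_logistic (t : R) :
  is_derive t (1 : R) logistic (logistic t * (1 - logistic t)).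
Proof.
have n0 (s : R) : 1 + expR (- s) != 0 by rewrite gt_eqF// addr_gt0 ?expR_gt0.
have h : is_derive t 1 (fun s : R => 1 + expR (- s)) (- expR (- t)).
  have := is_deriveD (is_derive_cst (1 : R) t (1 : R))
    (is_derive1_comp (is_derive_expR (- t)) (is_deriveN (is_derive_id t (1 : R)))).
  by rewrite add0r mulrN1.
have h' := @is_deriveV R (fun s : R => 1 + expR (- s)) t _ _ (n0 t) h.
have -> : logistic t * (1 - logistic t) = - (1 + expR (- t)) ^- 2 *: - expR (- t).
  rewrite /logistic /GRing.scale/=; have := n0 t; set u := expR _ => u0.
  by field; exact: u0.
exact: h'.
Qed.

Definition plogistic (p : {poly R}) (a b : R) (i : 'I_d) : E -> C :=
  fun x => (p.[logistic (a * x ord0 i + b)])%:C%C.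

Lemma plogistic_grad p a b i x : cdiff (plogistic p a b i) x /\
  forall j, partial j (plogistic p a b i) x =
    (a *+ (i == j))%:C%C * plogistic (p^`()%R * ('X * (1 - 'X))) a b i x.
Proof.
pose h : R -> R := fun t => p.[logistic (a * t + b)].
have dp (t : R) : is_derive t 1 (fun t => p.[t]) (p^`()%R).[t].
  apply: DeriveDef; first exact: derivable_horner.
  by rewrite -derive1E derivE.
have dl (t : R) : is_derive t 1 (fun t => a * t + b) a.
  have := is_deriveD (is_deriveZ a (is_derive_id t (1 : R)))
    (is_derive_cst b t (1 : R)).
  by rewrite addr0 /GRing.scale/= mulr1.
have dh (t : R) : is_derive t 1 h (a * (p^`()%R * ('X * (1 - 'X))).[logistic (a * t + b)]).
  have h1 := @is_derive1_comp R logistic (fun t => a * t + b) t _ _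
     (is_derive_logistic _) (dl t).
  have h2 := @is_derive1_comp R (fun t => p.[t]) _ t _ _ (dp _) h1.
  have -> : a * (p^`()%R * ('X * (1 - 'X))).[logistic (a * t + b)] =
      (p^`()%R).[logistic (a * t + b)] *
      (logistic (a * t + b) * (1 - logistic (a * t + b)) * a).
    by rewrite !hornerE /=; ring.
  exact: h2.
have dc : differentiable (fun x : E => x ord0 i : R) x by exact: differentiable_coord.
have dhd (t : R) : derivable h t 1 by exact: (@ex_derive _ _ _ _ _ _ _ (dh t)).
split.
  by apply: (@cdiff_real _ _ (fun x : E => h (x ord0 i)));
    have [] := chain1 0 (dhd _) dc.
move=> j; rewrite (@partial_real _ _ j (fun x : E => h (x ord0 i))).
have [_ ->] := chain1 (e_ j) (dhd (x ord0 i)) dc.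
rewrite (@derive_val _ _ _ _ _ _ _ (dh _)).
have -> : 'D_(e_ j) (fun x : E => x ord0 i : R) x = (i == j)%:R.
  by have [_ /(_ j) /(congr1 (@complex.Re R))] := crd_grad i x.
rewrite /plogistic -rmorphM/=; congr ((_)%:C%C).
by rewrite mulr_natr -mulrnAl.
Qed.

Lemma plogistic_bound k p a b i : smoothn k (plogistic p a b i) /\
  exists A, dbound k 0 (plogistic p a b i) A.
Proof.
(* Polynomials are bounded on the interval [0, 1], where the logistic function
   takes its values. *)
have base q : exists A, forall x, wt x ^ 0 * cmod (plogistic q a b i x) <= A.
  exists (\sum_(j < size q) `|q`_j|) => x; rewrite expr0z mul1r cmod_real.
  rewrite horner_coef (le_trans (ler_norm_sum _ _ _))//; apply: ler_sum => j _.
  rewrite normrM ler_piMr// normrX ger0_norm ?(ltW (logistic_gt0 _))//.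
  by rewrite exprn_ile1// ltW// ?logistic_gt0 ?logistic_lt1.
elim: k p => [|k IH] p.
  split; first by apply: smoothn0 => x; case: (plogistic_grad p a b i x).
  by have [A hA] := base p; exists A; exact: dbound0.
have pe j : partial j (plogistic p a b i) = fun x =>
    (a *+ (i == j))%:C%C * plogistic (p^`()%R * ('X * (1 - 'X))) a b i x.
  by apply/funext => x; have [_] := plogistic_grad p a b i x.
have [IH1 [A bA]] := IH (p^`()%R * ('X * (1 - 'X))).
have [B bB] := base p.
have A0 := dbound_ge0 bA.
split.
  apply: smoothnS => [x|j]; first by case: (plogistic_grad p a b i x).
  by rewrite pe; apply: smoothnM => //; exact: smoothn_cst.
exists (B + `|a| * A); apply: dboundS => [x|j].
  by rewrite (le_trans (bB x))// lerDl mulr_ge0.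
rewrite pe; have H := dbound_cstM (a *+ (i == j))%:C%C IH1 bA.
apply: (dbound_le (leqnn k) (lexx 0) _ H); rewrite cmod_real.
have B0 : 0 <= B by apply: le_trans (bB 0); rewrite mulr_ge0.
rewrite -[leLHS]add0r lerD// ler_wpM2r//.
by case: eqP => _; rewrite ?mulr1n ?mulr0n ?normr0.
Qed.

Lemma slow_plogistic p a b i : slow (plogistic p a b i).
Proof.
split; first by apply/smoothP => k; have [] := plogistic_bound k p a b i.
by move=> k; have [_ [A bA]] := plogistic_bound k p a b i; exists 0, A.
Qed.

(** The dilation by [n ^ 2] makes the steps steeper and the shift by [n] makes
    their limit vanish on the boundary hyperplane as well, so that they
    approximate the indicator of an open half-space. *)
Definition step (n : nat) (ia : 'I_d * R) x : R :=
  logistic (n%:R ^+ 2 * (x ord0 ia.1 - ia.2) - n%:R).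
Definition steps n (L : seq ('I_d * R)) x : R := \prod_(ia <- L) step n ia x.
Definition test n L : E -> C := fun x => (steps n L x)%:C%C * cgauss x.

Lemma steps_ge0 n L x : 0 <= steps n L x.
Proof. by apply: prodr_ge0 => ia _; exact/ltW/logistic_gt0. Qed.
Lemma steps_le1 n L x : steps n L x <= 1.
Proof.
by apply: prodr_ile1 => ia _; rewrite !ltW// ?logistic_gt0// logistic_lt1.
Qed.

Lemma slow_steps n L : slow (fun x => (steps n L x)%:C%C).
Proof.
elim: L => [|ia L IH].
  rewrite (_ : (fun _ => _) = fun=> 1); first exact: slow_cst.
  by apply/funext => x; rewrite /steps big_nil.
rewrite (_ : (fun _ => _) = fun x =>
   plogistic 'X (n%:R ^+ 2) (- (n%:R ^+ 2 * ia.2) - n%:R) ia.1 x * (steps n L x)%:C%C).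
  by apply: slowM => //; exact: slow_plogistic.
apply/funext => x; rewrite /steps big_cons rmorphM/=; congr (_ * _).
by rewrite /plogistic hornerX /step mulrBr addrA.
Qed.

Lemma schwartz_test n L : schwartz (test n L).
Proof. by apply: slow_cgauss; exact: slow_steps. Qed.
End sigmoids.

(** * Affine substitutions and product integrands *)

Section lebesgue_line.
Context (R : realType).
Local Notation leb := (@lebesgue_measure R).
Local Open Scope ereal_scope.

Definition affl (a b t : R) : R := (a * t + b)%R.

Local Notation T := (measurableTypeR R).

Lemma measurable_affl a b : measurable_fun setT (affl a b : T -> T).
Proof. by apply: measurable_funD => //; exact: mulrl_measurable. Qed.

Lemma affl_preimage_ocitv (a b c e : R) : a != 0%R ->
  leb (affl a b @^-1` `]c, e]%classic) = (`|a|^-1)%:E * leb `]c, e]%classic.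
Proof.
move=> a0; have [ap|an] := ltP 0%R a.
  rewrite (_ : _ @^-1` _ = `]((c - b) / a)%R, ((e - b) / a)%R]%classic); last first.
    apply/seteqP; split => t /=; rewrite !in_itv/= /affl;
      by rewrite ltr_pdivrMr// ler_pdivlMr// ltrBlDr lerBrDr mulrC.
  rewrite !lebesgue_measure_itv/= !lte_fin gtr0_norm//.
  rewrite ltr_pM2r ?invr_gt0// ltrD2r; case: ifPn => ce; last by rewrite mule0.
  by rewrite -!EFinB -EFinM; congr EFin; field.
have {}an : (a < 0)%R by rewrite lt_neqAle a0.
rewrite (_ : _ @^-1` _ = `[((e - b) / a)%R, ((c - b) / a)%R[%classic); last first.
  apply/seteqP; split => t /=; rewrite !in_itv/= /affl;
    by rewrite ler_ndivrMr// ltr_ndivlMr// ltrBlDr lerBrDr mulrC andbC.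
rewrite !lebesgue_measure_itv/= !lte_fin ltr0_norm//.
rewrite ltr_nM2r ?invr_lt0// ltrD2r; case: ifPn => ce; last by rewrite mule0.
by rewrite -!EFinB -EFinM; congr EFin; field.
Qed.

Lemma affl_image_measure (a b : R) : exists m : {measure set T -> \bar R},
  (m : set T -> \bar R) = pushforward leb (affl a b : T -> T).
Proof.
unshelve (refine (ex_intro _ (pushforward leb (affl a b : T -> T)
  : {measure set T -> \bar R}) _)); [exact: measurable_affl|by []].
Qed.

(** The image of Lebesgue measure under an affine map is a multiple of it,
    since this holds on intervals. *)
Lemma ge0_integral_affl (a b : R) (f : T -> \bar R) : a != 0%R ->
  measurable_fun setT f -> (forall t, 0 <= f t) ->
  \int[leb]_t f (affl a b t) = (`|a|^-1)%:E * \int[leb]_t f t.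
Proof.
move=> a0 mf f0; have [pf pfE] := affl_image_measure a b.
pose m := mscale (NngNum (normr_ge0 a)) pf.
have lebE A : measurable A -> leb A = m A.
  move=> mA; apply: lebesgue_measure_unique mA.
  move=> X [[c e] _ <-] /=; rewrite /m /mscale pfE /pushforward /=.
  rewrite affl_preimage_ocitv// muleA -EFinM divff ?mul1e//.
  by rewrite normr_eq0.
have -> : \int[leb]_t f t = `|a|%:E * \int[leb]_t f (affl a b t).
  rewrite (@eq_measure_integral _ _ _ setT m leb f); last first.
    by move=> A mA _; exact: lebE.
  rewrite ge0_integral_mscale//= pfE; congr (_ * _).
  by rewrite (ge0_integral_pushforward (measurable_affl a b)).
by rewrite muleA -EFinM mulVf ?mul1e// normr_eq0.
Qed.
End lebesgue_line.

Section lebesgue_space.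
Context (R : realType).
Local Notation leb := (@lebesgue_measure R).
Local Notation mu n := (lebesgue_rV R n).
Local Open Scope ereal_scope.

Lemma measurable_affE n (a : R) (b : 'rV[R]_n) : measurable_fun setT (aff a b).
Proof.
apply: measurable_fun_rVP => i.
rewrite (_ : _ \o _ = affl a (b ord0 i) \o rV_coord i).
  by apply: measurableT_comp; [exact: measurable_affl|exact: measurable_rV_coord].
by apply/funext => x; rewrite /rV_coord /aff /affl /= !mxE.
Qed.

Lemma ge0_integral_rVS n (f : 'rV[R]_n.+1 -> \bar R) :
  measurable_fun setT f -> (forall x, 0 <= f x) ->
  \int[mu n.+1]_x f x = \int[leb]_s \int[mu n]_y f (cons_rV (s, y)).
Proof.
move=> mf f0.
rewrite [LHS](@ge0_integral_pushforward _ _ _ _ _ _ (@measurable_cons_rV R n))//.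
rewrite preimage_setT fubini_tonelli1//; last by move=> x; exact: f0.
by apply: measurableT_comp => //; exact: measurable_cons_rV.
Qed.

Lemma measurable_cons_pair n (s : R) :
  measurable_fun setT (fun y : 'rV[R]_n => cons_rV (s, y)).
Proof.
apply: measurableT_comp; first exact: measurable_cons_rV.
exact: measurable_pair1.
Qed.

(** The measure on R^(n+1) being the image of a product, the claim reduces to
    one coordinate at a time. *)
Lemma ge0_integral_aff n (a : R) (b : 'rV[R]_n) (f : 'rV[R]_n -> \bar R) :
  a != 0%R -> measurable_fun setT f -> (forall x, 0 <= f x) ->
  \int[mu n]_x f (aff a b x) = (`|a|^-1 ^+ n)%:E * \int[mu n]_x f x.
Proof.
move=> a0; elim: n b f => [|n IH] b f mf f0.
  rewrite expr0 mul1e; apply: eq_integral => x _; congr f.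
  by apply/rowP => -[].
rewrite ge0_integral_rVS//; last first.
  by apply: measurableT_comp => //; exact: measurable_affE.
pose b' : 'rV[R]_n := \row_j b ord0 (lift ord0 j).
have E s y : aff a b (cons_rV (s, y)) = cons_rV (affl a (b ord0 ord0) s, aff a b' y).
  apply/rowP => i; rewrite /aff /affl !mxE /=.
  by have [j ->|->] := unliftP ord0 i; rewrite ?liftK ?unlift_none /= ?mxE.
pose g s := \int[mu n]_y f (cons_rV (s, y)).
have mg : measurable_fun setT g.
  apply: (measurable_fun_fubini_tonelli_F (fun p => f (cons_rV p))) => //.
  by apply: measurableT_comp => //; exact: measurable_cons_rV.
have g0 s : 0 <= g s by apply: integral_ge0 => y _; exact: f0.
transitivity (\int[leb]_s ((`|a|^-1 ^+ n)%:E * g (affl a (b ord0 ord0) s))).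
  apply: eq_integral => s _; under eq_integral do rewrite E.
  rewrite (IH b' (fun y => f (cons_rV (affl a (b ord0 ord0) s, y))))//.
  by apply: measurableT_comp => //; exact: measurable_cons_pair.
rewrite ge0_integralZl//; last first.
  exact: (measurableT_comp mg (measurable_affl _ _)).
rewrite ge0_integral_affl// muleA -EFinM exprSr; congr (_ * _).
by rewrite [RHS]ge0_integral_rVS.
Qed.

Lemma integral_prod_coord n (h : 'I_n -> R -> R) (c : R) :
  (forall i, measurable_fun setT (h i : measurableTypeR R -> R)) -> (forall i t, (0 <= h i t)%R) ->
  (forall i, \int[leb]_t (h i t)%:E = c%:E) ->
  \int[mu n]_x (\prod_i h i (x ord0 i))%:E = (c ^+ n)%:E.
Proof.
move=> mh h0 hc; elim: n h mh h0 hc => [|n IH] h mh h0 hc.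
  rewrite (eq_integral (fun=> 1%:E)); last by move=> x _; rewrite big_ord0.
  by rewrite integral_cst//= mul1e [LHS]diracT.
have c0 : (0 <= c)%R.
  rewrite -lee_fin -(hc ord0); apply: integral_ge0 => t _.
  by rewrite lee_fin.
have mp m (k : 'I_m -> R -> R) : (forall i, measurable_fun setT (k i : measurableTypeR R -> R)) ->
    measurable_fun setT (fun x : 'rV[R]_m => (\prod_i k i (x ord0 i))%R).
  move=> mk; apply: measurable_prod => i _.
  apply: (measurableT_comp (mk i)); exact: (@measurable_rV_coord R m i).
rewrite ge0_integral_rVS; last 2 first.
- by apply/measurable_EFinP; exact: mp.
- by move=> x; rewrite lee_fin prodr_ge0.
transitivity (\int[leb]_s ((c ^+ n)%:E * (h ord0 s)%:E)).
  apply: eq_integral => s _.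
  rewrite (eq_integral (fun y : 'rV[R]_n => (h ord0 s)%:E *
     (\prod_i h (lift ord0 i) (y ord0 i))%:E)); last first.
    move=> y _; rewrite big_ord_recl -EFinM; congr (EFin (h ord0 _ * _)%R).
      by rewrite mxE unlift_none.
    by apply: eq_bigr => i _; rewrite mxE liftK.
  rewrite ge0_integralZl//; last 3 first.
  - by apply/measurable_EFinP; apply: (mp n (fun i => h (lift ord0 i))).
  - by move=> y _; rewrite lee_fin prodr_ge0.
  - by rewrite lee_fin.
  by rewrite (IH (fun i => h (lift ord0 i)))// muleC.
rewrite ge0_integralZl//; last 3 first.
- by apply/measurable_EFinP.
- by move=> t _; rewrite lee_fin.
- by rewrite lee_fin exprn_ge0.
by rewrite hc -EFinM exprSr.
Qed.
End lebesgue_space.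

(** * Borel sets *)

Section borel_space.
Context (R : realType) (d : nat).
Local Notation E := ('rV[R]_d).
Local Notation C := (R[i]).

Lemma measurable_coordE (i : 'I_d) : measurable_fun setT (fun x : E => x ord0 i).
Proof. exact: (@measurable_rV_coord R d i). Qed.

(** The boxes with a rational centre and a radius [1 / n] form a countable
    base of the topology. *)
Lemma open_measurable_rV (U : set E) : open U -> measurable U.
Proof.
move=> oU.
pose B (q : 'rV[rat]_d * nat) : set E :=
  [set y | forall i, `|ratr (q.1 ord0 i) - y ord0 i| < q.2.+1%:R^-1].
have mB q : measurable (B q).
  rewrite (_ : B q = \bigcap_(i in [set: 'I_d])
     (fun y : E => y ord0 i) @^-1` ball (ratr (q.1 ord0 i) : R) q.2.+1%:R^-1).
    apply: fin_bigcap_measurable => // i _.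
    rewrite -[X in measurable X]setTI; apply: measurable_coordE => //.
    exact: measurable_ball.
  apply/seteqP; split => y /=; first by move=> h i _; exact: h.
  by move=> h i; exact: h.
rewrite (_ : U = \bigcup_(q in [set: 'rV[rat]_d * nat])
    (if `[< B q `<=` U >] then B q else set0)).
  apply: countable_bigcupT_measurable => //.
  by move=> q; case: ifP => _ //; exact: measurable0.
apply/seteqP; split => x; last first.
  by move=> [q _]; case: asboolP => // BU; exact: BU.
move=> Ux; have /nbhs_ballP[e /= e0 xeU] : nbhs x U by exact: open_nbhs_nbhs.
(* A box of radius [n.+1%:R^-1] that contains [x] lies within twice this
   radius of [x], for the maximum norm. *)
pose n := Num.truncn (2 / e).
have n2e : 2 / n.+1%:R < e.
  rewrite ltr_pdivrMr// -ltr_pdivrMl// mulrC.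
  by rewrite truncnS_gt.
have /choice[q hq] : forall i, exists q : rat, `|ratr q - x ord0 i| < n.+1%:R^-1 :> R.
  move=> i; have h : x ord0 i - n.+1%:R^-1 < x ord0 i + n.+1%:R^-1.
    by rewrite ltrD2l gtrN// invr_gt0.
  have [q] := rat_in_itvoo h; rewrite in_itv/= => /andP[q1 q2]; exists q.
  by rewrite distrC ltr_distlC q1.
exists (\row_i q i, n) => //.
case: asboolP => [_|nBU].
  by move=> i /=; rewrite mxE.
exfalso; apply: nBU => y By; apply: xeU; split=> // i j.
rewrite (ord1 i) /ball /= /ball_ /=.
have := By j; rewrite /= mxE => h; have := hq j => h'.
rewrite -(subrKA (ratr (q j))) (le_lt_trans (ler_normD _ _))//.
rewrite (lt_trans _ n2e)// [2 / _]mulr_natl mulr2n distrC; exact: ltrD.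
Qed.

Lemma continuous_measurable_rV (f : E -> R) : continuous f ->
  measurable_fun setT f.
Proof.
move=> cf; apply: (measurability _ (RGenOInfty.measurableE R)) => //.
move=> /= _ [_ [a ->] <-]; rewrite setTI; apply: open_measurable_rV.
by apply: open_comp => // x _; exact: cf.
Qed.
End borel_space.

(** * Complex integrals *)

Section complex_measurable.
Context (R : realType) d' (T : measurableType d').
Local Notation C := (R[i]).
Implicit Types f g : T -> C.

Definition cmeas f : Prop := measurable_fun setT (@complex.Re R \o f) /\
  measurable_fun setT (@complex.Im R \o f).

Lemma cmeasD f g : cmeas f -> cmeas g -> cmeas (fun x => f x + g x).
Proof.
move=> [rf jf] [rg jg]; split.
  rewrite (_ : _ \o _ = (@complex.Re R \o f) \+ (@complex.Re R \o g)).
    exact: measurable_funD.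
  by apply/funext => x /=; rewrite Re_add.
rewrite (_ : _ \o _ = (@complex.Im R \o f) \+ (@complex.Im R \o g)).
  exact: measurable_funD.
by apply/funext => x /=; rewrite Im_add.
Qed.

Lemma cmeasM f g : cmeas f -> cmeas g -> cmeas (fun x => f x * g x).
Proof.
move=> [rf jf] [rg jg]; split.
  rewrite (_ : _ \o _ = ((@complex.Re R \o f) \* (@complex.Re R \o g)) \-
      ((@complex.Im R \o f) \* (@complex.Im R \o g))).
    by apply: measurable_funB; exact: measurable_funM.
  by apply/funext => x; exact: Re_mul.
rewrite (_ : _ \o _ = ((@complex.Re R \o f) \* (@complex.Im R \o g)) \+
    ((@complex.Im R \o f) \* (@complex.Re R \o g))).
  by apply: measurable_funD; exact: measurable_funM.
by apply/funext => x; exact: Im_mul.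
Qed.

Lemma cmeas_cst (c : C) : cmeas (fun=> c).
Proof.
by split; [exact: (measurable_cst (complex.Re c))|exact: (measurable_cst (complex.Im c))].
Qed.

Lemma cmeas_real (f : T -> R) : measurable_fun setT f -> cmeas (fun x => (f x)%:C%C).
Proof. by move=> mf; split=> //; exact: (measurable_cst (0 : R)). Qed.

Lemma cmeas_expi (f : T -> R) : measurable_fun setT f -> cmeas (fun x => expi (f x)).
Proof.
move=> mf; split.
  by apply: (measurableT_comp _ mf); apply: continuous_measurable_fun; exact: continuous_cos.
by apply: (measurableT_comp _ mf); apply: continuous_measurable_fun; exact: continuous_sin.
Qed.

Lemma measurable_cmod f : cmeas f -> measurable_fun setT (fun x => cmod (f x)).
Proof.
move=> [rf jf]; rewrite (_ : (fun _ => _) = fun x =>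
   Num.sqrt ((complex.Re (f x)) ^+ 2 + (complex.Im (f x)) ^+ 2)); last first.
  by apply/funext => x; rewrite cmodE.
apply: (measurableT_comp (continuous_measurable_fun (@sqrt_continuous R))).
by apply: measurable_funD; apply: (measurable_funX 2).
Qed.

Lemma cmeas_sum (I : Type) (r : seq I) (F : I -> T -> C) :
  (forall i, cmeas (F i)) -> cmeas (fun x => \sum_(i <- r) F i x).
Proof.
move=> mF; elim: r => [|i r IH].
  rewrite (_ : (fun _ => _) = fun=> 0); first exact: cmeas_cst.
  by apply/funext => x; rewrite big_nil.
rewrite (_ : (fun _ => _) = fun x => F i x + \sum_(j <- r) F j x).
  exact: cmeasD.
by apply/funext => x; rewrite big_cons.
Qed.
End complex_measurable.

Lemma cmeas_comp (R : realType) d1 d2 (T1 : measurableType d1)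
  (T2 : measurableType d2) (f : T2 -> R[i]) (h : T1 -> T2) :
  measurable_fun setT h -> cmeas f -> cmeas (fun x => f (h x)).
Proof. by move=> mh [rf jf]; split; [exact: (measurableT_comp rf mh)|exact: (measurableT_comp jf mh)]. Qed.

Section complex_integral.
Context (R : realType) (d : nat).
Local Notation E := ('rV[R]_d).
Local Notation C := (R[i]).
Local Notation mu := (lebesgue_rV R d).
Local Notation cint f := (cintegral setT f).
Local Notation cibl f := (cintegrable setT f).
Implicit Types f g : E -> C.

Lemma smoothn_cmeas k f : smoothn k f -> cmeas f.
Proof.
move=> sf; split; apply: continuous_measurable_rV => x;
  by have [] := cdiff_continuous (smoothn_cdiff sf x).
Qed.

Lemma cintegrableP f : cibl f <->
  cmeas f /\ (\int[mu]_x (cmod (f x))%:E < +oo)%E.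
Proof.
split=> [[/integrableP[mr ir] /integrableP[mi ii]]|[[mr mi] ifin]].
  have mf : cmeas f by split; exact/measurable_EFinP.
  split=> //; apply: (@le_lt_trans _ _
      (\int[mu]_x (`|(complex.Re (f x))%:E| + `|(complex.Im (f x))%:E|))%E).
    apply: ge0_le_integral => //=.
    - by move=> x _; rewrite lee_fin.
    - by apply/measurable_EFinP; exact: measurable_cmod.
    - by case: (mf) => m1 m2; apply: emeasurable_funD; apply/measurable_EFinP; exact: measurableT_comp.
    - by move=> x _; rewrite lee_fin cmod_le.
  by rewrite ge0_integralD//; [exact: lte_add_pinfty|exact: measurableT_comp|exact: measurableT_comp].
have mf : cmeas f by [].
split; apply/integrableP; split; [exact/measurable_EFinP| |exact/measurable_EFinP|];
  apply: le_lt_trans ifin; apply: ge0_le_integral => //=.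
- by apply/measurable_EFinP; apply: measurableT_comp.
- by apply/measurable_EFinP; exact: measurable_cmod.
- by move=> x _; rewrite lee_fin Re_le_cmod.
- by apply/measurable_EFinP; apply: measurableT_comp.
- by apply/measurable_EFinP; exact: measurable_cmod.
- by move=> x _; rewrite lee_fin Im_le_cmod.
Qed.

Lemma cintegrable_cmeas f : cibl f -> cmeas f.
Proof. by move=> /cintegrableP[]. Qed.

Lemma cintegrable_cmod f : cibl f -> (\int[mu]_x (cmod (f x))%:E < +oo)%E.
Proof. by move=> /cintegrableP[]. Qed.

Lemma le_cintegrable f g : cmeas f -> (forall x, cmod (f x) <= cmod (g x)) ->
  cibl g -> cibl f.
Proof.
move=> mf fg /cintegrableP[mg ig]; apply/cintegrableP; split=> //.
apply: le_lt_trans ig; apply: ge0_le_integral => //=.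
- by move=> x _; rewrite lee_fin.
- by apply/measurable_EFinP; exact: measurable_cmod.
- by apply/measurable_EFinP; exact: measurable_cmod.
- by move=> x _; rewrite lee_fin.
Qed.

Lemma cintegrableD f g : cibl f -> cibl g -> cibl (fun x => f x + g x).
Proof.
move=> [rf jf] [rg jg]; split.
  rewrite (_ : _ \o _ = (EFin \o (@complex.Re R \o f)) \+ (EFin \o (@complex.Re R \o g))).
    exact: integrableD.
  by apply/funext => x /=; rewrite Re_add.
rewrite (_ : _ \o _ = (EFin \o (@complex.Im R \o f)) \+ (EFin \o (@complex.Im R \o g))).
  exact: integrableD.
by apply/funext => x /=; rewrite Im_add.
Qed.

Lemma cintegrableZ (c : C) f : cibl f -> cibl (fun x => c * f x).
Proof.
move=> /cintegrableP[mf ifin]; apply/cintegrableP; split.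
  by apply: cmeasM => //; exact: cmeas_cst.
under eq_integral do rewrite cmodM EFinM.
rewrite ge0_integralZl//.
- by rewrite lte_mul_pinfty// lee_fin.
- by apply/measurable_EFinP; exact: measurable_cmod.
- by move=> x _; rewrite lee_fin.
- by rewrite lee_fin.
Qed.

Lemma cintegralD f g : cibl f -> cibl g ->
  cint (fun x => f x + g x) = cint f + cint g.
Proof.
move=> [rf jf] [rg jg]; apply: complex_ext; rewrite ?Re_add ?Im_add /=.
  rewrite -RintegralD//; apply: eq_Rintegral => x _ /=; exact: Re_add.
rewrite -RintegralD//; apply: eq_Rintegral => x _ /=; exact: Im_add.
Qed.

Lemma cintegralZ (c : C) f : cibl f -> cint (fun x => c * f x) = c * cint f.
Proof.
move=> [rf jf]; apply: complex_ext.
  rewrite Re_mul /= -!RintegralZl// -RintegralB//.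
  - apply: eq_Rintegral => x _ /=; exact: Re_mul.
  - by rewrite (_ : _ \o _ = (fun x => (complex.Re c)%:E * (EFin \o (@complex.Re R \o f)) x)%E);
      [exact: integrableZl|].
  - by rewrite (_ : _ \o _ = (fun x => (complex.Im c)%:E * (EFin \o (@complex.Im R \o f)) x)%E);
      [exact: integrableZl|].
rewrite Im_mul /= -!RintegralZl// -RintegralD//.
- apply: eq_Rintegral => x _ /=; exact: Im_mul.
- by rewrite (_ : _ \o _ = (fun x => (complex.Re c)%:E * (EFin \o (@complex.Im R \o f)) x)%E);
    [exact: integrableZl|].
- by rewrite (_ : _ \o _ = (fun x => (complex.Im c)%:E * (EFin \o (@complex.Re R \o f)) x)%E);
    [exact: integrableZl|].
Qed.

Lemma cintegral0 : cint (fun _ : E => 0 : C) = 0.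
Proof.
apply: complex_ext; rewrite /=.
  by rewrite (_ : _ \o _ = cst (0 : R))// /Rintegral integral0.
by rewrite (_ : _ \o _ = cst (0 : R))// /Rintegral integral0.
Qed.

Lemma cintegrable0 : cibl (fun _ : E => 0 : C).
Proof.
apply/cintegrableP; split; first exact: cmeas_cst.
by under eq_integral do rewrite cmod0; rewrite integral0.
Qed.

Lemma cintegral_sum (I : Type) (r : seq I) (F : I -> E -> C) :
  (forall i, cibl (F i)) -> cibl (fun x => \sum_(i <- r) F i x) /\
  cint (fun x => \sum_(i <- r) F i x) = \sum_(i <- r) cint (F i).
Proof.
move=> iF; elim: r => [|i r [IH1 IH2]].
  rewrite (_ : (fun _ => _) = fun=> 0); last by apply/funext => x; rewrite big_nil.
  by split; [exact: cintegrable0|rewrite cintegral0 big_nil].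
rewrite (_ : (fun _ => _) = fun x => F i x + \sum_(j <- r) F j x); last first.
  by apply/funext => x; rewrite big_cons.
by split; [exact: cintegrableD|rewrite cintegralD// IH2 big_cons].
Qed.

Lemma cintegralB f g : cibl f -> cibl g -> cibl (fun x => f x - g x) /\
  cint (fun x => f x - g x) = cint f - cint g.
Proof.
move=> jf jg; have jg' := cintegrableZ (-1) jg.
rewrite (_ : (fun x => f x - g x) = fun x => f x + -1 * g x); last first.
  by apply/funext => x; rewrite mulN1r.
by split; [exact: cintegrableD|rewrite cintegralD// cintegralZ// mulN1r].
Qed.

(** Real and imaginary part are estimated separately, which costs the factor
    2; no constant matters in what follows. *)
Lemma cintegral_le f (M : R) : cibl f -> (\int[mu]_x (cmod (f x))%:E <= M%:E)%E ->
  cmod (cint f) <= 2 * M.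
Proof.
move=> jf fM; have [mf ff] := cintegrable_cmeas jf; have [rf imf] := jf.
have mcf := measurable_cmod (cintegrable_cmeas jf).
apply: le_trans (cmod_le _) _; rewrite mulr_natl mulr2n /=; apply: lerD.
- rewrite (le_trans (le_normr_Rintegral _ rf))// -lee_fin /Rintegral fineK.
    apply: le_trans fM; apply: ge0_le_integral => //=.
    + by apply/measurable_EFinP; exact: measurableT_comp.
    + exact/measurable_EFinP.
    + by move=> x _; rewrite lee_fin Re_le_cmod.
  by apply: integrable_fin_num => //; exact: (integrable_norm rf).
- rewrite (le_trans (le_normr_Rintegral _ imf))// -lee_fin /Rintegral fineK.
    apply: le_trans fM; apply: ge0_le_integral => //=.
    + by apply/measurable_EFinP; exact: measurableT_comp.
    + exact/measurable_EFinP.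
    + by move=> x _; rewrite lee_fin Im_le_cmod.
  by apply: integrable_fin_num => //; exact: (integrable_norm imf).
Qed.

Lemma Rintegral_aff (h : E -> R) (a : R) b : a != 0 ->
  mu.-integrable setT (EFin \o h) ->
  Rintegral mu setT (h \o aff a b) = `|a|^-1 ^+ d * Rintegral mu setT h.
Proof.
move=> a0 ih; have mh := measurable_int mu ih.
have fh := integrable_fin_num measurableT ih.
have E1 : (\int[mu]_x ((fun x => (h (aff a b x))%:E)^\+)%E x =
    (`|a|^-1 ^+ d)%:E * \int[mu]_x ((EFin \o h)^\+)%E x)%E.
  transitivity (\int[mu]_x ((EFin \o h)^\+)%E (aff a b x))%E.
    by apply: eq_integral => x _; rewrite !funeposE.
  exact: (@ge0_integral_aff R d a b ((EFin \o h)^\+)%E a0 (measurable_funepos mh) (fun=> funepos_ge0 _ _)).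
have E2 : (\int[mu]_x ((fun x => (h (aff a b x))%:E)^\-)%E x =
    (`|a|^-1 ^+ d)%:E * \int[mu]_x ((EFin \o h)^\-)%E x)%E.
  transitivity (\int[mu]_x ((EFin \o h)^\-)%E (aff a b x))%E.
    by apply: eq_integral => x _; rewrite !funenegE.
  exact: (@ge0_integral_aff R d a b ((EFin \o h)^\-)%E a0 (measurable_funeneg mh) (fun=> funeneg_ge0 _ _)).
have E : (\int[mu]_x (h (aff a b x))%:E =
    (`|a|^-1 ^+ d)%:E * \int[mu]_x (EFin \o h) x)%E.
  rewrite (integralE _ _ (fun x => (h (aff a b x))%:E)) (integralE _ _ (EFin \o h)).
  have ad := integrable_add_def measurableT ih.
  have fa : (`|a|^-1 ^+ d)%:E \is a fin_num by [].
  by rewrite E1 E2; exact/esym/(muleBr fa ad).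
rewrite /Rintegral -[X in X * _]/(fine (`|a|^-1 ^+ d)%:E) -fineM//.
by rewrite -E.
Qed.

Lemma cintegrable_aff f (a : R) b : a != 0 -> cibl f -> cibl (f \o aff a b).
Proof.
move=> a0 /cintegrableP[mf ifin]; apply/cintegrableP; split.
  by apply: cmeas_comp => //; exact: measurable_affE.
rewrite (@ge0_integral_aff R d a b (fun x => (cmod (f x))%:E))//.
- by rewrite lte_mul_pinfty// lee_fin exprn_ge0// invr_ge0.
- by apply/measurable_EFinP; exact: measurable_cmod.
- by move=> x; rewrite lee_fin.
Qed.

Lemma cintegral_aff f (a : R) b : a != 0 -> cibl f ->
  cint (f \o aff a b) = ((`|a|^-1 ^+ d)%:C)%C * cint f.
Proof.
move=> a0 [rf jf]; apply: complex_ext.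
  by rewrite Re_mul Re_real Im_real mul0r subr0 /= -(Rintegral_aff b a0 rf).
by rewrite Im_mul Re_real Im_real mul0r addr0 /= -(Rintegral_aff b a0 jf).
Qed.

Lemma cintegral_opp f : cibl f -> cint (fun x => f (- x)) = cint f.
Proof.
move=> jf; rewrite (_ : (fun x => f (- x)) = f \o aff (-1) 0).
  by rewrite cintegral_aff ?oppr_eq0 ?oner_eq0// normrN1 invr1 expr1n mul1r.
by apply/funext => x; rewrite /= /aff addr0 scaleN1r.
Qed.

Lemma cintegral_shift f b : cibl f -> cint (fun x => f (x + b)) = cint f.
Proof.
move=> jf; rewrite (_ : (fun x => f (x + b)) = f \o aff 1 b).
  by rewrite cintegral_aff ?oner_eq0// normr1 invr1 expr1n mul1r.
by apply/funext => x; rewrite /= /aff scale1r.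
Qed.

Lemma rfubini (F : E * E -> R) : measurable_fun setT F ->
  (\int[mu]_x \int[mu]_y `|(F (x, y))%:E| < +oo)%E ->
  (forall x, mu.-integrable setT (fun y => (F (x, y))%:E)) ->
  (forall y, mu.-integrable setT (fun x => (F (x, y))%:E)) ->
  [/\ mu.-integrable setT (fun x => (Rintegral mu setT (fun y => F (x, y)))%:E),
      mu.-integrable setT (fun y => (Rintegral mu setT (fun x => F (x, y)))%:E) &
   Rintegral mu setT (fun x => Rintegral mu setT (fun y => F (x, y))) =
   Rintegral mu setT (fun y => Rintegral mu setT (fun x => F (x, y)))].
Proof.
move=> mF F12 F1 F2.
have iF : (mu \x mu)%E.-integrable setT (EFin \o F).
  by apply/integrable12ltyP => //; exact/measurable_EFinP.
have E1 : (fun x => (Rintegral mu setT (fun y => F (x, y)))%:E) =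
    (fun x => \int[mu]_y (EFin \o F) (x, y))%E.
  by apply/funext => x; rewrite /Rintegral fineK//; exact: integrable_fin_num.
have E2 : (fun y => (Rintegral mu setT (fun x => F (x, y)))%:E) =
    (fun y => \int[mu]_x (EFin \o F) (x, y))%E.
  by apply/funext => y; rewrite /Rintegral fineK//; exact: integrable_fin_num.
split; first by rewrite E1; exact: integrable_fubini_F.
  pose F' p : \bar R := (F (p.2, p.1))%:E.
  have mF' : measurable_fun setT F'.
    by apply/measurable_EFinP; apply: (measurableT_comp mF); exact: measurable_swap.
  have iF' : (mu \x mu)%E.-integrable setT F'.
    apply/integrable12ltyP; first exact: mF'.
    rewrite -(@fubini_tonelli _ _ _ _ _ mu mu (fun p => `|(F p)%:E|%E))//.
    by apply: measurableT_comp => //; exact/measurable_EFinP.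
  by rewrite E2; exact: (integrable_fubini_F iF').
rewrite [LHS]/Rintegral [RHS]/Rintegral; congr fine.
rewrite E1 E2; exact: (Fubini iF).
Qed.

(** Integrability in one variable is asked for every value of the other one,
    so that the inner integrals are meaningful everywhere, without exceptional
    null sets. *)
Lemma cfubini (F : E * E -> C) : cmeas F ->
  (\int[mu]_x \int[mu]_y (cmod (F (x, y)))%:E < +oo)%E ->
  (forall x, cibl (fun y => F (x, y))) -> (forall y, cibl (fun x => F (x, y))) ->
  [/\ cibl (fun x => cint (fun y => F (x, y))),
      cibl (fun y => cint (fun x => F (x, y))) &
      cint (fun x => cint (fun y => F (x, y))) =
      cint (fun y => cint (fun x => F (x, y)))].
Proof.
move=> mF F12 F1 F2; have [rF jF] := mF.
have mcF : measurable_fun setT (fun p => (cmod (F p))%:E).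
  by apply/measurable_EFinP; exact: measurable_cmod.
have main (pr : C -> R) : measurable_fun setT (pr \o F) ->
    (forall z, `|pr z| <= cmod z) ->
    (\int[mu]_x \int[mu]_y `|((pr \o F) (x, y))%:E| < +oo)%E.
  move=> mpr hpr; apply: le_lt_trans F12; apply: ge0_le_integral => //=.
  - by move=> x _; apply: integral_ge0 => y _; rewrite lee_fin.
  - apply: (measurable_fun_fubini_tonelli_F (fun p => `|((pr \o F) p)%:E|%E)) => //.
    by apply/measurable_EFinP; exact: measurableT_comp.
  - apply: (measurable_fun_fubini_tonelli_F (fun p => (cmod (F p))%:E)) => //.
    by move=> p; rewrite lee_fin.
  - move=> x _; apply: ge0_le_integral => //=.
    + apply/measurable_EFinP; apply: measurableT_comp => //.
      exact: (measurableT_comp mpr (measurable_pair1 x)).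
    + exact: (measurableT_comp mcF (measurable_pair1 x)).
    + by move=> y _; rewrite lee_fin.
have [r1 r2 r3] := rfubini rF (main _ rF (@Re_le_cmod R))
  (fun x => (F1 x).1) (fun y => (F2 y).1).
have [i1 i2 i3] := rfubini jF (main _ jF (@Im_le_cmod R))
  (fun x => (F1 x).2) (fun y => (F2 y).2).
by split; [split; [exact: r1|exact: i1]|split; [exact: r2|exact: i2]|
  apply: complex_ext; [exact: r3|exact: i3]].
Qed.
End complex_integral.

(** * Weights adapted to dyadic cubes *)

Section cubes.
Context (R : realType) (d : nat).
Local Notation E := ('rV[R]_d).
Local Notation mu := (lebesgue_rV R d).
Local Notation side P := (@cube_side R d P).
Local Notation Q P := (@cube_set R d P).
Implicit Types P : dyadic d.

(** The union of the cubes of the size of [P] whose indices differ from those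
    of [P] by at most [n] in each coordinate. *)
Definition nbox P (n : nat) : set E := [set x | forall i,
  side P * ((P.2 i)%:~R - n%:R) <= x ord0 i < side P * ((P.2 i)%:~R + n%:R + 1)].

Lemma side_gt0 P : 0 < side P. Proof. exact: exprz_gt0. Qed.

Lemma box_measurable (a b : 'I_d -> R) :
  measurable [set x : E | forall i, a i <= x ord0 i < b i].
Proof.
rewrite (_ : [set _ | _] = \bigcap_(i in [set: 'I_d])
   (fun x : E => x ord0 i) @^-1` `[a i, b i[%classic).
  apply: fin_bigcap_measurable => // i _.
  by rewrite -[X in measurable X]setTI; apply: (@measurable_coordE R d i).
apply/seteqP; split => x /= h i.
  by move=> _; rewrite /= in_itv/= h.
by have := h i I; rewrite /= in_itv/=.
Qed.

Lemma cube_measurable P : measurable (Q P).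
Proof. exact: box_measurable. Qed.

Lemma nbox_measurable P n : measurable (nbox P n).
Proof. exact: box_measurable. Qed.

Lemma nbox0 P : nbox P 0 = Q P.
Proof.
by apply/seteqP; split => x /= h i; have := h i; rewrite ?subr0 ?addr0.
Qed.

Lemma nbox_cover P n x : nbox P n x ->
  exists m : {ffun 'I_d -> 'I_(n.*2.+1)},
    Q (P.1, fun i => P.2 i + (m i)%:Z - n%:Z) x.
Proof.
move=> xP; have s0 := side_gt0 P.
pose t i : int := Num.floor (x ord0 i / side P).
have ht i : (t i)%:~R <= x ord0 i / side P < (t i)%:~R + 1.
  by rewrite floor_le_tmp /= -[1]/(1%:~R) -intrD floorD1_gt.
have t1 i : P.2 i - n%:Z <= t i.
  have /andP[h1 _] := xP i; rewrite /t floor_ge_int intrB.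
  by rewrite ler_pdivlMr// mulrC; exact: h1.
have t2 i : t i <= P.2 i + n%:Z.
  have /andP[_ h2] := xP i; rewrite -ltzD1 /t floor_lt_int !intrD.
  by rewrite ltr_pdivrMr// mulrC; exact: h2.
have mE i : (`|(t i - (P.2 i - n%:Z))%R|%N < n.*2.+1)%N.
  rewrite ltnS -lez_nat gez0_abs ?subr_ge0//.
  rewrite lerBlDr -addnn PoszD; have := t2 i; lia.
exists [ffun i => Ordinal (mE i)] => i /=.
rewrite ffunE /=; have -> : P.2 i + `|(t i - (P.2 i - n%:Z))%R|%N%:Z - n%:Z = t i.
  by rewrite gez0_abs ?subr_ge0//; ring.
have /andP[h1 h2] := ht i; rewrite -[@cube_side R d (_, _)]/(side P).
rewrite mulrC -ler_pdivlMr// h1 /=.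
by rewrite mulrC -ltr_pdivrMr.
Qed.

Lemma nbox_sep P n x y : 1 <= side P -> Q P x -> ~ nbox P n y ->
  n%:R <= n1 (x - y).
Proof.
move=> s1 xP /existsNP[i /negP]; have s0 := side_gt0 P.
have /andP[x1 x2] := xP i; rewrite negb_and -!ltNge -leNgt => h.
have sn : n%:R <= side P * n%:R by rewrite ler_peMl.
apply: le_trans sn _; apply: le_trans (n1_coord (x - y) i); rewrite !mxE.
case/orP: h => h.
  rewrite ler_normr; apply/orP; left.
  by move: x1 x2 h; rewrite !(mulrDr, mulrBr) => x1 x2 h; lra.
rewrite ler_normr; apply/orP; right.
by move: x1 x2 h; rewrite !(mulrDr, mulrBr) !mulr1 => x1 x2 h; lra.
Qed.

Local Open Scope ereal_scope.

Lemma integral_nbox P n (u : E -> \bar R) (A : \bar R) :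
  measurable_fun setT u -> (forall x, 0 <= u x) ->
  (forall k, \int[mu]_(x in Q (P.1, k)) u x <= A) ->
  \int[mu]_(x in nbox P n) u x <= (n.*2.+1 ^ d)%:R%:E * A.
Proof.
move=> mu_ u0 hA.
pose k (m : {ffun 'I_d -> 'I_(n.*2.+1)}) i := (P.2 i + (m i)%:Z - n%:Z)%R.
apply: (@le_trans _ _ (\sum_(m : {ffun 'I_d -> 'I_(n.*2.+1)})
   \int[mu]_(x in Q (P.1, k m)) u x)).
  under eq_bigr do rewrite integral_mkcond.
  rewrite integral_mkcond -ge0_integral_sum//; last 2 first.
  - move=> m; apply/(measurable_restrictT _ (cube_measurable _)).
    exact: measurable_funTS.
  - by move=> m x _; rewrite /patch; case: ifPn.
  apply: ge0_le_integral => //.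
  - by move=> x _; rewrite /patch; case: ifPn.
  - apply/(measurable_restrictT _ (nbox_measurable _ _)).
    exact: measurable_funTS.
  - apply: emeasurable_sum => m; apply/(measurable_restrictT _ (cube_measurable _)).
    exact: measurable_funTS.
  - move=> x _; rewrite {1}/patch; case: ifPn => [/set_mem xP|_]; last first.
      by apply: sume_ge0 => m _; rewrite /patch; case: ifPn.
    have [m xm] := nbox_cover xP; rewrite (bigD1 m)//= {1}/patch mem_set//.
    by rewrite leeDl// sume_ge0// => m' _; rewrite /patch; case: ifPn.
apply: (@le_trans _ _ (\sum_(m : {ffun 'I_d -> 'I_(n.*2.+1)}) A)).
  by apply: lee_sum => m _; exact: hA.
by rewrite sumr_const card_ffun !card_ord mule_natl.
Qed.

(** A point first reached by the [n]-th box receives the tail from [n] on of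
    the coefficients, so that this weight decays like a power of the distance
    to [P]. Being a superposition of indicators of boxes, it turns weighted
    integrals into sums of integrals over cubes of the size of [P]. *)
Definition cube_weight P (y : E) : \bar R :=
  \sum_(n <oo) ((n.+1%:R ^- (d.+2))%:E * (\1_(nbox P n) y)%:E).

Lemma cube_weight_term_ge0 P n y :
  0 <= (n.+1%:R ^- (d.+2))%:E * (\1_(nbox P n) y)%:E :> \bar R.
Proof. by rewrite mule_ge0// lee_fin// invr_ge0 exprn_ge0. Qed.

Lemma measurable_cube_weight P : measurable_fun setT (cube_weight P).
Proof.
apply: ge0_emeasurable_sum => [n x _ _|n _]; first exact: cube_weight_term_ge0.
by apply: measurable_funeM; apply/measurable_EFinP; apply: measurable_indic;
  exact: nbox_measurable.
Qed.

Lemma cube_weight_ge0 P y : 0 <= cube_weight P y.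
Proof. by apply: nneseries_ge0 => n _ _; exact: cube_weight_term_ge0. Qed.

Lemma cube_weight_ge P n y : nbox P n y ->
  (n.+1%:R ^- (d.+2))%:E <= cube_weight P y.
Proof.
move=> yP; apply: le_trans (nneseries_lim_ge n.+1 _); last first.
  by move=> k _ _; exact: cube_weight_term_ge0.
rewrite big_nat_recr//= indicE mem_set// mule1 leeDr//.
by apply: sume_ge0 => k _; exact: cube_weight_term_ge0.
Qed.

Lemma cube_weight_ge1 P y : Q P y -> 1 <= cube_weight P y.
Proof.
move=> yP; have := @cube_weight_ge P 0 y; rewrite nbox0 => /(_ yP).
by rewrite expr1n invr1.
Qed.

(** If [n] is the least index whose box contains [y], then [y] is at distance
    at least [n - 1] from [x], and the [n]-th term alone of the weight is
    large enough. As the side of [P] is at least 1, distances in units of it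
    are smaller than true distances. *)
Lemma wt_le_cube_weight P x y : (1 <= side P)%R -> Q P x ->
  ((wt (x - y) ^+ d.+2)^-1)%:E <= (2 ^+ d.+2)%:E * cube_weight P y.
Proof.
move=> s1 xP.
have [n yn nmin] : exists2 n, nbox P n y & forall m, (m < n)%N -> ~ nbox P m y.
  have ex : exists n, `[< nbox P n y >].
    (* The successor of [n] exceeds the size of [y] plus a bound for the
       corners of [P]. *)
    pose n := Num.trunc (n1 y + \sum_(i < d) (side P * (`|(P.2 i)%:~R| + 1)))%R.
    exists n.+1; apply/asboolP => i.
    have hn : (n1 y + \sum_(i < d) (side P * (`|(P.2 i)%:~R| + 1)) < n.+1%:R :> R)%R.
      exact: truncnS_gt.
    have yi := n1_coord y i.
    have si : (side P * (`|(P.2 i)%:~R| + 1) <=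
        \sum_(i < d) (side P * (`|(P.2 i)%:~R| + 1)))%R.
      rewrite (bigD1 i)//= lerDl sumr_ge0// => j _.
      by rewrite mulr_ge0 ?addr_ge0// ltW// side_gt0.
    have sn : (n.+1%:R <= side P * n.+1%:R)%R by rewrite ler_peMl.
    have s0 := side_gt0 P.
    have k1 : (`|side P * (P.2 i)%:~R| = side P * `|(P.2 i)%:~R|)%R.
      by rewrite normrM gtr0_norm.
    have k2 := ler_norm (side P * (P.2 i)%:~R)%R.
    have k3 := ler_norm (- (side P * (P.2 i)%:~R))%R.
    have y2 := ler_norm (y ord0 i); have y3 := ler_norm (- y ord0 i)%R.
    rewrite !normrN in k3 y3.
    move: si; rewrite !(mulrDr, mulrBr) !mulr1 => si.
    by apply/andP; split; lra.
  exists (ex_minn ex); case: ex_minnP => m /asboolP ym mmin //.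
  by move=> k km /asboolP /mmin; rewrite leqNgt km.
have W := cube_weight_ge yn.
apply: (@le_trans _ _ ((2 ^+ d.+2)%:E * (n.+1%:R ^- (d.+2))%:E)); last first.
  by rewrite lee_wpmul2l// lee_fin exprn_ge0.
rewrite -EFinM lee_fin -!exprVn -exprMn.
rewrite lerXn2r ?nnegrE ?invr_ge0// ?mulr_ge0 ?invr_ge0//.
rewrite -[leLHS]div1r -[leRHS]/(2 / n.+1%:R)%R ler_pdivrMr// mulrAC ler_pdivlMr// mul1r.
case: n yn nmin W => [|n] yn nmin W.
  by have := wt_ge1 (x - y); lra.
have := nbox_sep s1 xP (nmin n (ltnSn n)).
by rewrite /wt -!natr1; have : (0 <= n%:R :> R)%R by []; lra.
Qed.

Lemma sum_inv_square (N : nat) :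
  (\sum_(0 <= n < N) (n.+1%:R ^- 2) <= 2 :> R)%R.
Proof.
(* The term [- N.+1%:R^-1] makes the bound inductive, by comparison with a
   telescoping sum. *)
suff h : (\sum_(0 <= n < N.+1) (n.+1%:R ^- 2) <= 2 - N.+1%:R^-1 :> R)%R.
  apply: (@le_trans _ _ (2 - N.+1%:R^-1)%R); last by rewrite gerBl invr_ge0.
  apply: le_trans h; rewrite [leRHS]big_nat_recr//= lerDl.
  by rewrite invr_ge0 exprn_ge0.
elim: N => [|N IH]; first by rewrite big_nat1 expr1n invr1; lra.
rewrite big_nat_recr//=; apply: (le_trans (lerD IH (lexx _))).
rewrite -(natr1 N.+1); set t := N.+1%:R : R.
have t1 : (1 <= t)%R by rewrite ler1n.
have h : ((t + 1) ^- 2 <= t^-1 - (t + 1)^-1)%R.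
  have -> : (t^-1 - (t + 1)^-1 = (t * (t + 1))^-1)%R by field; apply/andP; split; lra.
  rewrite lef_pV2 ?posrE; [|nra|nra]; nra.
by apply: le_trans (lerD (lexx _) h) _; rewrite addrA subrK.
Qed.

Lemma nneseriesZl_ge0 (x : \bar R) (f : nat -> \bar R) : 0 <= x ->
  (forall n, 0 <= f n) -> x * \sum_(n <oo) f n = \sum_(n <oo) (x * f n).
Proof.
move=> x0 f0; case: x x0 => [r| |//] x0; first by rewrite nneseriesZl.
have [f00|] := pselect (forall n, f n = 0).
  by rewrite !eseries0 ?mule0// => n _ _; rewrite f00 ?mule0.
move=> /existsNP[n fn]; have {fn} fn : 0 < f n.
  by rewrite lt0e f0 andbT; apply/eqP.
have ge (g : nat -> \bar R) : (forall n, 0 <= g n) -> g n <= \sum_(k <oo) g k.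
  move=> g0; apply: le_trans (nneseries_lim_ge n.+1 _); last by [].
  by rewrite big_nat_recr//= leeDr// sume_ge0.
rewrite gt0_mulye; last exact: lt_le_trans fn (ge _ f0).
apply/esym/eqP; rewrite -leye_eq; apply: le_trans (ge (fun k => +oo * f k) _).
  by rewrite gt0_mulye.
by move=> k; rewrite mule_ge0.
Qed.

(** The [n]-th box consists of [(2 n + 1) ^ d] cubes, and this number is
    compensated by the coefficient up to a factor [(n + 1) ^ (-2)], which is
    summable. *)
Lemma integral_cube_weight P (u : E -> \bar R) (A : \bar R) :
  measurable_fun setT u -> (forall x, 0 <= u x) -> 0 <= A ->
  (forall k, \int[mu]_(x in Q (P.1, k)) u x <= A) ->
  \int[mu]_y (cube_weight P y * u y) <= (2 ^+ d.+1)%:E * A.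
Proof.
move=> mu_ u0 A0 hA.
pose c n : R := (n.+1%:R ^- (d.+2))%R.
have c0 n : (0 <= c n)%R by rewrite invr_ge0 exprn_ge0.
have mb n : measurable_fun setT (fun y => (\1_(nbox P n) y)%:E : \bar R).
  by apply/measurable_EFinP; apply: measurable_indic; exact: nbox_measurable.
pose g n y : \bar R := (c n)%:E * (u y * (\1_(nbox P n) y)%:E).
have E1 y : cube_weight P y * u y = \sum_(n <oo) g n y.
  rewrite muleC /cube_weight nneseriesZl_ge0//.
  by apply: eq_eseriesr => n _; rewrite muleCA.
have g0 n y : 0 <= u y * (\1_(nbox P n) y)%:E by rewrite mule_ge0// lee_fin.
have mg n : measurable_fun setT (fun y => u y * (\1_(nbox P n) y)%:E).
  exact: emeasurable_funM.
under eq_integral do rewrite E1.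
rewrite integral_nneseries//; last 2 first.
- by move=> n; apply: measurable_funeM.
- by move=> n y _; rewrite mule_ge0// lee_fin.
apply: (@le_trans _ _ (\sum_(n <oo) ((2 ^+ d * n.+1%:R ^- 2)%:E * A))).
  apply: lee_nneseries => [n _ _|n _].
    by apply: integral_ge0 => y _; rewrite mule_ge0// lee_fin.
  rewrite ge0_integralZl//; last by rewrite lee_fin.
  rewrite (_ : \int[mu]_y _ = \int[mu]_(y in nbox P n) u y); last first.
    rewrite [RHS]integral_mkcond; apply: eq_integral => y _.
    by rewrite patchE indicE; case: ifPn => _; rewrite ?mule1 ?mule0.
  apply: (@le_trans _ _ ((c n)%:E * ((n.*2.+1 ^ d)%:R%:E * A))).
    by rewrite lee_wpmul2l ?lee_fin//; exact: integral_nbox.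
  rewrite muleA -EFinM lee_wpmul2r// lee_fin /c.
  rewrite -[d.+2]addn2 exprD invfM mulrAC ler_wpM2r ?invr_ge0 ?exprn_ge0//.
  rewrite mulrC ler_pdivrMr ?exprn_gt0// natrX -exprMn lerXn2r ?nnegrE//.
  by rewrite -natrM ler_nat -muln2 mulnC; lia.
under eq_eseriesr do rewrite muleC.
rewrite -nneseriesZl_ge0//.
rewrite muleC lee_wpmul2r//.
apply: lime_le.
  by apply: is_cvg_nneseries => n _ _; rewrite lee_fin mulr_ge0 ?invr_ge0 ?exprn_ge0.
apply: nearW => N; rewrite sumEFin lee_fin -mulr_sumr exprSr ler_wpM2l ?exprn_ge0//.
exact: sum_inv_square.
Qed.

Lemma cube_cover (x : E) j : exists k, Q (j, k) x.
Proof.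
have s0 := side_gt0 (j, fun=> 0%R).
exists (fun i => Num.floor (x ord0 i / side (j, fun=> 0%R))) => i /=.
rewrite /cube_side /= in s0 *; set s := (2 ^ (- j))%R in s0 *.
rewrite mulrC -ler_pdivlMr// ge_floor /= mulrC -ltr_pdivrMr//.
by rewrite -[1%R]/(1%:~R)%R -intrD floorD1_gt.
Qed.

Lemma unit_cube_measure k : mu (Q (0%R, k)) = 1.
Proof.
rewrite -[Q _]setIT -integral_indic//; last exact: cube_measurable.
rewrite (eq_integral (fun x : E =>
   (\prod_i \1_(`[(k i)%:~R, (k i)%:~R + 1[%classic : set R) (x ord0 i))%:E)); last first.
  move=> x _; congr EFin; rewrite indicE; have [|] := boolP (_ \in _).
    move=> /set_mem h; rewrite big1// => i _; rewrite indicE mem_set//= in_itv/=.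
    by have := h i; rewrite /cube_side/= oppr0 expr0z !mul1r.
  move=> /negP h.
  have [i hi] : exists i, ~ ((k i)%:~R <= x ord0 i < (k i)%:~R + 1)%R.
    apply: contrapT => /forallNP h'; apply: h; apply/mem_set => i.
    by have /contrapT := h' i; rewrite /cube_side/= oppr0 expr0z !mul1r.
  apply/esym/eqP/prodf_eq0; exists i => //.
  by rewrite indicE memNset//= in_itv/=.
rewrite (@integral_prod_coord R d (fun i => \1_(`[(k i)%:~R%R, ((k i)%:~R + 1)%R[%classic : set R)) 1%R).
- by rewrite expr1n.
- by move=> i; apply: measurable_indic; exact: measurable_itv.
- by [].
- move=> i; rewrite integral_indic ?setIT//.
  by rewrite [LHS](@lebesgue_measure_itv R (Interval (BLeft _) (BLeft _)))/= lte_fin ltrDl ltr01 -EFinB addrAC subrr add0r.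
Qed.
End cubes.

(** * Integrability by polynomial decay *)

Section polynomial_decay.
Context (R : realType) (d : nat).
Local Notation E := ('rV[R]_d).
Local Notation C := (R[i]).
Local Notation mu := (lebesgue_rV R d).

Definition wt_mass : R := fine (\int[mu]_y ((wt y ^+ d.+2)^-1)%:E).

Lemma wt_mass_ge0 : 0 <= wt_mass.
Proof. by apply: fine_ge0; apply: integral_ge0 => y _; rewrite lee_fin invr_ge0 exprn_ge0. Qed.

Lemma measurable_n1 : measurable_fun setT (@n1 R d).
Proof.
apply: measurable_sum => i; apply: measurableT_comp => //.
exact: measurable_coordE.
Qed.

Lemma measurable_wt : measurable_fun setT (@wt R d).
Proof. by apply: measurable_funD => //; exact: measurable_n1. Qed.

Lemma measurable_wtV n : measurable_fun setT (fun x : E => (wt x ^+ n)^-1).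
Proof.
rewrite (_ : (fun _ => _) = fun x => wt x `^ (- n%:R)).
  by apply: (measurableT_comp (measurable_powR _)); exact: measurable_wt.
by apply/funext => x; rewrite powR_invn.
Qed.

(** Up to a constant, [cube_weight] for the unit cube at the origin dominates
    the integrand. *)
Lemma integral_wt_le :
  (\int[mu]_y ((wt y ^+ d.+2)^-1)%:E <= (2 ^+ d.+2 * 2 ^+ d.+1 : R)%:E)%E.
Proof.
pose P : dyadic d := (0, fun=> 0).
have s1 : 1 <= @cube_side R d P by rewrite /cube_side oppr0 expr0z.
have P0 : @cube_set R d P 0.
  by move=> i; rewrite mxE /cube_side oppr0 expr0z !mul1r lexx add0r ltr01.
apply: (@le_trans _ _ (\int[mu]_y ((2 ^+ d.+2)%:E * (cube_weight P y * 1)))%E).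
  apply: ge0_le_integral => //.
  - by move=> y _; rewrite lee_fin invr_ge0 exprn_ge0.
  - by apply/measurable_EFinP; exact: measurable_wtV.
  - apply: measurable_funeM; apply: emeasurable_funM => //.
    exact: measurable_cube_weight.
  - move=> y _; rewrite mule1; have := wt_le_cube_weight y s1 P0.
    by rewrite sub0r wtN.
rewrite ge0_integralZl//; last 2 first.
- by apply: emeasurable_funM => //; exact: measurable_cube_weight.
- by move=> y _; rewrite mule1 cube_weight_ge0.
rewrite (EFinM (2 ^+ d.+2)) lee_wpmul2l ?lee_fin ?exprn_ge0//.
rewrite -[leRHS]mule1; apply: integral_cube_weight => // k.
rewrite integral_cst; last exact: (@cube_measurable R d (P.1, k)).
by rewrite mul1e /P /=; have /eqP := @unit_cube_measure R d k; rewrite eq_le => /andP[].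
Qed.

Lemma integral_wt : (\int[mu]_y ((wt y ^+ d.+2)^-1)%:E)%E = wt_mass%:E.
Proof.
rewrite /wt_mass fineK// ge0_fin_numE.
  by apply: le_lt_trans integral_wt_le _; rewrite ltry.
by apply: integral_ge0 => y _; rewrite lee_fin invr_ge0 exprn_ge0.
Qed.

Lemma cintegrable_decay (f : E -> C) (A : R) : cmeas f ->
  (forall x, wt x ^+ d.+2 * cmod (f x) <= A) ->
  cintegrable setT f /\ (\int[mu]_x (cmod (f x))%:E <= (A * wt_mass)%:E)%E.
Proof.
move=> mf hf; have A0 : 0 <= A by apply: le_trans (hf 0); rewrite mulr_ge0// exprn_ge0.
have h : (\int[mu]_x (cmod (f x))%:E <= (A * wt_mass)%:E)%E.
  apply: (@le_trans _ _ (\int[mu]_y (A%:E * ((wt y ^+ d.+2)^-1)%:E))%E).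
    apply: ge0_le_integral => //.
    - by move=> x _; rewrite lee_fin.
    - by apply/measurable_EFinP; exact: measurable_cmod.
    - by apply: measurable_funeM; apply/measurable_EFinP; exact: measurable_wtV.
    - by move=> x _; rewrite -EFinM lee_fin ler_pdivlMr ?exprn_gt0// mulrC.
  rewrite ge0_integralZl ?lee_fin//; last 2 first.
  - by apply/measurable_EFinP; exact: measurable_wtV.
  - by move=> y _; rewrite lee_fin invr_ge0 exprn_ge0.
  by rewrite integral_wt EFinM.
split=> //; apply/cintegrableP; split=> //.
by apply: le_lt_trans h _; rewrite ltry.
Qed.

Lemma schwartz_cmeas (f : E -> C) : schwartz f -> cmeas f.
Proof. by move=> sf; apply: (@smoothn_cmeas _ _ 0); exact: schwartz_smoothn. Qed.

Lemma schwartz_cintegrable (f : E -> C) : schwartz f -> cintegrable setT f.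
Proof.
move=> sf; have [A bA] := schwartz_dbound 0 d.+2%:Z sf.
by have [] := cintegrable_decay (schwartz_cmeas sf) (dbound_val bA).
Qed.
End polynomial_decay.

(** * The Fourier transform of Schwartz functions *)

Section fourier_transform.
Context (R : realType) (d : nat).
Local Notation E := ('rV[R]_d).
Local Notation C := (R[i]).
Local Notation mu := (lebesgue_rV R d).
Local Notation cint f := (cintegral setT f).
Local Notation cibl f := (cintegrable setT f).
Implicit Types (f g h : E -> C) (x y v : E).
Local Notation e_ i := (delta_mx ord0 i : E).
Local Notation fK := (((2 * pi) `^ (- (d%:R / 2)))%R : R).

Lemma fK_gt0 : 0 < fK.
Proof. by rewrite powR_gt0// mulr_gt0// pi_gt0. Qed.

Lemma le_eps0 (x K : R) : (forall e, 0 < e -> e <= 1 -> x <= K * e) -> x <= 0.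
Proof.
move=> h; apply/ler_addgt0Pr => e e0; rewrite add0r.
pose K' := `|K| + 1; have K'0 : 0 < K' by rewrite ltr_wpDl.
pose t := Num.min 1 (e / K').
have t0 : 0 < t by rewrite lt_min ltr01 divr_gt0.
apply: le_trans (h t t0 _) _; first by rewrite ge_min lexx.
apply: (@le_trans _ _ (K' * t)).
  by rewrite ler_wpM2r ?(ltW t0)// (le_trans (ler_norm K))// lerDl.
by rewrite mulrC -ler_pdivlMr// ge_min lexx orbT.
Qed.

Lemma fourierE f xi : fourier f xi = fK%:C%C * cint (fun x => f x * wave (- xi) x).
Proof.
rewrite /fourier; congr (_ * cint _); apply/funext => x.
by rewrite /wave dotpNr.
Qed.

Lemma inv_fourierE f x : inv_fourier f x = fourier f (- x).
Proof.
rewrite fourierE opprK /inv_fourier; congr (_ * cint _); apply/funext => xi.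
by rewrite /wave dotpC.
Qed.

Lemma inv_fourierE' f : inv_fourier f = fun x => fourier f (- x).
Proof. by apply/funext => x; exact: inv_fourierE. Qed.

Lemma schwartz_wave f y : schwartz f -> schwartz (fun x => f x * wave y x).
Proof.
move=> sf; rewrite (_ : (fun _ => _) = fun x => wave y x * f x).
  by apply: slow_schwartz => //; exact: slow_wave.
by apply/funext => x; rewrite mulrC.
Qed.

Lemma fourier_bound f (A : R) xi : schwartz f ->
  (forall x, wt x ^+ d.+2 * cmod (f x) <= A) ->
  cmod (fourier f xi) <= fK * (2 * (A * wt_mass R d)).
Proof.
move=> sf hA; rewrite fourierE cmodM cmod_real ger0_norm ?(ltW fK_gt0)//.
rewrite ler_wpM2l ?(ltW fK_gt0)//.
have [h1 h2] : cibl (fun x => f x * wave (- xi) x) /\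
   (\int[mu]_x (cmod (f x * wave (- xi) x))%:E <= (A * wt_mass R d)%:E)%E.
  apply: cintegrable_decay; first exact: (schwartz_cmeas (schwartz_wave _ sf)).
  by move=> x; rewrite cmodM cmod_expi mulr1.
exact: cintegral_le.
Qed.

(** An integrable bound of the quadratic remainder is inherited by the
    integral. This yields total, not only partial, differentiability of
    Fourier transforms and of convolutions. *)
Lemma differentiation_under (F : E -> E -> C) (G : 'I_d -> E -> E -> C) (B : R) x :
  (forall x, cibl (F x)) -> (forall i, cibl (G i x)) ->
  (forall v y, n1 v <= 1 ->
     cmod (F (x + v) y - F x y - \sum_i (v ord0 i)%:C%C * G i x y) <=
     B / wt y ^+ d.+2 * n1 v ^+ 2) ->
  cdiff (fun x => cint (F x)) x /\
  forall i, partial i (fun x => cint (F x)) x = cint (G i x).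
Proof.
move=> iF iG hB; apply: (@quad_cdiff _ _ _ _ _ (2 * (B * wt_mass R d))) => v v1.
have iGv i : cibl (fun y => (v ord0 i)%:C%C * G i x y) by exact: cintegrableZ.
have [iS ES] := cintegral_sum (index_enum 'I_d) iGv.
have [i1 E1] := cintegralB (iF (x + v)) (iF x).
have [i2 E2] := cintegralB i1 iS.
rewrite (eq_bigr (fun i => cint (fun y => (v ord0 i)%:C%C * G i x y))); last first.
  by move=> i _; rewrite cintegralZ.
rewrite -ES -E1 -E2 -!mulrA; apply: cintegral_le => //.
have [||_ h] := @cintegrable_decay R d
   (fun y => F (x + v) y - F x y - \sum_i (v ord0 i)%:C%C * G i x y) (B * n1 v ^+ 2).
- exact: cintegrable_cmeas.
- move=> y; rewrite mulrC -ler_pdivlMr ?wtX_gt0//.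
  by rewrite (le_trans (hB v y v1))// mulrAC.
by rewrite (mulrC (wt_mass R d)) mulrA.
Qed.

Definition mulx (i : 'I_d) f : E -> C := fun x => Complex 0 (-1) * (crd i x * f x).

Lemma schwartz_crd i f : schwartz f -> schwartz (fun x => crd i x * f x).
Proof. by apply: slow_schwartz; exact: slow_crd. Qed.

Lemma schwartz_mulx i f : schwartz f -> schwartz (mulx i f).
Proof. by move=> sf; apply: schwartzZ; exact: schwartz_crd. Qed.

Lemma fourier_grad f xi : schwartz f -> cdiff (fourier f) xi /\
  forall i, partial i (fourier f) xi = fourier (mulx i f) xi.
Proof.
move=> sf.
have [A bA] := schwartz_dbound 0 d.+4%:Z sf.
pose F xi x := f x * wave (- xi) x.
pose G i xi x := mulx i f x * wave (- xi) x.
have [h1 h2] : cdiff (fun xi => cint (F xi)) xi /\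
    forall i, partial i (fun xi => cint (F xi)) xi = cint (G i xi).
  apply: (@differentiation_under F G (2 * A)).
  - by move=> z; apply: schwartz_cintegrable; exact: schwartz_wave.
  - by move=> i; apply: schwartz_cintegrable; apply: schwartz_wave; exact: schwartz_mulx.
  move=> v y v1.
  have -> : F (xi + v) y - F xi y - \sum_i (v ord0 i)%:C%C * G i xi y =
      f y * wave (- xi) y * (expi (- dotp y v) - 1 - Complex 0 (- dotp y v)).
    have -> : Complex 0 (- dotp y v) =
        \sum_i (v ord0 i)%:C%C * (Complex 0 (-1) * crd i y) :> C.
      apply: complex_ext; rewrite ?Re_sum ?Im_sum /=.
        by rewrite big1// => i _; rewrite !mul0r !mulr0 subrr; ring.
      rewrite /dotp -sumrN; apply: eq_bigr => i _; ring.
    rewrite !mulrBr mulr1 /F /G /wave !dotpNr dotpDr opprD expiD.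
    rewrite mulrA; congr (_ - _ - _).
    by rewrite mulr_sumr; apply: eq_bigr => i _; rewrite /mulx; ring.
  rewrite !cmodM cmod_expi mulr1.
  apply: (@le_trans _ _ (cmod (f y) * (2 * (wt y ^+ 2 * n1 v ^+ 2)))).
    rewrite ler_wpM2l// (le_trans (expi_taylor2 _))// ler_wpM2l//.
    rewrite -exprMn -real_normK ?num_real// normrN.
    rewrite lerXn2r ?nnegrE ?mulr_ge0//.
    rewrite (le_trans (dotp_le _ _))// ler_wpM2r// /wt lerDr//.
  rewrite (_ : _ * (2 * _) = cmod (f y) * 2 * wt y ^+ 2 * n1 v ^+ 2); last by ring.
  rewrite ler_wpM2r ?sqr_ge0// ler_pdivlMr ?wtX_gt0//.
  have h : wt y ^+ d.+4 * cmod (f y) <= A := dbound_val bA y.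
  rewrite (_ : _ * _ * wt y ^+ d.+2 = 2 * (wt y ^+ d.+4 * cmod (f y))) ?ler_pM2l//.
  by rewrite -(addn2 d.+2) (exprD _ d.+2); ring.
split=> [|i]; rewrite (_ : fourier f = fun xi => fK%:C%C * cint (F xi)).
- exact: (cdiffM (cdiff_cst _ _) h1).
- by apply/funext => z; rewrite fourierE.
- rewrite partialM ?partial_cst ?mul0r ?add0r; last 2 first.
  + exact: cdiff_cst.
  + exact: h1.
  by rewrite h2 fourierE.
- by apply/funext => z; rewrite fourierE.
Qed.

Lemma partial_fourier i f : schwartz f -> partial i (fourier f) = fourier (mulx i f).
Proof. by move=> sf; apply/funext => x; have [_ ->] := fourier_grad x sf. Qed.

Lemma smoothn_fourier k f : schwartz f -> smoothn k (fourier f).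
Proof.
elim: k f => [|k IH] f sf.
  by apply: smoothn0 => x; have [] := fourier_grad x sf.
apply: smoothnS => [x|i]; first by have [] := fourier_grad x sf.
by rewrite partial_fourier//; apply: IH; exact: schwartz_mulx.
Qed.

(** The integral of a translate does not depend on the translation;
    differentiate it under the integral sign. *)
Lemma cintegral_partial i f : schwartz f -> cint (partial i f) = 0.
Proof.
move=> sf; pose F x y := f (y + x).
have [A bA] := schwartz_dbound 2 d.+2%:Z sf.
have iF x : cibl (F x).
  rewrite (_ : F x = f \o aff 1 x); last by apply/funext => y; rewrite /F /= /aff scale1r.
  by apply: cintegrable_aff; [exact: oner_neq0|exact: schwartz_cintegrable].
have iG j : cibl (fun y => partial j f (y + 0)).
  rewrite (_ : (fun _ => _) = partial j f); last first.
    by apply/funext => y; rewrite addr0.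
  by apply: schwartz_cintegrable; exact: schwartz_partial.
have [v y v1|_ h] := @differentiation_under F (fun i x y => partial i f (y + x))
    (2 * (2 ^+ d.+2 * A)) 0 iF iG.
  have := ctaylor2 (schwartz_smoothn sf) bA (y + 0) v1.
  rewrite -(addrA y 0 v) => h; apply: (le_trans h).
  by rewrite addr0 mulrAC.
have := h i; rewrite (_ : (fun x => cint (F x)) = fun=> cint f).
  rewrite partial_cst => ->; congr (cint _).
  by apply/funext => y; rewrite addr0.
by apply/funext => x; rewrite cintegral_shift//; exact: schwartz_cintegrable.
Qed.

Lemma fourier_partial i f xi : schwartz f ->
  fourier (partial i f) xi = Complex 0 (xi ord0 i) * fourier f xi.
Proof.
move=> sf; have := cintegral_partial i (schwartz_wave (- xi) sf).
have -> : partial i (fun x => f x * wave (- xi) x) = fun x =>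
    partial i f x * wave (- xi) x + (- Complex 0 (xi ord0 i)) * (f x * wave (- xi) x).
  apply/funext => x; have [w1 w2] := wave_grad (- xi) x.
  rewrite (partialM i (@smoothn_cdiff R d 0 f (schwartz_smoothn sf) x) w1).
  rewrite w2 mxE (_ : Complex 0 (- xi ord0 i) = - Complex 0 (xi ord0 i)); last first.
    by apply: complex_ext; rewrite ?Re_opp ?Im_opp ?oppr0.
  by congr (_ + _); ring.
have i1 := schwartz_cintegrable (schwartz_wave (- xi) (schwartz_partial i sf)).
have i2 := schwartz_cintegrable (schwartz_wave (- xi) sf).
rewrite cintegralD//; last exact: cintegrableZ.
rewrite cintegralZ// mulNr => /eqP; rewrite subr_eq0 => /eqP e.
by rewrite !fourierE e; ring.
Qed.

(** Continuity of the Fourier transform on the Schwartz space. A power of the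
    weight is bought with derivatives of [f] ([fourier_partial]) and a
    derivative with powers of the weight ([partial_fourier]); the induction is
    on [N] for [k = 0], then on [k]. *)
Lemma fourier_bounded (k N : nat) : exists (M : nat) (K : R), 0 <= K /\
  forall f A, schwartz f -> dbound M M f A -> dbound k N (fourier f) (K * A).
Proof.
have base n : exists (M : nat) (K : R), 0 <= K /\ forall f A, schwartz f ->
    dbound M M f A -> forall x, wt x ^+ n * cmod (fourier f x) <= K * A.
  elim: n => [|n [M [K [K0 IH]]]].
    exists d.+2, (fK * (2 * wt_mass R d)); split.
      by rewrite mulr_ge0 ?(ltW fK_gt0)// mulr_ge0// wt_mass_ge0.
    move=> f A sf bA x; rewrite expr0 mul1r.
    apply: le_trans (fourier_bound x sf (dbound_val bA)) _.
    by rewrite (mulrC A) !mulrA.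
  exists M.+1, (d.+1%:R * K); split; first by rewrite mulr_ge0.
  move=> f A sf bA x.
  have b0 : dbound M M f A by apply: (dbound_le (leqnSn M) _ (lexx A) bA); lia.
  have bi i : dbound M M (partial i f) A.
    by apply: dbound_partial; apply: (dbound_le (leqnn M.+1) _ (lexx A) bA); lia.
  rewrite exprSr /wt /n1 -mulrA mulrDl mul1r mulrDr mulr_suml mulr_sumr -/(n1 x) -/(wt x).
  rewrite -[d.+1]add1n natrD mulrDl mul1r mulrDl; apply: lerD; first exact: IH.
  rewrite -mulrA mulr_natl -[X in _ *+ X](card_ord d) -sumr_const; apply: ler_sum => i _.
  apply: le_trans (IH _ _ (schwartz_partial i sf) (bi i) x).
  by rewrite fourier_partial// cmodM cmod_imag.
elim: k N => [|k IH] N.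
  have [M [K [K0 h]]] := base N; exists M, K; split=> // f A sf bA.
  by apply: dbound0 => x; exact: h.
have [M0 [K0 [K00 h0]]] := base N; have [M1 [K1 [K10 h1]]] := IH N.
exists (M0 + M1.+1)%N, (K0 + K1 * 2 ^+ M1); split.
  by rewrite addr_ge0// mulr_ge0// exprn_ge0.
move=> f A sf bA; have A0 := dbound_ge0 bA.
apply: dboundS => [x|i].
  apply: (@le_trans _ _ (K0 * A)).
    by apply: h0 => //; apply: dbound_le bA => //; lia.
  by rewrite ler_wpM2r// lerDl mulr_ge0// exprn_ge0.
rewrite partial_fourier//.
have bf : dbound M1 M1.+1%:Z f A by apply: dbound_le bA => //; lia.
have := dboundM (@smoothn_crd R d M1 i) (schwartz_smoothn sf) (@dbound_crd R d M1 i) bf.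
rewrite mul1r (_ : -1 + M1.+1%:Z = M1%:Z)%R; last by lia.
move=> /(dbound_cstM (Complex 0 (-1)) (schwartz_smoothn (schwartz_crd i sf))).
rewrite cmod_imag normrN1 mul1r => /(h1 _ _ (schwartz_mulx i sf)).
apply: dbound_le => //.
by rewrite mulrA ler_wpM2r// lerDr.
Qed.

Lemma schwartz_fourier f : schwartz f -> schwartz (fourier f).
Proof.
move=> sf; apply/schwartzP; split; first by apply/smoothP => k; exact: smoothn_fourier.
move=> k z; have [M [K [_ h]]] := fourier_bounded k `|z|%N.
have [A bA] := schwartz_dbound M M sf; exists (K * A).
by apply: dbound_le (h _ _ sf bA) => //; lia.
Qed.

Lemma schwartz_inv_fourier f : schwartz f -> schwartz (inv_fourier f).
Proof.
move=> sf; rewrite inv_fourierE'; apply: schwartz_opp_arg; exact: schwartz_fourier.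
Qed.

Lemma measurable_dotp :
  measurable_fun setT (fun p : E * E => dotp p.1 p.2).
Proof.
apply: measurable_sum => i; apply: measurable_funM.
  by apply: (measurableT_comp (@measurable_coordE R d i)); exact: measurable_fst.
by apply: (measurableT_comp (@measurable_coordE R d i)); exact: measurable_snd.
Qed.

(** Both sides are the double integral of [f x * g y * expi (- dotp x y)]. *)
Lemma fourier_swap f g : schwartz f -> schwartz g ->
  cint (fun x => fourier f x * g x) = cint (fun x => f x * fourier g x).
Proof.
move=> sf sg; pose F (p : E * E) : C := f p.1 * g p.2 * expi (- dotp p.1 p.2).
have [||||I1 I2 eF] := @cfubini R d F.
- apply: cmeasM; first apply: cmeasM.
  + by apply: cmeas_comp; [exact: measurable_fst|exact: schwartz_cmeas].
  + by apply: cmeas_comp; [exact: measurable_snd|exact: schwartz_cmeas].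
  by apply: cmeas_expi; apply: measurable_funN; exact: measurable_dotp.
- rewrite (eq_integral (fun x => (cmod (f x))%:E * \int[mu]_y (cmod (g y))%:E)%E).
    rewrite ge0_integralZr//; last 3 first.
    + by apply/measurable_EFinP; apply: measurable_cmod; exact: schwartz_cmeas.
    + by move=> x _; rewrite lee_fin.
    + by apply: integral_ge0 => y _; rewrite lee_fin.
    rewrite lte_mul_pinfty ?integral_ge0//.
    + by move=> x _; rewrite lee_fin.
    + rewrite ge0_fin_numE; first exact: (cintegrable_cmod (schwartz_cintegrable sf)).
      by apply: integral_ge0 => x _; rewrite lee_fin.
    + exact: (cintegrable_cmod (schwartz_cintegrable sg)).
  move=> x _; rewrite -ge0_integralZl//; last 3 first.
  + by apply/measurable_EFinP; apply: measurable_cmod; exact: schwartz_cmeas.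
  + by move=> y _; rewrite lee_fin.
  + by rewrite lee_fin.
  by apply: eq_integral => y _; rewrite /F !cmodM cmod_expi mulr1 EFinM.
- move=> x; rewrite (_ : (fun _ => _) = fun y => f x * (g y * wave (- x) y)).
    by apply: cintegrableZ; apply: schwartz_cintegrable; exact: schwartz_wave.
  by apply/funext => y; rewrite /F /wave dotpNr (dotpC y) mulrA.
- move=> y; rewrite (_ : (fun _ => _) = fun x => g y * (f x * wave (- y) x)).
    by apply: cintegrableZ; apply: schwartz_cintegrable; exact: schwartz_wave.
  by apply/funext => x; rewrite /F /wave dotpNr /=; ring.
have i1 x : cibl (fun y => g y * wave (- x) y).
  by apply: schwartz_cintegrable; exact: schwartz_wave.
have E1 x : f x * fourier g x = fK%:C%C * cint (fun y => F (x, y)).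
  rewrite fourierE mulrCA -(cintegralZ (f x) (i1 x)); congr (_ * cint _); apply/funext => y.
  by rewrite /F /wave dotpNr (dotpC y) mulrA.
have i2 y : cibl (fun x => f x * wave (- y) x).
  by apply: schwartz_cintegrable; exact: schwartz_wave.
have E2 y : fourier f y * g y = fK%:C%C * cint (fun x => F (x, y)).
  rewrite fourierE -mulrA (mulrC _ (g y)) -(cintegralZ (g y) (i2 y)); congr (_ * cint _).
  by apply/funext => x; rewrite /F /wave dotpNr /=; ring.
rewrite (_ : (fun x => f x * _) = fun x => fK%:C%C * cint (fun y => F (x, y))); last first.
  by apply/funext => x; exact: E1.
rewrite (_ : (fun x => _ * g x) = fun y => fK%:C%C * cint (fun x => F (x, y))); last first.
  by apply/funext => x; exact: E2.
by rewrite (cintegralZ _ I1) (cintegralZ _ I2) eF.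
Qed.

(** The Gaussian satisfies [partial i G = - crd i * G], and the Fourier
    transform exchanges the two sides of this equation up to a common factor.
    *)
Lemma cgauss_eigen i xi :
  partial i (fourier (@cgauss R d)) xi = - crd i xi * fourier (@cgauss R d) xi.
Proof.
have sG := schwartz_cgauss R d.
rewrite partial_fourier//.
have -> : mulx i (@cgauss R d) = fun x => Complex 0 1 * partial i (@cgauss R d) x.
  apply/funext => x; have [_ ->] := cgauss_grad x.
  by rewrite /mulx; apply: complex_ext; rewrite !(Re_mul, Im_mul, Re_opp, Im_opp) /=; ring.
rewrite fourierE (_ : (fun _ => _) =
    fun x => Complex 0 1 * (partial i (@cgauss R d) x * wave (- xi) x)).
  rewrite cintegralZ; last first.
    by apply: schwartz_cintegrable; apply: schwartz_wave; exact: schwartz_partial.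
  rewrite mulrCA -fourierE fourier_partial// mulrA; congr (_ * _).
  by apply: complex_ext; rewrite !(Re_mul, Im_mul, Re_opp, Im_opp) /=; ring.
by apply/funext => x; rewrite mulrA.
Qed.

Lemma gradient0_cst (f : E -> C) x : (forall y, cdiff f y) ->
  (forall i y, partial i f y = 0) -> f x = f 0.
Proof.
move=> df pf; rewrite -[x]add0r; apply: complex_ext; apply/eqP; rewrite -subr_eq0.
- have [t _ ->] := @taylor1 R d (@complex.Re R \o f) 0 x (fun y => (df y).1).
  by rewrite big1// => i _; have := pf i (0 + t *: x); rewrite /partial => -[-> _]; rewrite mulr0.
- have [t _ ->] := @taylor1 R d (@complex.Im R \o f) 0 x (fun y => (df y).2).
  by rewrite big1// => i _; have := pf i (0 + t *: x); rewrite /partial => -[_ ->]; rewrite mulr0.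
Qed.

Lemma integral_gauss : (\int[mu]_x (gauss x)%:E)%E = ((2 * pi) `^ (d%:R / 2))%:E.
Proof.
(* The function [gauss_fun] is [expR (- t ^+ 2)]; the dilation brings the
   factor [1 / 2] into the exponent. *)
pose h (t : R) : R := gauss_fun (affl (Num.sqrt 2)^-1 0 t).
have s20 : 0 < Num.sqrt 2 :> R by rewrite sqrtr_gt0.
have mh : measurable_fun setT (h : measurableTypeR R -> R).
  by apply: measurableT_comp; [exact: measurable_gauss_fun|exact: measurable_affl].
have hE t : h t = expR (- (t ^+ 2 / 2)).
  rewrite /h /gauss_fun /affl addr0 exprMn exprVn sqr_sqrtr//.
  by rewrite mulrC.
have e : (\int[@lebesgue_measure R]_t (h t)%:E)%E = (Num.sqrt (2 * pi))%:E.
  have := @ge0_integral_affl R (Num.sqrt 2)^-1 0 (EFin \o @gauss_fun R).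
  rewrite invr_eq0 gt_eqF// => ->//.
  - by rewrite integralT_gauss ger0_norm ?invr_ge0 ?(ltW s20)// invrK -EFinM -sqrtrM.
  - by apply/measurable_EFinP; exact: measurable_gauss_fun.
  - by move=> t; rewrite lee_fin gauss_fun_ge0.
rewrite (eq_integral (fun x => (\prod_i h (x ord0 i))%:E)).
  rewrite (@integral_prod_coord R d (fun=> h) (Num.sqrt (2 * pi)))//.
    congr EFin; rewrite -powR12_sqrt ?mulr_ge0 ?pi_ge0// -powR_mulrn ?powR_ge0// -powRrM.
    by congr (_ `^ _); rewrite mulrC.
  by move=> i t; rewrite hE expR_ge0.
move=> x _; congr EFin; rewrite /gauss /sqsum.
rewrite (eq_bigr (fun i => expR (- (x ord0 i ^+ 2 / 2))) (fun i _ => hE (x ord0 i))).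
by rewrite -expR_sum mulr_suml sumrN.
Qed.

Lemma cint_cgauss : cint (@cgauss R d) = ((2 * pi) `^ (d%:R / 2))%:C%C.
Proof.
apply: complex_ext; rewrite /cintegral /=.
  by rewrite /Rintegral integral_gauss.
by rewrite /Rintegral integral0_eq.
Qed.

Lemma fK_cint_cgauss : fK%:C%C * cint (@cgauss R d) = 1.
Proof.
rewrite cint_cgauss -(rmorphM (real_complex R)) powRN mulVf ?(rmorph1 (real_complex R))//.
by rewrite gt_eqF// powR_gt0// mulr_gt0// pi_gt0.
Qed.

Lemma fourier_cgauss0 : fourier (@cgauss R d) 0 = 1.
Proof.
rewrite fourierE -[RHS]fK_cint_cgauss; congr (_ * cint _); apply/funext => x.
by rewrite /wave oppr0 dotpC dotp0l expi0 mulr1.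
Qed.

(** By [cgauss_eigen] the quotient of the transform by the Gaussian has
    gradient zero; it equals 1 at the origin. *)
Lemma fourier_cgauss : fourier (@cgauss R d) = @cgauss R d.
Proof.
have sG := schwartz_cgauss R d.
(* The reciprocal of the Gaussian. *)
pose w (x : E) : R := expR (- - (sqsum x / 2)).
have w_diff x : differentiable w x /\ forall i, 'D_(e_ i) w x = w x * x ord0 i.
  have [q1 q2] := sqsum_grad x.
  have dh : is_derive (- (sqsum x / 2)) (1 : R) (fun t => expR (- t))
     (- expR (- - (sqsum x / 2))).
    have := is_derive1_comp (is_derive_expR (- (- (sqsum x / 2))))
       (is_deriveN (is_derive_id (- (sqsum x / 2)) (1 : R))).
    by rewrite mulrN1.
  have dd : derivable (fun t : R => expR (- t)) (- (sqsum x / 2)) 1 by exact: ex_derive.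
  split; first by have [] := chain1 0 dd q1.
  by move=> i; have [_ ->] := chain1 (e_ i) dd q1; rewrite q2 derive_val; rewrite /w; ring.
have cw x : cdiff (fun x => (w x)%:C%C) x by apply: cdiff_real; have [] := w_diff x.
have cF x : cdiff (fourier (@cgauss R d)) x := @smoothn_cdiff R d 0 _ (smoothn_fourier sG) x.
have H x : fourier (@cgauss R d) x * (w x)%:C%C = fourier (@cgauss R d) 0 * (w 0)%:C%C.
  apply: (gradient0_cst (f := fun x => fourier (@cgauss R d) x * (w x)%:C%C)) => [y|i y].
    exact: cdiffM.
  rewrite partialM// cgauss_eigen partial_real; have [_ ->] := w_diff y.
  by rewrite (rmorphM (real_complex R)); rewrite /crd; ring.
have w0 : w 0 = 1.
  by rewrite /w /sqsum big1 ?mul0r ?oppr0 ?expR0// => i _; rewrite mxE expr0n.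
have F0 := fourier_cgauss0.
apply/funext => x; have := H x; rewrite w0 F0 mulr1 => e.
have wg : w x * gauss x = 1 by rewrite /w /gauss -expRD addNr expR0.
rewrite -[LHS]mulr1 -[1](rmorph1 (real_complex R)) -wg (rmorphM (real_complex R)) mulrA.
by rewrite e mul1r.
Qed.

Lemma fourier_opp_arg g x : schwartz g -> fourier (fun y => g (- y)) x = fourier g (- x).
Proof.
move=> sg; rewrite !fourierE opprK; congr (_ * _).
rewrite -(cintegral_opp (schwartz_cintegrable (schwartz_wave x sg))).
by congr cintegral; apply/funext => y; rewrite /wave dotpNl dotpNr.
Qed.

Lemma fourier_wave_dilate f x (t : R) y : 0 < t -> schwartz f ->
  fourier (fun xi => wave x xi * f (t *: xi)) y =
  ((t^-1 ^+ d)%:C)%C * fourier f (t^-1 *: (y - x)).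
Proof.
move=> t0 sf; have tn0 : t != 0 by rewrite gt_eqF.
rewrite !fourierE mulrCA; congr (_ * _).
have := cintegral_aff 0 tn0 (schwartz_cintegrable (schwartz_wave (- (t^-1 *: (y - x))) sf)).
rewrite ger0_norm ?(ltW t0)// => <-; congr cintegral; apply/funext => z.
rewrite /aff /= addr0 (mulrC (wave x z)) -mulrA; congr (_ * _).
rewrite /wave -expiD; congr expi.
rewrite dotpZl -scalerN dotpZr mulrA divff// mul1r opprB dotpDr dotpNr; ring.
Qed.

Lemma cmod_cgaussB1 : exists2 B, 0 <= B & forall (t : R) (z : E), 0 <= t ->
  cmod (cgauss (t *: z) - 1) <= B * t * n1 z.
Proof.
have sG := schwartz_cgauss R d; have [A bA] := schwartz_dbound 1 0 sG.
exists (2 * A) => [|t z t0]; first by rewrite mulr_ge0// (dbound_ge0 bA).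
have := ctaylor1 (schwartz_smoothn sG) bA 0 (t *: z).
rewrite add0r n1Z ger0_norm// mulrA (_ : cgauss 0 = 1)//.
by rewrite /cgauss /gauss /sqsum big1 ?mul0r ?oppr0 ?expR0// => i _; rewrite mxE expr0n.
Qed.

Lemma cintegral_decay_le (h : E -> C) (A : R) : cibl h ->
  (forall x, wt x ^+ d.+2 * cmod (h x) <= A) -> cmod (cint h) <= 2 * wt_mass R d * A.
Proof.
move=> ih hA; have [_ h2] := cintegrable_decay (cintegrable_cmeas ih) hA.
by rewrite -mulrA (mulrC (wt_mass R d)); exact: cintegral_le.
Qed.

(** Inserting the factor [cgauss (t *: xi)] into the inversion integral gives,
    by [fourier_swap], the integral of [f (t *: z + x) * cgauss z]. Both
    differ from the respective expressions at [t = 0] by O(t), because [f] and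
    the Gaussian are Lipschitz. *)
Lemma fourier_inversion f : schwartz f -> inv_fourier (fourier f) = f.
Proof.
move=> sf; apply/funext => x; apply/eqP; rewrite -subr_eq0; apply/eqP/cmod_eq0/le_anti.
rewrite cmod_ge0 andbT.
have sG := schwartz_cgauss R d; have sF := schwartz_fourier sf.
have [B B0 hB] := cmod_cgaussB1.
have [A1 bA1] := schwartz_dbound 0 d.+3%:Z sF.
have [A2 bA2] := schwartz_dbound 1 0 sf; have A20 := dbound_ge0 bA2.
have [A3 bA3] := schwartz_dbound 0 d.+3%:Z sG.
apply: (@le_eps0 _ (fK * (2 * wt_mass R d * (A1 * B)) + fK * (2 * wt_mass R d * (2 * A2 * A3)))) => t t0 t1.
have tn0 : t != 0 by rewrite gt_eqF.
pose w xi := wave x xi * cgauss (t *: xi).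
have sw : schwartz w.
  apply: slow_schwartz; first exact: slow_wave.
  rewrite (_ : (fun _ => _) = @cgauss R d \o aff t 0); first exact: schwartz_aff.
  by apply/funext => z; rewrite /aff /= addr0.
pose h z := f (t *: z + x) * cgauss z.
have sh : schwartz h.
  apply: slow_schwartz => //; apply: schwartz_slow; exact: (schwartz_aff x tn0 sf).
have e1 : cint (fun y => fourier f y * w y) = cint h.
  rewrite fourier_swap// (_ : (fun y => f y * _) =
      fun y => ((t^-1 ^+ d)%:C)%C * (h \o aff t^-1 (- (t^-1 *: x))) y); last first.
    apply/funext => y; rewrite fourier_wave_dilate// fourier_cgauss /h /aff /= mulrCA.
    by rewrite -scalerBr scalerA divff// scale1r subrK.
  have tV0 : t^-1 != 0 by rewrite invr_eq0.
  rewrite cintegralZ; last by apply: cintegrable_aff => //; exact: schwartz_cintegrable.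
  rewrite cintegral_aff//; last exact: schwartz_cintegrable.
  rewrite mulrA -(rmorphM (real_complex R)) ger0_norm ?invr_ge0 ?(ltW t0)// invrK -exprMn mulVf//.
  by rewrite expr1n (rmorph1 (real_complex R)) mul1r.
have [i1 d1] := cintegralB (schwartz_cintegrable (schwartz_wave x sF))
   (schwartz_cintegrable (slow_schwartz (schwartz_slow sF) sw)).
have [i2 d2] := cintegralB (schwartz_cintegrable sh)
   (cintegrableZ (f x) (schwartz_cintegrable sG)).
rewrite cintegralZ in d2; last exact: schwartz_cintegrable.
have -> : inv_fourier (fourier f) x - f x =
   fK%:C%C * (cint (fun xi => fourier f xi * wave x xi) - cint (fun y => fourier f y * w y))
   + fK%:C%C * (cint h - f x * cint (@cgauss R d)).
  rewrite inv_fourierE fourierE opprK e1 -{1}[f x]mulr1 -fK_cint_cgauss; ring.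
have K0 := ltW fK_gt0.
rewrite (_ : (_ + _) * t = fK * (2 * wt_mass R d * (A1 * B * t)) +
   fK * (2 * wt_mass R d * (2 * A2 * A3 * t))); last by ring.
apply: le_trans (cmodD _ _) _; rewrite !cmodM cmod_real ger0_norm//.
apply: lerD; rewrite ler_wpM2l// -?d1 -?d2.
- apply: cintegral_decay_le => // z.
  rewrite (_ : _ - _ = fourier f z * (wave x z * (1 - cgauss (t *: z)))); last by rewrite /w; ring.
  rewrite cmodM (cmodM (wave x z)) cmod_expi mul1r cmodC.
  apply: (@le_trans _ _ (wt z ^+ d.+2 * (cmod (fourier f z) * (B * t * wt z)))).
    apply: ler_wpM2l; first exact: wtX_ge0.
    apply: ler_wpM2l => //; apply: le_trans (hB _ _ (ltW t0)) _.
    rewrite ler_wpM2l ?mulr_ge0 ?(ltW t0)//.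
    by rewrite /wt lerDr.
  rewrite (_ : _ * _ = wt z ^+ d.+3 * cmod (fourier f z) * (B * t)).
    by rewrite -(mulrA A1) [leRHS]mulrC [leLHS]mulrC ler_wpM2l ?mulr_ge0 ?(ltW t0)//; exact: (dbound_val bA1).
  by rewrite [wt z ^+ d.+3]exprSr; ring.
- apply: cintegral_decay_le => // z.
  rewrite /h -mulrBl cmodM (addrC (t *: z) x).
  apply: (@le_trans _ _ (wt z ^+ d.+2 * ((2 * A2 * (t * wt z)) * cmod (cgauss z)))).
    apply: ler_wpM2l; first exact: wtX_ge0.
    apply: ler_wpM2r => //.
    apply: le_trans (ctaylor1 (schwartz_smoothn sf) bA2 _ _) _.
    by rewrite ler_wpM2l ?mulr_ge0// n1Z ger0_norm ?(ltW t0)// ler_wpM2l ?(ltW t0)// /wt lerDr.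
  rewrite (_ : _ * _ = 2 * A2 * t * (wt z ^+ d.+3 * cmod (cgauss z))); last first.
    by rewrite [wt z ^+ d.+3]exprSr; ring.
  rewrite (_ : 2 * A2 * A3 * t = 2 * A2 * t * A3); last by ring.
  by rewrite ler_wpM2l ?mulr_ge0 ?(ltW t0)//; exact: (dbound_val bA3).
Qed.

Lemma fourier_inversion' f : schwartz f -> fourier (inv_fourier f) = f.
Proof.
move=> sf; rewrite inv_fourierE'; apply/funext => x.
rewrite fourier_opp_arg; last exact: schwartz_fourier.
by rewrite -inv_fourierE fourier_inversion.
Qed.

End fourier_transform.

(** * Uniqueness of densities *)

Section halfspaces.
Context (R : realType) (d : nat).
Local Notation E := ('rV[R]_d).
Local Notation C := (R[i]).
Local Notation mu := (lebesgue_rV R d).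
Local Notation cint f := (cintegral setT f).
Local Notation cibl f := (cintegrable setT f).
Implicit Types (f g h : E -> C) (x y v : E) (L : seq ('I_d * R)).

(** The empty list gives the whole space, and concatenation gives
    intersections, so that these sets form a pi-system. *)
Definition halfspaces L : set E := [set x | all (fun ia => ia.2 < x ord0 ia.1) L].

Lemma halfspaces_measurableE :
  @measurable _ E = <<s range halfspaces >>.
Proof.
apply/seteqP; split=> A.
  suff H : measurable_fun setT (id : g_sigma_algebraType (range halfspaces) -> E).
    by move=> mA; have := H measurableT A mA; rewrite setTI preimage_id.
  apply: measurable_fun_rVP => i.
  apply: (@measurability _ _ _ (measurableTypeR R) _ _ _ (RGenOInfty.measurableE R)) => _ [_ [a ->] <-].
  apply: sub_sigma_algebra; exists [:: (i, a)] => //.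
  rewrite setTI /halfspaces; apply/seteqP; split=> x /=.
    by rewrite andbT in_itv /= andbT.
  by rewrite andbT in_itv /= andbT.
apply: smallest_sub; first exact: sigma_algebra_measurable.
move=> _ [L _ <-]; elim: L => [|[i a] L IH].
  rewrite (_ : halfspaces [::] = setT); first exact: measurableT.
  by apply/seteqP; split=> x.
rewrite (_ : halfspaces _ = (fun x : E => x ord0 i) @^-1` `]a, +oo[%classic `&` halfspaces L).
  apply: measurableI => //; rewrite -[X in measurable X]setTI.
  by apply: measurable_coordE => //; exact: measurable_itv.
by apply/seteqP; split=> x /=; rewrite in_itv /= andbT => /andP.
Qed.

Lemma halfspacesI : setI_closed (range halfspaces).
Proof.
move=> _ _ [L _ <-] [L' _ <-]; exists (L ++ L') => //.
by rewrite /halfspaces; apply/seteqP; split=> x /=; rewrite all_cat => /andP.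
Qed.

Lemma halfspaces_measurable L : measurable (halfspaces L).
Proof. by rewrite halfspaces_measurableE; apply: sub_sigma_algebra; exists L. Qed.

Lemma halfspaces_ae0 (u : E -> R) : mu.-integrable setT (EFin \o u) ->
  (forall L, (\int[mu]_(x in halfspaces L) (u x)%:E = 0)%E) ->
  {ae mu, forall x, u x = 0}.
Proof.
move=> iu hL.
have H A : measurable A -> (\int[mu]_(x in A) (EFin \o u) x = 0)%E.
  rewrite halfspaces_measurableE; move: A.
  apply: (dynkin_induction halfspaces_measurableE halfspacesI).
  - by rewrite -[RHS](hL [::]); congr integral; apply/seteqP; split.
  - by move=> _ [L _ <-]; exact: hL.
  - move=> S mS hS; have := hL [::].
    rewrite (_ : halfspaces [::] = S `|` ~` S); last by rewrite setUv; apply/seteqP; split.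
    rewrite integral_setU_EFin//.
    + by rewrite hS add0e.
    + exact: measurableC.
    + by rewrite setUv; case/integrableP: iu => /measurable_EFinP.
    + by rewrite disj_set2E setICr.
  - move=> F mF tF hF.
    have := @charge_semi_sigma_additive _ _ _ (induced_charge iu) F mF tF (bigcup_measurable (fun k _ => mF k)).
    rewrite (_ : (fun n => _) = fun=> 0%E).
      by move=> h; apply/esym; apply: (cvg_unique _ _ h); [exact: ereal_hausdorff|exact: cvg_cst].
    by apply/funext => n; rewrite big1// => i _; exact: hF.
have [||N [mN N0 sN]] := @integral_ae_eq _ _ _ mu setT measurableT (cst 0%E) (EFin \o u) iu.
- exact: measurable_cst.
- by move=> A _ mA; rewrite H// integral0.
- exists N; split=> // x /= nu; apply: sN => /= h; apply: nu.
  by case: (h I).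
Qed.

Lemma step_cvg (ia : 'I_d * R) x :
  (fun n => step n ia x) @ \oo --> ((ia.2 < x ord0 ia.1)%R%:R : R).
Proof.
have logistic_le (t : R) : logistic t <= expR t.
  rewrite /logistic -[expR t]invrK -expRN lef_pV2 ?posrE ?expR_gt0//.
  by rewrite lerDr.
have exp_le (n : nat) : expR (- n%:R : R) <= harmonic n.
  rewrite expRN /harmonic lef_pV2 ?posrE ?expR_gt0//.
  by rewrite -addn1 natrD addrC expR_ge1Dx.
set t := x ord0 ia.1 - ia.2.
have cut (n : nat) : step n ia x = logistic (n%:R ^+ 2 * t - n%:R) by [].
case: ltP => xa.
- have t0 : 0 < t by rewrite subr_gt0.
  have -> : (fun n => step n ia x) = fun n => 1 - logistic (n%:R - n%:R ^+ 2 * t).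
    apply/funext => n; rewrite cut /logistic opprB.
    have e0 s : 1 + expR s != 0 :> R by rewrite gt_eqF// addr_gt0 ?expR_gt0.
    rewrite expRN; set a := expR _.
    have a0 : 0 < a by rewrite expR_gt0.
    by field; rewrite !gt_eqF// addr_gt0.
  rewrite -[X in _ --> X]subr0; apply: cvgB; first exact: cvg_cst.
  apply: (@squeeze_cvgr _ _ _ _ (fun=> 0) (@harmonic R)); last 2 first.
  + exact: cvg_cst.
  + exact: cvg_harmonic.
  near=> n; rewrite ltW ?logistic_gt0//=.
  apply: le_trans (logistic_le _) _; apply: le_trans (exp_le n); rewrite ler_expR.
  have : 2 / t <= n%:R by near: n; exact: nbhs_infty_ger.
  rewrite ler_pdivrMr// => h.
  have : n%:R * 2 <= n%:R * (n%:R * t) :> R by rewrite ler_wpM2l.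
  rewrite expr2 -mulrA; lra.
- have t0 : t <= 0 by rewrite subr_le0.
  apply: (@squeeze_cvgr _ _ _ _ (fun=> 0) (@harmonic R)); last 2 first.
  + exact: cvg_cst.
  + exact: cvg_harmonic.
  near=> n; rewrite cut ltW ?logistic_gt0//=.
  apply: le_trans (logistic_le _) _; apply: le_trans (exp_le n); rewrite ler_expR.
  by rewrite gerDr mulr_ge0_le0// exprn_ge0.
Unshelve. all: by end_near. Qed.

Lemma steps_cvg L x : (fun n => steps n L x) @ \oo --> (\1_(halfspaces L) x : R).
Proof.
rewrite indicE; elim: L => [|ia L IH].
  rewrite mem_set// (_ : (fun n => _) = fun=> 1); first exact: cvg_cst.
  by apply/funext => n; rewrite /steps big_nil.
have -> : x \in halfspaces (ia :: L) = (ia.2 < x ord0 ia.1) && (x \in halfspaces L).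
  by apply/idP/andP; rewrite !inE /halfspaces /= => /andP.
rewrite -mulnb natrM (_ : (fun n => _) = fun n => step n ia x * steps n L x).
  by apply: cvgM IH; exact: step_cvg.
by apply/funext => n; rewrite /steps big_cons.
Qed.

Lemma steps_ae0 (u : E -> R) : mu.-integrable setT (EFin \o u) ->
  (forall n L, (\int[mu]_x (steps n L x * u x)%:E = 0)%E) ->
  {ae mu, forall x, u x = 0}.
Proof.
move=> iu h0; apply: halfspaces_ae0 => // L.
have mu_ : measurable_fun setT u by case/integrableP: iu => /measurable_EFinP.
have ms n : measurable_fun setT (steps n L : E -> R).
  by have [] := @smoothn_cmeas R d 0 _ (slow_smoothn (slow_steps n L)).
have [|||||_ _ hc] := @dominated_convergence _ E R mu setT measurableT
   (fun n x => (steps n L x * u x)%:E) (fun x => (\1_(halfspaces L) x * u x)%:E)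
   (fun x => `|(u x)%:E|%E).
- by move=> n; apply/measurable_EFinP; apply: measurable_funM.
- apply/measurable_EFinP; apply: measurable_funM => //.
  by apply: measurable_indic; exact: halfspaces_measurable.
- apply: aeW => x _; apply/fine_cvgP; split; first by apply: nearW.
  by apply: cvgM; [exact: steps_cvg|exact: cvg_cst].
- exact: integrable_abse.
- apply: aeW => x n _; rewrite lee_fin normrM ger0_norm ?steps_ge0//.
  by rewrite ler_piMl// steps_le1.
rewrite integral_mkcond -[RHS](_ : \int[mu]_x (\1_(halfspaces L) x * u x)%:E = 0)%E.
  apply: eq_integral => x _; rewrite patchE indicE; case: ifP => _.
    by rewrite mul1r.
  by rewrite mul0r.
apply: (cvg_unique (@ereal_hausdorff R) hc).
rewrite (_ : [sequence _]_n = fun=> 0%E); first exact: cvg_cst.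
by apply/funext => n; exact: h0.
Qed.

(** Products of smooth steps with a Gaussian already separate densities: in
    the limit they detect the integrals of [g * cgauss] over all intersections
    of half-spaces. *)
Lemma test_unique g : cibl (fun x => g x * cgauss x) ->
  (forall n L, cint (fun x => g x * test n L x) = 0) -> {ae mu, forall x, g x = 0}.
Proof.
move=> ig h0; have [iR iI] := ig.
have fact (n : nat) L x : g x * test n L x = (steps n L x)%:C%C * (g x * cgauss x).
  by rewrite /test mulrCA.
have it n L : cibl (fun x => g x * test n L x).
  apply: le_cintegrable ig => [|x].
    rewrite (_ : (fun _ => _) = fun x => (steps n L x)%:C%C * (g x * cgauss x)); last first.
      by apply/funext => x; exact: fact.
    apply: cmeasM; last exact: cintegrable_cmeas.
    exact: smoothn_cmeas (slow_smoothn (k := 0) (slow_steps n L)).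
  rewrite fact (cmodM (steps n L x)%:C%C) cmod_real ger0_norm ?steps_ge0//.
  by rewrite ler_piMl// steps_le1.
have conv (r : C -> R) : (forall a z, r (a%:C%C * z) = a * r z) ->
    (forall n L, mu.-integrable setT (EFin \o (r \o (fun x => g x * test n L x)))) ->
    (forall n L, Rintegral mu setT (r \o (fun x => g x * test n L x)) = 0) ->
    forall n L, (\int[mu]_x (steps n L x * (r (g x * cgauss x)))%:E = 0)%E.
  move=> rM ir r0 n L; have := r0 n L; rewrite /Rintegral => h.
  have := integrable_fin_num measurableT (ir n L) => /fineK.
  rewrite (_ : (\int[mu]_x _)%E = (\int[mu]_x (steps n L x * (r (g x * cgauss x)))%:E)%E) in h *.
    by rewrite h => <-.
  by apply: eq_integral => x _; rewrite /= fact rM.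
have hR : {ae mu, forall x, complex.Re (g x * cgauss x) = 0}.
  apply: (steps_ae0 iR); apply: (conv (@complex.Re R)) => [a z|n L|n L].
  - by rewrite Re_mul /= mul0r subr0.
  - by have [] := it n L.
  - by have := congr1 (@complex.Re R) (h0 n L).
have hI : {ae mu, forall x, complex.Im (g x * cgauss x) = 0}.
  apply: (steps_ae0 iI); apply: (conv (@complex.Im R)) => [a z|n L|n L].
  - by rewrite Im_mul /= mul0r addr0.
  - by have [] := it n L.
  - by have := congr1 (@complex.Im R) (h0 n L).
apply: filterS2 hR hI => x hr hi.
have : g x * cgauss x = 0 by apply: complex_ext.
move/eqP; rewrite mulf_eq0 => /orP[/eqP//|/eqP /(congr1 (@complex.Re R)) /= e].
by move: (gauss_gt0 x); rewrite e ltxx.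
Qed.
End halfspaces.

(** * Low frequency cutoffs *)

Section littlewood_paley.
Context (R : realType) (d : nat).
Local Notation E := ('rV[R]_d).
Local Notation C := (R[i]).
Local Notation mu := (lebesgue_rV R d).
Local Notation cint f := (cintegral setT f).
Local Notation cibl f := (cintegrable setT f).
Implicit Types (f g h : E -> C) (x y v : E) (T : dist R d).
Variables (theta0 : E -> C) (htheta : resolution theta0).

Lemma schwartz_theta0 : schwartz theta0. Proof. by case: htheta. Qed.

Lemma theta0_0 : theta0 0 = 1.
Proof.
case: htheta => _ h _; apply: h; rewrite /enorm big1 ?sqrtr0// => i _.
by rewrite mxE expr0n.
Qed.

Definition cutoff (t : R) : E -> C := fun x => theta0 (t *: x).

Lemma cutoffE t : cutoff t = theta0 \o aff t 0.
Proof. by apply/funext => x; rewrite /cutoff /aff /= addr0. Qed.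

Lemma schwartz_cutoff t : t != 0 -> schwartz (cutoff t).
Proof. by move=> t0; rewrite cutoffE; apply: schwartz_aff => //; exact: schwartz_theta0. Qed.

Lemma schwartz_theta j : schwartz (theta theta0 j).
Proof.
case: j => [|j] /=; first exact: schwartz_theta0.
have -> : (fun x : E => theta0 (2 ^- j.+1 *: x) - theta0 ((2 * 2 ^- j.+1) *: x)) =
    fun x => cutoff (2 ^- j.+1) x + (-1) * cutoff (2 * 2 ^- j.+1) x.
  by apply/funext => x; rewrite mulN1r.
apply: schwartzD; first by apply: schwartz_cutoff; rewrite invr_eq0 expf_neq0.
by apply: schwartzZ; apply: schwartz_cutoff; rewrite mulf_neq0// invr_eq0 expf_neq0.
Qed.

Lemma sum_theta N x : \sum_(j < N.+1) theta theta0 j x = cutoff (2 ^- N) x.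
Proof.
elim: N => [|N IH]; first by rewrite big_ord1 /cutoff expr0 invr1 scale1r.
rewrite big_ord_recr IH /= /cutoff exprS invfM mulrA divff// mul1r.
by rewrite addrCA addrN addr0.
Qed.

(** As [theta0] is Lipschitz, [theta0 (t *: x) - 1] is of size [t * n1 x]: one
    power of the weight is given up for the factor [t]. The derivatives carry
    a factor [t] anyway. *)
Lemma cutoff_dbound (k : nat) : exists A, forall t : R, 0 < t <= 1 ->
  dbound k (-1) (fun x => cutoff t x + -1) (A * t).
Proof.
have s0 := schwartz_theta0.
have [A0 b0] := schwartz_dbound 1 0 s0.
have [A1 b1] := schwartz_dbound k 0 s0.
exists (2 * A0 + A1) => t /andP[t0 t1].
have A00 := dbound_ge0 b0; have A10 := dbound_ge0 b1.
have val x : wt x ^ (-1) * cmod (cutoff t x + -1) <= (2 * A0 + A1) * t.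
  have := ctaylor1 (schwartz_smoothn s0) b0 0 (t *: x).
  rewrite add0r theta0_0 n1Z gtr0_norm// => h.
  rewrite exprN1 mulrC ler_pdivrMr//; apply: le_trans h _.
  rewrite mulrA; apply: ler_pM; rewrite ?mulr_ge0 ?(ltW t0)//.
    by rewrite ler_wpM2r ?(ltW t0)// lerDl.
  by rewrite /wt lerDr.
case: k b1 => [|k] b1; first exact: dbound0.
apply: dboundS => // i.
have -> : partial i (fun x => cutoff t x + -1) =
    fun x => t%:C%C * (partial i theta0 \o aff t 0) x.
  apply/funext => x; rewrite partialD; last first.
  - exact: cdiff_cst.
  - by apply: (@smoothn_cdiff R d 0); apply: schwartz_smoothn; apply: schwartz_cutoff; rewrite gt_eqF.
  rewrite partial_cst addr0 cutoffE partial_aff//.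
  by apply: (@smoothn_cdiff R d 0); apply: schwartz_smoothn.
have bp : dbound k 0 (partial i theta0) A1 := dbound_partial i b1.
have sp : smoothn k (partial i theta0) := schwartz_smoothn (schwartz_partial i s0).
have := dbound_cstM t%:C%C (smoothn_aff t 0 sp)
  (@dbound_aff R d k 0 (partial i theta0) t 1 1 A1 0 sp bp _ (lexx 1) _).
rewrite gtr0_norm// => /(_ t1) h; apply: dbound_le (h _) => //.
  rewrite cmod_real gtr0_norm// expr1n !mul1r mulrC ler_wpM2r ?(ltW t0)//.
  by rewrite lerDr mulr_ge0.
by move=> x; rewrite !expr0z mul1r.
Qed.

Lemma tempered_sub T f g : tempered T -> schwartz f -> schwartz g ->
  T f - T g = T (fun x => f x - g x).
Proof.
move=> [lT _] sf sg; rewrite (_ : (fun x => f x - g x) = fun x => -1 * g x + f x).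
  by rewrite lT// mulN1r addrC.
by apply/funext => x; rewrite mulN1r addrC.
Qed.

Lemma fourierD f g : schwartz f -> schwartz g ->
  fourier (fun x => f x + g x) = fun x => fourier f x + fourier g x.
Proof.
move=> sf sg; apply/funext => x; rewrite !fourierE -mulrDr; congr (_ * _).
rewrite -cintegralD; try by apply: schwartz_cintegrable; exact: schwartz_wave.
by congr cintegral; apply/funext => y; rewrite mulrDl.
Qed.

Lemma fourierZ (c : C) f : schwartz f ->
  fourier (fun x => c * f x) = fun x => c * fourier f x.
Proof.
move=> sf; apply/funext => x; rewrite !fourierE mulrCA; congr (_ * _).
rewrite -cintegralZ; last by apply: schwartz_cintegrable; exact: schwartz_wave.
by congr cintegral; apply/funext => y; rewrite mulrA.
Qed.

(** Low frequency cutoffs converge to the identity in the Schwartz topology: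
    the power of the weight lost in [cutoff_dbound] is absorbed by the decay
    of [inv_fourier h]. *)
Lemma cutoff_fourier T h : tempered T -> schwartz h -> exists K, forall N : nat,
  cmod (T (fourier (fun x => cutoff (2 ^- N) x * inv_fourier h x)) - T h) <= K * 2 ^- N.
Proof.
move=> tT sh; have [M [c [c0 hc]]] := tempered_bound tT.
have [M' [K [K0 hK]]] := fourier_bounded R d M M.
have [A hA] := cutoff_dbound M'.
have su := schwartz_inv_fourier sh.
have [B bB] := schwartz_dbound M' (M' + 1)%:Z su.
exists (c * (K * (2 ^+ M' * (A * B)))) => N.
have t0 : 0 < (2 ^- N : R) <= 1.
  by rewrite invr_gt0 exprn_gt0//= invf_le1 ?exprn_gt0// exprn_ege1// ler1n.
have tn0 : 2 ^- N != 0 :> R by rewrite invr_eq0 expf_neq0.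
have sc := schwartz_cutoff tn0.
have scu : schwartz (fun x => cutoff (2 ^- N) x * inv_fourier h x).
  by apply: slow_schwartz su; exact: schwartz_slow.
have slc : slow (fun x => cutoff (2 ^- N) x + -1).
  by apply: slowD; [exact: schwartz_slow|exact: slow_cst].
have sw : schwartz (fun x => (cutoff (2 ^- N) x + -1) * inv_fourier h x).
  exact: slow_schwartz.
rewrite (tempered_sub tT (schwartz_fourier scu) sh).
rewrite (_ : (fun x => _ - _) = fourier (fun x => (cutoff (2 ^- N) x + -1) * inv_fourier h x)).
  rewrite -!mulrA; apply: hc; first exact: schwartz_fourier.
  apply: hK => //.
  have := dboundM (slow_smoothn (k := M') slc) (schwartz_smoothn (k := M') su) (hA _ t0) bB.
  by rewrite PoszD addrCA subrr addr0 [X in _ * X]mulrAC -!mulrA.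
rewrite (_ : (fun x => (_ + -1) * _) = fun x => cutoff (2 ^- N) x * inv_fourier h x + (-1) * inv_fourier h x).
  rewrite fourierD//; last exact: schwartzZ.
  by rewrite fourierZ// fourier_inversion'//; apply/funext => x; rewrite mulN1r.
by apply/funext => x; rewrite mulrDl.
Qed.

Lemma pieceE T j h : piece theta0 T j h = T (fourier (fun x => theta theta0 j x * inv_fourier h x)).
Proof. by []. Qed.

Lemma sum_pieces T h N : tempered T -> schwartz h ->
  \sum_(j < N.+1) piece theta0 T j h =
  T (fourier (fun x => cutoff (2 ^- N) x * inv_fourier h x)).
Proof.
move=> tT sh; have su := schwartz_inv_fourier sh.
have scu (j : nat) : schwartz (fun x => theta theta0 j x * inv_fourier h x).
  by apply: slow_schwartz su; apply: schwartz_slow; exact: schwartz_theta.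
elim: N => [|N IH].
  rewrite big_ord1 pieceE; congr (T (fourier _)); apply/funext => x.
  by rewrite /cutoff expr0 invr1 scale1r.
have sc : schwartz (fun x => cutoff (2 ^- N) x * inv_fourier h x).
  by apply: slow_schwartz su; apply: schwartz_slow; apply: schwartz_cutoff; rewrite invr_eq0 expf_neq0.
rewrite big_ord_recr IH /= pieceE; have [lT _] := tT.
rewrite -[X in X + _]mul1r -lT; [|exact: schwartz_fourier|exact: schwartz_fourier].
congr (T _); rewrite (_ : (fun x => 1 * _ + _) = fun x =>
   fourier (fun x => cutoff (2 ^- N) x * inv_fourier h x) x +
   fourier (fun x => theta theta0 N.+1 x * inv_fourier h x) x); last first.
  by apply/funext => x; rewrite mul1r.
rewrite -fourierD//; congr fourier; apply/funext => x.
by rewrite -mulrDl -!sum_theta [in RHS]big_ord_recr.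
Qed.

End littlewood_paley.

(** * The sum of the pieces is a density *)

Section function_series.
Context (R : realType) (d : nat).
Local Notation E := ('rV[R]_d).
Local Notation C := (R[i]).
Local Notation mu := (lebesgue_rV R d).
Local Notation cint f := (cintegral setT f).
Local Notation cibl f := (cintegrable setT f).
Implicit Types (f h : E -> C) (x y v : E) (T : dist R d).

Lemma nneseries_cvg_fine (u : nat -> R) : (forall j, 0 <= u j) ->
  (\sum_(j <oo) (u j)%:E < +oo)%E ->
  (fun n => \sum_(j < n) u j) @ \oo --> fine (\sum_(j <oo) (u j)%:E)%E.
Proof.
move=> u0 uoo.
have h : (\sum_(0 <= j < n) (u j)%:E)%E @[n --> \oo] --> (\sum_(j <oo) (u j)%:E)%E.
  by apply: is_cvg_nneseries => j _ _; rewrite lee_fin.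
have fs : (\sum_(j <oo) (u j)%:E)%E \is a fin_num.
  by rewrite ge0_fin_numE// nneseries_ge0// => j _ _; rewrite lee_fin.
move: h; rewrite -(fineK fs) => /fine_cvg; rewrite fineK//.
rewrite (_ : _ \o _ = fun n => \sum_(j < n) u j)//.
by apply/funext => n; rewrite /= sumEFin/= big_mkord.
Qed.

Definition rsum (u : nat -> R) : R :=
  fine (\sum_(j <oo) (Num.max (u j) 0)%:E)%E - fine (\sum_(j <oo) (Num.max (- u j) 0)%:E)%E.

Lemma rsum_cvg (u a : nat -> R) : (forall j, `|u j| <= a j) ->
  (\sum_(j <oo) (a j)%:E < +oo)%E -> (fun n => \sum_(j < n) u j) @ \oo --> rsum u.
Proof.
move=> ua aoo.
have pos (w : nat -> R) : (forall j, `|w j| <= a j) ->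
    (fun n => \sum_(j < n) Num.max (w j) 0) @ \oo -->
    fine (\sum_(j <oo) (Num.max (w j) 0)%:E)%E.
  move=> wa; apply: nneseries_cvg_fine => [j|]; first by rewrite le_max lexx orbT.
  apply: le_lt_trans aoo; apply: lee_nneseries => [j _ _|j _]; rewrite lee_fin.
    by rewrite le_max lexx orbT.
  by rewrite ge_max (le_trans (ler_norm _) (wa j)) (le_trans _ (wa j)).
rewrite (_ : (fun n => _) = fun n => \sum_(j < n) Num.max (u j) 0 - \sum_(j < n) Num.max (- u j) 0).
  by apply: cvgB; apply: pos => // j; rewrite normrN.
apply/funext => n; rewrite -sumrB; apply: eq_bigr => j _.
by case: (leP (u j) 0) => h; case: (leP (- u j) 0) => h'; lra.
Qed.

(** Positive and negative parts are summed separately, so that the sum is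
    measurable whether or not the series converges. *)
Definition csum (g : nat -> E -> C) : E -> C := fun x =>
  Complex (rsum (fun j => complex.Re (g j x))) (rsum (fun j => complex.Im (g j x))).

Definition abs_sum (g : nat -> E -> C) (x : E) : \bar R := (\sum_(j <oo) (cmod (g j x))%:E)%E.

Implicit Types g : nat -> E -> C.

Lemma abs_sum_ge0 g x : (0 <= abs_sum g x)%E.
Proof. by apply: nneseries_ge0 => j _ _; rewrite lee_fin. Qed.

Lemma measurable_nneseries (u : nat -> E -> R) : (forall j, measurable_fun setT (u j)) ->
  (forall j x, 0 <= u j x) -> measurable_fun setT (fun x => \sum_(j <oo) (u j x)%:E)%E.
Proof.
move=> mu_ u0; apply: ge0_emeasurable_sum => [j x _ _|j _]; first by rewrite lee_fin.
by apply/measurable_EFinP.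
Qed.

Lemma measurable_rsum (u : nat -> E -> R) : (forall j, measurable_fun setT (u j)) ->
  measurable_fun setT (fun x => rsum (fun j => u j x)).
Proof.
have pos (w : nat -> E -> R) : (forall j, measurable_fun setT (w j)) ->
    measurable_fun setT (fun x => fine (\sum_(j <oo) (Num.max (w j x) 0)%:E)%E).
  move=> mw; apply: (measurableT_comp (@fine_measurable R setT measurableT)).
  apply: (measurable_nneseries (u := fun j x => Num.max (w j x) 0)) => [j|j x].
    by apply: measurable_maxr => //.
  by rewrite le_max lexx orbT.
by move=> mu_; apply: measurable_funB; apply: pos => // j; exact: measurable_funN.
Qed.

Lemma cmeas_csum g : (forall j, cmeas (g j)) -> cmeas (csum g).
Proof.
move=> mg; split.
  by apply: (measurable_rsum (u := fun j x => complex.Re (g j x))) => j; have [] := mg j.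
by apply: (measurable_rsum (u := fun j x => complex.Im (g j x))) => j; have [] := mg j.
Qed.

Lemma measurable_abs_sum g : (forall j, cmeas (g j)) -> measurable_fun setT (abs_sum g).
Proof. by move=> mg; apply: measurable_nneseries => // j; exact: measurable_cmod. Qed.

Lemma csum_cvg g x : (abs_sum g x < +oo)%E ->
  (fun n => complex.Re (\sum_(j < n) g j x)) @ \oo --> complex.Re (csum g x) /\
  (fun n => complex.Im (\sum_(j < n) g j x)) @ \oo --> complex.Im (csum g x).
Proof.
move=> goo; split.
  under eq_cvg do rewrite Re_sum.
  by apply: (rsum_cvg (a := fun j => cmod (g j x))) => // j; exact: Re_le_cmod.
under eq_cvg do rewrite Im_sum.
by apply: (rsum_cvg (a := fun j => cmod (g j x))) => // j; exact: Im_le_cmod.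
Qed.

Lemma cmod_partial_sum g x n : ((cmod (\sum_(j < n) g j x))%:E <= abs_sum g x)%E.
Proof.
apply: (@le_trans _ _ (\sum_(0 <= j < n) (cmod (g j x))%:E)%E).
  by rewrite sumEFin lee_fin big_mkord cmod_sum.
by apply: nneseries_lim_ge => j _ _; rewrite lee_fin.
Qed.

Lemma cmod_csum g x : ((cmod (csum g x))%:E <= abs_sum g x)%E.
Proof.
have [goo|] := ltP (abs_sum g x) +oo%E; last by rewrite leye_eq => /eqP ->; rewrite leey.
have fg : abs_sum g x \is a fin_num by rewrite ge0_fin_numE// abs_sum_ge0.
rewrite -(fineK fg) lee_fin; apply/ler_addgt0Pr => e e0.
have [cR cI] := csum_cvg goo; have e20 : 0 < e / 2 by rewrite divr_gt0.
have /cvgrPdist_le/(_ _ e20) nR := cR; have /cvgrPdist_le/(_ _ e20) nI := cI.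
have : \forall n \near \oo, cmod (csum g x) <= fine (abs_sum g x) + e.
  near=> n; rewrite -[csum g x](subrK (\sum_(j < n) g j x)) addrC.
  apply: le_trans (cmodD _ _) _; apply: lerD.
    by rewrite -lee_fin fineK// cmod_partial_sum.
  apply: le_trans (cmod_le _) _; rewrite Re_add Re_opp Im_add Im_opp [leRHS]splitr.
  by apply: lerD; [near: n; exact: nR|near: n; exact: nI].
by move=> /filter_ex[n].
Unshelve. all: by end_near. Qed.

Lemma cdominated (F : nat -> E -> C) f (G : E -> \bar R) :
  (forall n, cmeas (F n)) -> cmeas f -> mu.-integrable setT G ->
  (forall x n, (cmod (F n x))%:E <= G x)%E ->
  (forall x, (G x < +oo)%E ->
    (fun n => complex.Re (F n x)) @ \oo --> complex.Re (f x) /\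
    (fun n => complex.Im (F n x)) @ \oo --> complex.Im (f x)) ->
  [/\ cibl f,
     (fun n => complex.Re (cint (F n))) @ \oo --> complex.Re (cint f) &
     (fun n => complex.Im (cint (F n))) @ \oo --> complex.Im (cint f)].
Proof.
move=> mF mf iG FG cF.
have Gfin := integrable_ae measurableT iG.
have main (r : C -> R) : (forall z, `|r z| <= cmod z) ->
    (forall n, measurable_fun setT (r \o F n)) -> measurable_fun setT (r \o f) ->
    (forall x, (G x < +oo)%E -> (fun n => r (F n x)) @ \oo --> r (f x)) ->
    mu.-integrable setT (EFin \o (r \o f)) /\
    (fun n => Rintegral mu setT (r \o F n)) @ \oo --> Rintegral mu setT (r \o f).
  move=> rle mrF mrf cr.
  have [|||||i1 _ i3] := @dominated_convergence _ E R mu setT measurableT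
     (fun n x => (r (F n x))%:E) (fun x => (r (f x))%:E) G.
  - by move=> n; apply/measurable_EFinP; exact: mrF.
  - by apply/measurable_EFinP.
  - apply: filterS Gfin => x Gx _; apply/fine_cvgP; split; first by apply: nearW.
    by apply: cr; move: (Gx I); rewrite fin_numE => /andP[_]; rewrite ltey.
  - by [].
  - apply: aeW => x n _; apply: le_trans (FG x n).
    by rewrite lee_fin rle.
  split=> //; move: i3; rewrite /Rintegral.
  have fi : (\int[mu]_x (r (f x))%:E)%E \is a fin_num by exact: integrable_fin_num.
  by rewrite -(fineK fi) => /fine_cvg; rewrite fineK.
have [i1 c1] := main (@complex.Re R) (@Re_le_cmod R) (fun n => (mF n).1) mf.1 (fun x Gx => (cF x Gx).1).
have [i2 c2] := main (@complex.Im R) (@Im_le_cmod R) (fun n => (mF n).2) mf.2 (fun x Gx => (cF x Gx).2).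
by split.
Qed.

(** Up to a constant, [cube_weight] for the unit cube at the origin dominates
    the inverse power of [wt]. *)
Lemma weighted_mass (u : E -> \bar R) (A : \bar R) : measurable_fun setT u ->
  (forall x, 0 <= u x)%E -> (0 <= A)%E ->
  (forall k, \int[mu]_(x in @cube_set R d (0%R, k)) u x <= A)%E ->
  (\int[mu]_x (((wt x ^+ d.+2)^-1)%:E * u x) <= (2 ^+ d.+2 * 2 ^+ d.+1)%:E * A)%E.
Proof.
move=> mu_ u0 A0 hA; pose P : dyadic d := (0, fun=> 0).
have s1 : 1 <= @cube_side R d P by rewrite /cube_side oppr0 expr0z.
have P0 : @cube_set R d P 0.
  by move=> i; rewrite mxE /cube_side oppr0 expr0z !mul1r lexx add0r ltr01.
apply: (@le_trans _ _ (\int[mu]_y ((2 ^+ d.+2)%:E * (cube_weight P y * u y)))%E).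
  apply: ge0_le_integral => //.
  - by move=> y _; rewrite mule_ge0// lee_fin invr_ge0 exprn_ge0.
  - by apply: emeasurable_funM => //; apply/measurable_EFinP; exact: measurable_wtV.
  - apply: measurable_funeM; apply: emeasurable_funM => //.
    exact: measurable_cube_weight.
  - move=> y _; rewrite muleA; apply: lee_wpmul2r => //.
    by have := wt_le_cube_weight y s1 P0; rewrite sub0r wtN.
rewrite ge0_integralZl//; last 2 first.
- by apply: emeasurable_funM => //; exact: measurable_cube_weight.
- by move=> y _; rewrite mule_ge0// cube_weight_ge0.
rewrite EFinM -muleA lee_wpmul2l ?lee_fin ?exprn_ge0//.
exact: integral_cube_weight.
Qed.

Lemma loc_integrable_mass (u : R) f (A : R) : cmeas f -> 0 <= A ->
  (forall k, \int[mu]_(x in @cube_set R d (0%R, k)) (cmod (f x) `^ u)%:E <= A%:E)%E ->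
  loc_integrable u f.
Proof.
move=> mf A0 hA; split; [exact: mf.1|exact: mf.2|move=> K cK].
have mcf : measurable_fun setT (fun x => (cmod (f x) `^ u)%:E).
  apply/measurable_EFinP; apply: (measurableT_comp (measurable_powR _)).
  exact: measurable_cmod.
have mK : measurable K.
  rewrite -[K]setCK; apply: measurableC; apply: open_measurable_rV.
  by apply: closed_openC; apply: compact_closed => //; exact: norm_hausdorff.
have [M [_ hM]] := compact_bounded cK.
pose B := 1 + d%:R * (`|M| + 1).
have B0 : 0 <= B by rewrite addr_ge0// mulr_ge0// addr_ge0.
have wB x : K x -> wt x <= B.
  move=> Kx; rewrite /wt lerD2l; apply: le_trans (n1_le_norm x) _; rewrite ler_wpM2l//.
  by apply: hM => //; rewrite (le_lt_trans (ler_norm M))// ltrDl.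
apply: (@le_lt_trans _ _ (\int[mu]_(x in K) ((B ^+ d.+2)%:E * (((wt x ^+ d.+2)^-1)%:E * (cmod (f x) `^ u)%:E)))%E).
  apply: ge0_le_integral => //.
  - by move=> x _; rewrite lee_fin powR_ge0.
  - exact: measurable_funTS.
  - apply: measurable_funTS; apply: measurable_funeM; apply: emeasurable_funM => //.
    by apply/measurable_EFinP; exact: measurable_wtV.
  - move=> x Kx; rewrite -!EFinM lee_fin mulrA ler_peMl ?powR_ge0// ler_pdivlMr ?wtX_gt0// mul1r.
    by rewrite lerXn2r ?nnegrE// wB.
apply: (@le_lt_trans _ _ (\int[mu]_x ((B ^+ d.+2)%:E * (((wt x ^+ d.+2)^-1)%:E * (cmod (f x) `^ u)%:E)))%E).
  apply: ge0_subset_integral => //.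
  - apply: measurable_funeM; apply: emeasurable_funM => //.
    by apply/measurable_EFinP; exact: measurable_wtV.
  - by move=> x _; rewrite -!EFinM lee_fin mulr_ge0 ?exprn_ge0// mulr_ge0 ?powR_ge0// invr_ge0 exprn_ge0.
rewrite ge0_integralZl//; last 3 first.
- by apply: emeasurable_funM => //; apply/measurable_EFinP; exact: measurable_wtV.
- by move=> x _; rewrite -EFinM lee_fin mulr_ge0 ?powR_ge0// invr_ge0 exprn_ge0.
- by rewrite lee_fin exprn_ge0.
have h := weighted_mass mcf (fun x => _ : 0 <= (cmod (f x) `^ u)%:E)%E (_ : 0 <= A%:E)%E hA.
apply: (@le_lt_trans _ _ ((B ^+ d.+2)%:E * ((2 ^+ d.+2 * 2 ^+ d.+1)%:E * A%:E))%E).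
  by rewrite lee_wpmul2l ?lee_fin ?exprn_ge0//; apply: h => [x|]; rewrite lee_fin ?powR_ge0.
by rewrite -!EFinM ltry.
Qed.

(** Against a Schwartz function the partial sums converge by [cutoff_fourier]
    to the distribution, and by dominated convergence to the integral of the
    sum; the majorant is integrable since a Schwartz function is bounded by a
    weight adapted to unit cubes. *)
Lemma csum_represents theta0 T g (A : R) : resolution theta0 -> tempered T ->
  pieces theta0 T g -> 0 <= A ->
  (forall k, \int[mu]_(x in @cube_set R d (0%R, k)) abs_sum g x <= A%:E)%E ->
  represents T (csum g).
Proof.
move=> ht tT pg A0 hA.
have mg j : cmeas (g j) by have [[]] := pg j.
have mS := cmeas_csum mg; have mG := measurable_abs_sum mg.
split.
  apply: (loc_integrable_mass mS A0) => k; apply: le_trans (hA k).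
  apply: ge0_le_integral => //.
  - exact: cube_measurable.
  - by move=> x _; rewrite lee_fin powR_ge0.
  - apply: measurable_funTS; apply/measurable_EFinP.
    apply: (measurableT_comp (measurable_powR _)); exact: measurable_cmod.
  - exact: measurable_funTS.
  - by move=> x _; rewrite powRr1// cmod_csum.
move=> h sh; have [B bB] := schwartz_dbound 0 d.+2%:Z sh; have B0 := dbound_ge0 bB.
have mh := schwartz_cmeas sh.
have mch : measurable_fun setT (fun x => (cmod (h x))%:E).
  by apply/measurable_EFinP; exact: measurable_cmod.
pose G x := (abs_sum g x * (cmod (h x))%:E)%E.
have mGh : measurable_fun setT G by apply: emeasurable_funM.
have G0 x : (0 <= G x)%E by rewrite mule_ge0 ?abs_sum_ge0// lee_fin.
have iG : mu.-integrable setT G.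
  apply/integrableP; split=> //; under eq_integral do rewrite gee0_abs//.
  apply: (@le_lt_trans _ _ (\int[mu]_x (B%:E * (((wt x ^+ d.+2)^-1)%:E * abs_sum g x)))%E).
    apply: ge0_le_integral => //.
    - apply: measurable_funeM; apply: emeasurable_funM => //.
      by apply/measurable_EFinP; exact: measurable_wtV.
    - move=> x _; rewrite /G muleC muleA lee_wpmul2r ?abs_sum_ge0// -EFinM lee_fin.
      by rewrite ler_pdivlMr ?wtX_gt0// mulrC; exact: (dbound_val bB).
  rewrite ge0_integralZl//; last 2 first.
  - by apply: emeasurable_funM => //; apply/measurable_EFinP; exact: measurable_wtV.
  - by move=> x _; rewrite mule_ge0 ?abs_sum_ge0// lee_fin invr_ge0 exprn_ge0.
  have hw := weighted_mass mG (@abs_sum_ge0 g) (_ : 0 <= A%:E)%E hA.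
  apply: (@le_lt_trans _ _ (B%:E * ((2 ^+ d.+2 * 2 ^+ d.+1)%:E * A%:E))%E).
    by rewrite lee_wpmul2l ?lee_fin//; apply: hw; rewrite lee_fin.
  by rewrite -!EFinM ltry.
pose F n x := (\sum_(j < n) g j x) * h x.
have cF x : (G x < +oo)%E ->
    (fun n => complex.Re (F n x)) @ \oo --> complex.Re (csum g x * h x) /\
    (fun n => complex.Im (F n x)) @ \oo --> complex.Im (csum g x * h x).
  have [h0 _|hn0 Goo] := eqVneq (h x) 0.
    by rewrite /F h0 mulr0; split; under eq_cvg do rewrite mulr0; exact: cvg_cst.
  have goo : (abs_sum g x < +oo)%E.
    have c0 : (0 < (cmod (h x))%:E)%E.
      by rewrite lte_fin lt_neqAle cmod_ge0 andbT eq_sym; apply: contra hn0 => /eqP/cmod_eq0 ->.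
    rewrite ltey; apply/negP => /eqP e; move: Goo; rewrite /G e gt0_mulye// ltxx//.
  have [cR cI] := csum_cvg goo; split.
    rewrite Re_mul; under eq_cvg do rewrite /F Re_mul.
    by apply: cvgB; apply: cvgM => //; exact: cvg_cst.
  rewrite Im_mul; under eq_cvg do rewrite /F Im_mul.
  by apply: cvgD; apply: cvgM => //; exact: cvg_cst.
have [|||i1 cR cI] := @cdominated F (fun x => csum g x * h x) G _ _ iG _ cF.
- by move=> n; apply: cmeasM => //; exact: (cmeas_sum (index_enum 'I_n) (fun j => mg j)).
- exact: cmeasM.
- by move=> x n; rewrite /F cmodM EFinM /G lee_wpmul2r ?lee_fin// cmod_partial_sum.
split=> //.
have eF n : cint (F n.+1) = \sum_(j < n.+1) piece theta0 T j h.
  have [_ e] := cintegral_sum (index_enum 'I_n.+1) (fun j : 'I_n.+1 => ((pg j).2 h sh).1).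
  rewrite (eq_bigr _ (fun (j : 'I_n.+1) _ => ((pg j).2 h sh).2)) -e.
  by congr cintegral; apply/funext => x; rewrite /F mulr_suml.
have [K hK] := cutoff_fourier ht tT sh.
have lim (r : C -> R) : (forall z w, r z - r w = r (z - w)) -> (forall z, `|r z| <= cmod z) ->
   (fun n => r (cint (F n))) @ \oo --> r (cint (fun x => csum g x * h x)) ->
   r (T h) = r (cint (fun x => csum g x * h x)).
  move=> rB rle cr.
  have c2 : (fun n => r (cint (F n.+1))) @ \oo --> r (cint (fun x => csum g x * h x)).
    by move/(cvg_comp (addn^~ 1%N) _ (cvg_addnr 1)): cr; under eq_cvg do rewrite /= addn1.
  apply: (cvg_unique _ _ c2); first exact: norm_hausdorff.
  apply/cvgrPdist_le => e e0; near=> n.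
  rewrite eF sum_pieces// rB; apply: le_trans (rle _) _; rewrite cmodC.
  apply: le_trans (hK n) _; rewrite ler_pdivrMr ?exprn_gt0//.
  apply: (@le_trans _ _ (n%:R * e)).
    by rewrite -ler_pdivrMr//; near: n; exact: nbhs_infty_ger.
  by rewrite mulrC ler_wpM2l ?(ltW e0)// -natrX ler_nat ltnW// ltn_expl.
apply: complex_ext.
  by apply: (lim (@complex.Re R)) => // [z w|z]; rewrite ?Re_add ?Re_opp ?Re_le_cmod.
by apply: (lim (@complex.Im R)) => // [z w|z]; rewrite ?Im_add ?Im_opp ?Im_le_cmod.
Unshelve. all: by end_near. Qed.

End function_series.

(** * Convolution with a rapidly decreasing weight *)

Section convolution.
Context (R : realType) (d : nat).
Local Notation E := ('rV[R]_d).
Local Notation C := (R[i]).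
Local Notation mu := (lebesgue_rV R d).
Local Notation cint f := (cintegral setT f).
Local Notation cibl f := (cintegrable setT f).
Implicit Types (f g h : E -> C) (x y v : E) (T : dist R d).

Variables (w : E -> R) (mw : measurable_fun setT w) (w0 : forall x, 0 <= w x).
Hypothesis hw : forall n, exists A, forall x, wt x ^+ n * w x <= A.

(** The weight [w] is not assumed to be smooth: below it is the modulus of a
    Schwartz function. *)
Definition conv f : E -> C := fun y => cint (fun x => (w x)%:C%C * f (y - x)).

Lemma cmeas_shift f y : schwartz f -> cmeas (fun x => f (y - x)).
Proof.
move=> sf; rewrite (_ : (fun _ => _) = f \o aff (-1) y).
  by apply: schwartz_cmeas; apply: schwartz_aff => //; rewrite oppr_eq0 oner_neq0.
by apply/funext => x; rewrite /aff /= scaleN1r addrC.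
Qed.

Lemma conv_cibl f y : schwartz f -> cibl (fun x => (w x)%:C%C * f (y - x)).
Proof.
move=> sf; have [A hA] := hw d.+2; have [B bB] := schwartz_dbound 0 0 sf.
have [] := @cintegrable_decay R d (fun x => (w x)%:C%C * f (y - x)) (A * B) => //.
  by apply: cmeasM; [exact: cmeas_real|exact: cmeas_shift].
move=> x; rewrite cmodM cmod_real ger0_norm// (mulrA (wt x ^+ d.+2)).
have h2 : cmod (f (y - x)) <= B by have := dbound_val bB (y - x); rewrite expr0z mul1r.
exact: ler_pM (mulr_ge0 (wtX_ge0 d.+2 x) (w0 x)) (cmod_ge0 _) (hA x) h2.
Qed.

Lemma conv_grad f y : schwartz f -> cdiff (conv f) y /\
  forall i, partial i (conv f) y = conv (partial i f) y.
Proof.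
move=> sf; have [A hA] := hw d.+2; have [B bB] := schwartz_dbound 2 0%N sf.
have B0 := dbound_ge0 bB.
apply: (@differentiation_under R d (fun y x => (w x)%:C%C * f (y - x))
   (fun i y x => (w x)%:C%C * partial i f (y - x)) (A * (2 * B))).
- by move=> z; exact: conv_cibl.
- by move=> i; apply: conv_cibl; exact: schwartz_partial.
move=> v x v1; rewrite [X in cmod X](_ : _ = (w x)%:C%C * (f (y - x + v) - f (y - x) -
    \sum_i (v ord0 i)%:C%C * partial i f (y - x))); last first.
  rewrite (addrAC y v) !mulrBr mulr_sumr; congr (_ - _).
  by apply: eq_bigr => i _; rewrite mulrCA.
have := ctaylor2 (schwartz_smoothn sf) bB (y - x) v1; rewrite !expr0 mul1r divr1 => h.
rewrite cmodM cmod_real ger0_norm//.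
apply: (@le_trans _ _ (w x * (2 * B * n1 v ^+ 2))); first by rewrite ler_wpM2l.
have wA : w x <= A / wt x ^+ d.+2 by rewrite ler_pdivlMr ?wtX_gt0// mulrC.
rewrite (_ : _ / _ * _ = A / wt x ^+ d.+2 * (2 * B * n1 v ^+ 2)); last by ring.
by rewrite ler_wpM2r// mulr_ge0 ?sqr_ge0// mulr_ge0.
Qed.

Lemma partial_conv i f : schwartz f -> partial i (conv f) = conv (partial i f).
Proof. by move=> sf; apply/funext => y; have [_ ->] := conv_grad y sf. Qed.

Lemma conv_decay f n : schwartz f -> exists A, forall y, wt y ^+ n * cmod (conv f y) <= A.
Proof.
move=> sf; have [A hA] := hw (n + d.+2); have [B bB] := schwartz_dbound 0 n sf.
exists (2 * wt_mass R d * (A * B)) => y.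
rewrite mulrC -ler_pdivlMr ?wtX_gt0// -[leRHS]mulrA.
apply: cintegral_decay_le; first exact: conv_cibl.
move=> x; rewrite ler_pdivlMr ?wtX_gt0// cmodM cmod_real ger0_norm//.
apply: (@le_trans _ _ ((wt x ^+ (n + d.+2) * w x) * (wt (y - x) ^+ n * cmod (f (y - x))))).
  have hy : wt y ^+ n <= wt x ^+ n * wt (y - x) ^+ n.
    by rewrite -exprMn lerXn2r ?nnegrE ?mulr_ge0// -{1}(subrK x y) addrC wtD.
  rewrite exprD; move: hy (wtX_ge0 d.+2 x).
  move: (wt y ^+ n) (wt x ^+ n) (wt (y - x) ^+ n) (wt x ^+ d.+2) => a b c e hy e0.
  rewrite (_ : _ * a = a * (e * (w x * cmod (f (y - x))))); last by ring.
  rewrite (_ : b * e * _ * _ = b * c * (e * (w x * cmod (f (y - x))))); last by ring.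
  by rewrite ler_wpM2r// !mulr_ge0.
apply: ler_pM => //; last exact: (dbound_val bB).
  by apply: mulr_ge0 => //; exact: wtX_ge0.
by apply: mulr_ge0 => //; exact: wtX_ge0.
Qed.

Lemma schwartz_conv f : schwartz f -> schwartz (conv f).
Proof.
move=> sf; apply/schwartzP; split.
  apply/smoothP => k; elim: k f sf => [|k IH] f sf.
    by apply: smoothn0 => x; have [] := conv_grad x sf.
  apply: smoothnS => [x|i]; first by have [] := conv_grad x sf.
  by rewrite partial_conv//; apply: IH; exact: schwartz_partial.
move=> k z; elim: k f sf => [|k IH] f sf.
  have [A hA] := conv_decay `|z|%N sf; exists A; apply: dbound0 => x.
  apply: le_trans (hA x); rewrite ler_wpM2r//.
  by apply: (@ler_wtz _ _ z `|z|%N%:Z); lia.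
have [A hA] := conv_decay `|z|%N sf.
have /choice[B hB] i : exists A, dbound k z (conv (partial i f)) A.
  by apply: IH; exact: schwartz_partial.
have B0 i := dbound_ge0 (hB i); have A0 : 0 <= A by apply: le_trans (hA 0); rewrite mulr_ge0 ?wtX_ge0.
exists (A + \sum_i B i); apply: dboundS => [x|i].
  apply: (@le_trans _ _ A); last by rewrite lerDl sumr_ge0.
  apply: le_trans (hA x); rewrite ler_wpM2r//.
  by apply: (@ler_wtz _ _ z `|z|%N%:Z); lia.
rewrite partial_conv//; apply: dbound_le (hB i) => //.
by rewrite (bigD1 i)//= addrCA lerDl addr_ge0// sumr_ge0.
Qed.

End convolution.

(** * Reproducing kernels of the pieces *)

Section reproducing.
Context (R : realType) (d : nat).
Local Notation E := ('rV[R]_d).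
Local Notation C := (R[i]).
Local Notation mu := (lebesgue_rV R d).
Local Notation cint f := (cintegral setT f).
Local Notation cibl f := (cintegrable setT f).
Local Notation fK := (((2 * pi) `^ (- (d%:R / 2)))%R : R).
Implicit Types (f g h : E -> C) (x y v : E) (T : dist R d).
Variables (theta0 : E -> C) (htheta : resolution theta0).
Local Notation cutoff := (@cutoff R d theta0).

Lemma enormZ (a : R) x : 0 <= a -> enorm (a *: x) = a * enorm x.
Proof.
move=> a0; rewrite /enorm (eq_bigr (fun i => a ^+ 2 * x ord0 i ^+ 2)).
  by rewrite -mulr_sumr sqrtrM ?sqr_ge0// sqrtr_sqr ger0_norm.
by move=> i _; rewrite mxE exprMn.
Qed.

(** The support of [theta theta0 j] lies in the ball of radius [3 / 2 * 2 ^
    j], inside the ball of radius [2 ^ j.+1] where the cutoff equals 1. *)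
Lemma theta_cutoff j x : theta theta0 j x * cutoff (2 ^- j.+1) x = theta theta0 j x.
Proof.
case: htheta => _ h1 h0.
have t0 n : 0 <= (2 ^- n : R) by rewrite invr_ge0 exprn_ge0.
have [xs|xl] := leP (enorm (2 ^- j.+1 *: x)) 1.
  by rewrite /cutoff h1// mulr1.
rewrite (_ : theta theta0 j x = 0) ?mul0r//.
rewrite enormZ// in xl.
case: j xl => [|j] /=.
  rewrite expr1 => h; apply: h0; lra.
rewrite [2 ^+ j.+2]exprS invfM => h.
have h' : 2 < 2 ^- j.+1 * enorm x by lra.
rewrite h0; last by rewrite enormZ//; lra.
by rewrite h0 ?subrr// enormZ ?mulr_ge0// -mulrA; lra.
Qed.

Definition band_kernel (t : R) : E -> C := fun z => fK%:C%C * fourier (cutoff t) z.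

Lemma schwartz_kernel t : t != 0 -> schwartz (band_kernel t).
Proof. by move=> t0; apply: schwartzZ; apply: schwartz_fourier; exact: schwartz_cutoff. Qed.

Lemma kernel_dilate t z : 0 < t ->
  band_kernel t z = ((t^-1 ^+ d)%:C)%C * (fK%:C%C * fourier theta0 (t^-1 *: z)).
Proof.
move=> t0; rewrite /band_kernel [RHS]mulrCA; congr (_ * _).
have e : (fun xi => wave 0 xi * theta0 (t *: xi)) = cutoff t.
  by apply/funext => x; rewrite /wave dotpC dotp0l expi0 mul1r.
by have := fourier_wave_dilate 0 z t0 (schwartz_theta0 htheta); rewrite subr0 e => <-.
Qed.

Lemma schwartz_shift f x : schwartz f -> schwartz (fun y => f (y - x)).
Proof.
move=> sf; rewrite (_ : (fun _ => _) = f \o aff 1 (- x)).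
  by apply: schwartz_aff => //; exact: oner_neq0.
by apply/funext => y; rewrite /aff /= scale1r.
Qed.

(** The convolution theorem, in disguise: the inverse transform of [h] is
    moved to the other factor by [fourier_swap], where the plane wave becomes
    a translation. *)
Lemma fourier_cutoff_conv t h y : 0 < t -> schwartz h ->
  fourier (fun xi => cutoff t xi * inv_fourier h xi) y =
  cint (fun x => band_kernel t (y - x) * h x).
Proof.
move=> t0 sh; have tn0 : t != 0 by rewrite gt_eqF.
have sc := schwartz_cutoff htheta tn0.
have sco := schwartz_opp_arg sc.
have sF := schwartz_fourier sh.
have scu : schwartz (fun xi => cutoff t xi * inv_fourier h xi).
  by apply: slow_schwartz; [exact: schwartz_slow|exact: schwartz_inv_fourier].
rewrite fourierE -(cintegral_opp (schwartz_cintegrable (schwartz_wave (- y) scu))).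
rewrite (_ : (fun x => _ * _) = fun xi => fourier h xi * (wave y xi * cutoff t (- xi))); last first.
  apply/funext => xi; rewrite inv_fourierE opprK /wave dotpNl dotpNr opprK; ring.
rewrite fourier_swap//; last by apply: slow_schwartz => //; exact: slow_wave.
rewrite -cintegralZ; last first.
  apply: schwartz_cintegrable; apply: slow_schwartz; first exact: schwartz_slow.
  by apply: schwartz_fourier; apply: slow_schwartz => //; exact: slow_wave.
congr cintegral; apply/funext => x.
have := fourier_wave_dilate y x ltr01 sco.
rewrite invr1 expr1n (rmorph1 (real_complex R)) mul1r scale1r fourier_opp_arg// opprB.
rewrite (_ : (fun xi => _ * cutoff t (- (1 *: xi))) = fun xi => wave y xi * cutoff t (- xi)).
  by move=> e; rewrite e /band_kernel mulrA mulrAC.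
by apply/funext => xi; rewrite scale1r.
Qed.

(** The [j]-th piece does not see the difference between [h] and its
    mollification by the kernel, because the cutoff equals 1 on the support of
    [theta theta0 j]. *)
Lemma piece_kernel T j h : schwartz h ->
  piece theta0 T j h = piece theta0 T j (fun y => cint (fun x => band_kernel (2 ^- j.+1) (y - x) * h x)).
Proof.
move=> sh; have t0 : 0 < (2 ^- j.+1 : R) by rewrite invr_gt0 exprn_gt0.
have -> : (fun y => cint (fun x => band_kernel (2 ^- j.+1) (y - x) * h x)) =
   fourier (fun xi => cutoff (2 ^- j.+1) xi * inv_fourier h xi).
  by apply/funext => y; rewrite fourier_cutoff_conv.
rewrite !pieceE; congr (T (fourier _)); apply/funext => xi.
rewrite fourier_inversion; first by rewrite mulrA theta_cutoff.
apply: slow_schwartz; last exact: schwartz_inv_fourier.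
by apply: schwartz_slow; apply: (schwartz_cutoff htheta); rewrite gt_eqF.
Qed.

Lemma piece_bound T j : tempered T -> exists N (c : R), 0 <= c /\
  forall h A, schwartz h -> dbound N N%:Z h A -> cmod (piece theta0 T j h) <= c * A.
Proof.
move=> tT; have [M [c [c0 hc]]] := tempered_bound tT.
have [M1 [K1 [K10 h1]]] := fourier_bounded R d M M.
have [M2 [K2 [K20 h2]]] := fourier_bounded R d M1 M1.
have st := schwartz_theta htheta j.
have [B bB] := schwartz_dbound M1 0 st; have B0 := dbound_ge0 bB.
exists M2, (c * (K1 * (2 ^+ M1 * (B * K2)))); split.
  by rewrite !mulr_ge0// exprn_ge0.
move=> h A sh bA.
have si := schwartz_inv_fourier sh.
have bi : dbound M1 M1 (inv_fourier h) (K2 * A).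
  rewrite inv_fourierE'; apply: dbound_opp_arg; first exact: smoothn_fourier.
  exact: h2.
have sm := slow_schwartz (schwartz_slow st) si.
have := dboundM (schwartz_smoothn st) (schwartz_smoothn si) bB bi.
rewrite add0r => /(h1 _ _ sm) /(hc _ _ (schwartz_fourier sm)).
by rewrite pieceE -!mulrA.
Qed.

Lemma measurable_subE : measurable_fun setT (fun p : E * E => p.1 - p.2).
Proof.
apply: measurable_fun_rVP => i.
rewrite (_ : _ \o _ = fun p : E * E => p.1 ord0 i - p.2 ord0 i); last first.
  by apply/funext => p; rewrite /rV_coord /= !mxE.
apply: measurable_funB.
  by apply: (measurableT_comp (@measurable_coordE R d i)); exact: measurable_fst.
by apply: (measurableT_comp (@measurable_coordE R d i)); exact: measurable_snd.
Qed.

Section band.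
Variables (T : dist R d) (tT : tempered T) (j : nat) (g : E -> C).
Hypothesis rg : represents (piece theta0 T j) g.
Local Notation ker := (band_kernel (2 ^- j.+1)).

(** The entire function of exponential type that represents the [j]-th piece,
    as the convolution of a density with the (reflected) kernel. Unlike the
    density [g], it has pointwise values that can be estimated. *)
Definition band x : C := cint (fun y => g y * ker (y - x)).

Let tn0 : 2 ^- j.+1 != 0 :> R. Proof. by rewrite invr_eq0 expf_neq0. Qed.
Let sk := schwartz_kernel tn0.
Let mg : cmeas g. Proof. by case: rg => -[m1 m2 _] _; split. Qed.

Lemma band_cibl x : cibl (fun y => g y * ker (y - x)).
Proof. by have [] := rg.2 _ (schwartz_shift x sk). Qed.

(** A tempered distribution tested on the translates of a Schwartz function
    grows polynomially, the weight being submultiplicative. *)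
Lemma band_growth : exists (N : nat) (K : R), forall x, cmod (band x) <= K * wt x ^+ N.
Proof.
have [N [c [c0 hc]]] := piece_bound j tT.
have [A bA] := schwartz_dbound N N%:Z sk.
exists N, (c * A) => x.
have [_ e] := rg.2 _ (schwartz_shift x sk); rewrite /band -e.
have ->  : (fun y => ker (y - x)) = ker \o aff 1 (- x).
  by apply/funext => y; rewrite /aff /= scale1r.
have := @dbound_aff R d N N%:Z ker 1 1 (wt x ^+ N) A (- x) (schwartz_smoothn sk) bA _ (lexx 1) _.
rewrite normr1 expr1n mul1r => /(_ (lexx 1)) h; rewrite -mulrA (mulrC A).
apply: hc; first by apply: schwartz_aff => //; exact: oner_neq0.
apply: h => y; rewrite /aff scale1r -!exprnP -exprMn lerXn2r ?nnegrE ?mulr_ge0//.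
by rewrite -{1}(subrK x y) addrC wtD.
Qed.

(** To exchange the integrals, an integrable majorant in [y] is needed, while
    [g] is only known to be integrable against Schwartz functions. The
    convolution of [cmod ker] with the Gaussian is one, and it dominates the
    inner integral. *)
Lemma band_fubini h : schwartz h -> (forall x, cmod (h x) <= gauss x) ->
  cibl (fun x => band x * h x) /\
  cint (fun x => band x * h x) = cint (fun y => g y * h y).
Proof.
move=> sh hG; pose w x := cmod (ker x).
have mw : measurable_fun setT w by apply: measurable_cmod; exact: schwartz_cmeas.
have w0 x : 0 <= w x by rewrite /w.
have hw n : exists A, forall x, wt x ^+ n * w x <= A.
  by have [A bA] := schwartz_dbound 0 n sk; exists A; exact: (dbound_val bA).
have sG := schwartz_cgauss R d.
have sm := schwartz_conv mw w0 hw sG; set m := conv _ _ in sm.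
have mE y : (\int[mu]_x (cmod (ker (y - x) * h x))%:E <= (cmod (m y))%:E)%E.
  have mg' : measurable_fun setT (fun x => w x * gauss (y - x)).
    apply: measurable_funM => //.
    by have [] := cmeas_shift y sG.
  have iE : (\int[mu]_x (w x * gauss (y - x))%:E)%E = (complex.Re (m y))%:E.
    rewrite /m /conv /cintegral /Rintegral /= fineK.
      by apply: eq_integral => x _; rewrite /= !mul0r subr0.
    have [i1 _] := conv_cibl mw w0 hw y sG.
    exact: integrable_fin_num.
  have [_ hm] := ler_normlP _ _ (Re_le_cmod (m y)).
  apply: (@le_trans _ _ (complex.Re (m y))%:E); last by rewrite lee_fin.
  rewrite -iE.
  (* The convolution is symmetric: substitute [y - x] for [x]. *)
  have -> : (\int[mu]_x (w x * gauss (y - x))%:E = \int[mu]_x (w (y - x) * gauss x)%:E)%E.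
    have := @ge0_integral_aff R d (-1) y (fun x => (w x * gauss (y - x))%:E).
    rewrite oppr_eq0 oner_neq0 normrN1 invr1 expr1n mul1e => <-; last 3 first.
    - by [].
    - exact/measurable_EFinP.
    - by move=> x; rewrite lee_fin mulr_ge0// gauss_ge0.
    by apply: eq_integral => x _; rewrite /aff scaleN1r (addrC (- x)) opprB (addrC y (x - y)) subrK.
  apply: ge0_le_integral => //.
  - by move=> x _; rewrite lee_fin.
  - apply/measurable_EFinP; apply: measurable_cmod; apply: cmeasM.
      by apply: cmeas_shift.
    exact: schwartz_cmeas.
  - apply/measurable_EFinP; apply: measurable_funM.
      by apply: measurable_cmod; apply: cmeas_shift.
    by have [] := schwartz_cmeas sG.
  - by move=> x _; rewrite lee_fin cmodM ler_wpM2l.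
pose F (p : E * E) : C := g p.1 * (ker (p.1 - p.2) * h p.2).
have mF : cmeas F.
  apply: cmeasM; first by apply: cmeas_comp => //; exact: measurable_fst.
  apply: cmeasM; last by apply: cmeas_comp; [exact: measurable_snd|exact: schwartz_cmeas].
  by apply: (cmeas_comp measurable_subE); exact: schwartz_cmeas.
have sky y : schwartz (fun x => ker (y - x) * h x).
  apply: slow_schwartz => //; apply: schwartz_slow.
  rewrite (_ : (fun _ => _) = ker \o aff (-1) y).
    by apply: schwartz_aff => //; rewrite oppr_eq0 oner_neq0.
  by apply/funext => x; rewrite /aff /= scaleN1r addrC.
have [||||I1 I2 eF] := @cfubini R d F.
- exact: mF.
- have im := cintegrable_cmod (rg.2 _ sm).1; apply: le_lt_trans im.
  have mcF : measurable_fun setT (fun p => (cmod (F p))%:E).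
    by apply/measurable_EFinP; exact: measurable_cmod.
  apply: ge0_le_integral => //.
  + by move=> y _; apply: integral_ge0 => x _; rewrite lee_fin.
  + by apply: (measurable_fun_fubini_tonelli_F (fun p => (cmod (F p))%:E)) => // p; rewrite lee_fin.
  + apply/measurable_EFinP; apply: measurable_cmod; apply: cmeasM => //.
    exact: schwartz_cmeas.
  + move=> y _; rewrite (cmodM (g y) (m y)) EFinM.
    rewrite (eq_integral (fun x => (cmod (g y))%:E * (cmod (ker (y - x) * h x))%:E)%E); last first.
      by move=> x _; rewrite /F cmodM EFinM.
    rewrite ge0_integralZl//; last 3 first.
    * by apply/measurable_EFinP; apply: measurable_cmod; exact: schwartz_cmeas.
    * by move=> x _; rewrite lee_fin.
    * by rewrite lee_fin.
    by rewrite lee_wpmul2l ?lee_fin// mE.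
- by move=> y; apply: (cintegrableZ (g y) (schwartz_cintegrable (sky y))).
- move=> x; rewrite (_ : (fun _ => _) = fun y => h x * (g y * ker (y - x))).
    by apply: cintegrableZ; exact: band_cibl.
  by apply/funext => y; rewrite /F /=; ring.
have e1 : (fun y => cint (fun x => F (x, y))) = fun x => band x * h x.
  apply/funext => x; rewrite /band mulrC -cintegralZ; last exact: band_cibl.
  by congr cintegral; apply/funext => y; rewrite /F /=; ring.
split; first exact: (eq_ind _ (fun u => cibl u) I2 _ e1).
transitivity (cint (fun x => cint (fun y => F (x, y)))).
  exact (etrans (congr1 (cintegral setT) (esym e1)) (esym eF)).
have sh' : schwartz (fun y => cint (fun x => ker (y - x) * h x)).
  have t0 : 0 < (2 ^- j.+1 : R) by rewrite invr_gt0 exprn_gt0.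
  have -> : (fun y => cint (fun x => ker (y - x) * h x)) =
     fourier (fun xi => cutoff (2 ^- j.+1) xi * inv_fourier h xi).
    by apply/funext => y; rewrite fourier_cutoff_conv.
  apply: schwartz_fourier; apply: slow_schwartz; last exact: schwartz_inv_fourier.
  by apply: schwartz_slow; apply: (schwartz_cutoff htheta).
have [_ eh] := rg.2 _ sh; have [_ eh'] := rg.2 _ sh'.
rewrite -eh (piece_kernel _ _ sh) eh'; congr cintegral; apply/funext => y.
by rewrite -(cintegralZ (g y) (schwartz_cintegrable (sky y))).
Qed.

Lemma band_cmeas : cmeas band.
Proof.
have sG := schwartz_cgauss R d.
have [|i _] := @band_fubini (@cgauss R d) sG.
  by move=> x; rewrite cmod_real ger0_norm ?gauss_ge0.
(* Fubini's theorem gives measurability after multiplication by a Schwartz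
   function; the Gaussian can be divided out since it does not vanish. *)
have -> : band = fun x => (band x * cgauss x) * ((gauss x)^-1)%:C%C.
  apply/funext => x; rewrite -mulrA /cgauss -(rmorphM (real_complex R)) divff ?gt_eqF ?gauss_gt0//.
  by rewrite (rmorph1 (real_complex R)) mulr1.
apply: cmeasM; first exact: cintegrable_cmeas.
have [mG _] := schwartz_cmeas sG.
apply: cmeas_real; rewrite (_ : (fun x => _) = fun x => expR (- (- (sqsum x / 2)))).
  apply: continuous_measurable_rV => x.
  have [q _] := sqsum_grad x; have cq := differentiable_continuous q.
  apply: (@continuous_comp _ _ _ (fun x : E => - (sqsum x / 2)) (fun t => expR (- t))) => //.
  apply: (@continuous_comp _ _ _ (fun t : R => - t) expR); first exact: opp_continuous.
  exact: continuous_expR.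
by apply/funext => x; rewrite /gauss -expRN.
Qed.

Lemma band_ae : {ae mu, forall x, g x = band x}.
Proof.
have sG := schwartz_cgauss R d.
have hG x : cmod (@cgauss R d x) <= gauss x by rewrite cmod_real ger0_norm ?gauss_ge0.
have sub h : schwartz h -> (forall x, cmod (h x) <= gauss x) ->
    cibl (fun x => (g x - band x) * h x) /\ cint (fun x => (g x - band x) * h x) = 0.
  move=> sh hh; have [i1 e1] := band_fubini sh hh; have [i2 _] := rg.2 _ sh.
  have [i3 e3] := cintegralB i2 i1.
  rewrite (_ : (fun x => _ * _) = fun x => g x * h x - band x * h x); last first.
    by apply/funext => x; rewrite mulrBl.
  by split=> //; rewrite e3 e1 subrr.
have := test_unique (sub _ sG hG).1 (fun n L => (sub _ (schwartz_test n L) _).2).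
move=> h; have : {ae mu, forall x, g x - band x = 0}.
  apply: h => n L x; rewrite /test cmodM !cmod_real !ger0_norm ?steps_ge0 ?gauss_ge0//.
  by rewrite ler_piMl ?gauss_ge0// steps_le1.
by apply: filterS => x /eqP; rewrite subr_eq0 => /eqP.
Qed.

Lemma cintegral_ae f h : cmeas f -> cmeas h -> {ae mu, forall x, f x = h x} -> cint f = cint h.
Proof.
move=> mf mh fh; rewrite /cintegral /Rintegral; congr (Complex (fine _) (fine _)).
- apply: ae_eq_integral => //.
  + by apply/measurable_EFinP; exact: mf.1.
  + by apply/measurable_EFinP; exact: mh.1.
  by apply: filterS fh => x e _ /=; rewrite e.
- apply: ae_eq_integral => //.
  + by apply/measurable_EFinP; exact: mf.2.
  + by apply/measurable_EFinP; exact: mh.2.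
  by apply: filterS fh => x e _ /=; rewrite e.
Qed.

(** The integral that defines [band] does not change when the density is
    modified on a null set, so that [band] may be inserted for [g]. *)
Lemma band_fixed x : cibl (fun y => band y * ker (y - x)) /\
  band x = cint (fun y => band y * ker (y - x)).
Proof.
have mk : cmeas (fun y => ker (y - x)) by apply: schwartz_cmeas; exact: schwartz_shift.
have mb := band_cmeas.
have e : {ae mu, forall y, g y * ker (y - x) = band y * ker (y - x)}.
  by apply: filterS band_ae => y ->.
split; last by apply: cintegral_ae => //; exact: cmeasM.
apply/cintegrableP; split; first exact: cmeasM.
have <- : (\int[mu]_y (cmod (g y * ker (y - x)))%:E =
           \int[mu]_y (cmod (band y * ker (y - x)))%:E)%E; last first.
  exact: cintegrable_cmod (band_cibl x).
apply: ae_eq_integral => //.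
- by apply/measurable_EFinP; apply: measurable_cmod; exact: cmeasM.
- by apply/measurable_EFinP; apply: measurable_cmod; exact: cmeasM.
- by apply: filterS e => y e _; rewrite e.
Qed.

End band.
End reproducing.

(** * A maximal inequality for exponents below one *)

Section maximal_inequality.
Context (R : realType) (d : nat).
Local Notation E := ('rV[R]_d).
Local Notation C := (R[i]).
Local Notation mu := (lebesgue_rV R d).
Local Notation cint f := (cintegral setT f).
Local Notation cibl f := (cintegrable setT f).
Implicit Types (f g h : E -> C) (x y v : E) (T : dist R d).

Lemma wt_scale (t : R) x : 1 <= t -> wt x <= wt (t *: x).
Proof.
move=> t1; rewrite /wt n1Z lerD2l ler_peMl// ger0_norm//.
exact: le_trans t1.
Qed.

(** Only the part [g `^ (1 - p)] of [g] is estimated by [S * W]; of the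
    resulting [W `^ (1 - p)], one factor [W] is passed on to [U * V] and the
    decay of [k] pays for [V]. *)
Lemma split_power (p g S W U V k K : R) : 0 < p < 1 -> 0 <= g -> 0 <= S ->
  1 <= W -> 1 <= U -> 1 <= V -> 0 <= k -> k * V <= K -> g <= S * W -> W <= U * V ->
  g * k <= K * S `^ (1 - p) * U * (g `^ p * W `^ (- p)).
Proof.
move=> /andP[p0 p1] g0 S0 W1 U1 V1 k0 kV gS WUV.
have W0 : 0 < W by apply: lt_le_trans W1.
have U0 : 0 <= U by apply: le_trans U1.
have gE : g `^ p * g `^ (1 - p) = g.
  rewrite -powRD; last by rewrite addrCA subrr addr0 oner_eq0.
  by rewrite addrCA subrr addr0 powRr1.
have h1 : g `^ (1 - p) <= S `^ (1 - p) * (W * W `^ (- p)).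
  apply: (@le_trans _ _ ((S * W) `^ (1 - p))).
    by rewrite ge0_ler_powR ?nnegrE ?mulr_ge0 ?(ltW W0) ?subr_ge0 ?(ltW p1).
  rewrite powRM ?(ltW W0)// (@powRD _ W 1 (- p)) ?powRr1 ?(ltW W0)//.
  by rewrite (gt_eqF W0) implybT.
apply: (@le_trans _ _ (g `^ p * (S `^ (1 - p) * (W * W `^ (- p))) * k)).
  by rewrite -{1}gE ler_wpM2r// ler_wpM2l ?powR_ge0.
rewrite (_ : _ * k = g `^ p * S `^ (1 - p) * W `^ (- p) * (W * k)); last by ring.
rewrite [leRHS](_ : _ = g `^ p * S `^ (1 - p) * W `^ (- p) * (U * K)); last by ring.
rewrite ler_wpM2l ?mulr_ge0 ?powR_ge0//.
apply: (@le_trans _ _ (U * V * k)); first by rewrite ler_wpM2r.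
by rewrite -mulrA ler_wpM2l// mulrC.
Qed.

(** A function reproduced by a kernel concentrated at scale [1 / t] is
    controlled pointwise by weighted means of its [p]-th power even for [p <
    1]. In the maximal function [S] of Peetre's type below, the power [1 - p]
    is absorbed by the supremum itself: [S <= c * S `^ (1 - p) * J] gives [S
    `^ p <= c * J], provided that [S] is finite, which is what the growth
    hypothesis is for. *)
Lemma maximal_bound (G k : E -> C) (p t K : R) (a : nat) :
  0 < p < 1 -> 1 <= t -> 0 <= K -> cmeas G ->
  (forall x, cibl (fun y => G y * k (y - x)) /\ G x = cint (fun y => G y * k (y - x))) ->
  (forall z, cmod (k z) * wt (t *: z) ^+ a <= K) ->
  (exists B, forall y, cmod (G y) <= B * wt y ^+ a) ->
  forall x, ((cmod (G x) `^ p)%:E <=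
    (2 * K)%:E * \int[mu]_y (cmod (G y) `^ p * (wt (t *: (x - y)) ^+ a) `^ (- p))%:E)%E.
Proof.
move=> p01 t1 K0 mG fG hk [B hB] x; have /andP[p0 p1] := p01.
have t0 : 0 <= t by apply: le_trans t1.
pose W y : R := wt (t *: (x - y)) ^+ a.
pose u y : R := cmod (G y) `^ p * W y `^ (- p).
rewrite -[X in (_ * X)%E]/(\int[mu]_y (u y)%:E)%E.
have u0 y : 0 <= u y by rewrite mulr_ge0 ?powR_ge0.
have mW : measurable_fun setT W.
  rewrite (_ : W = (fun z : E => wt z ^+ a) \o aff (- t) (t *: x)).
    apply: measurableT_comp; last exact: measurable_affE.
    by apply: measurable_funX; exact: measurable_wt.
  by apply/funext => y; rewrite /W /aff /= scalerBr scaleNr addrC.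
have mu_ : measurable_fun setT u.
  apply: measurable_funM.
    by apply: (measurableT_comp (measurable_powR _)); exact: measurable_cmod.
  by apply: (measurableT_comp (measurable_powR _)).
have W1 y : 1 <= W y by exact: wtX_ge1.
have W0 y : 0 < W y by apply: lt_le_trans (W1 y).
pose Q := [set cmod (G y) / W y | y in [set: E]].
have ubQ : ubound Q (`|B| * wt x ^+ a).
  move=> _ [y _ <-]; rewrite ler_pdivrMr//; apply: le_trans (hB y) _.
  apply: (@le_trans _ _ (`|B| * wt y ^+ a)); first by rewrite ler_wpM2r ?ler_norm// wtX_ge0.
  rewrite -mulrA ler_wpM2l// -exprMn lerXn2r ?nnegrE ?mulr_ge0//.
  apply: (@le_trans _ _ (wt x * wt (x - y))); last by rewrite ler_wpM2l// wt_scale.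
  by rewrite -{1}(subKr x y) wtB.
have supQ : has_sup Q by split; [exists (cmod (G x) / W x); exists x|exists (`|B| * wt x ^+ a)].
pose S := sup Q.
have GS y : cmod (G y) <= S * W y.
  by rewrite -ler_pdivrMr//; apply: ub_le_sup; [case: supQ|exists y].
have Wx : W x = 1 by rewrite /W subrr scaler0 /wt n1_0 addr0 expr1n.
have GxS : cmod (G x) <= S by have := GS x; rewrite Wx mulr1.
have S0 : 0 <= S by apply: le_trans GxS.
(* If the integral is infinite, there is nothing to prove unless [K = 0]; then
   the kernel vanishes, and so does [G]. *)
have [Joo|] := ltP (\int[mu]_y (u y)%:E)%E +oo%E; last first.
  rewrite leye_eq => /eqP ->; have [K00|Kn0] := eqVneq K 0.
    rewrite (_ : G x = 0) ?cmod0 ?powR0 ?gt_eqF//; first by rewrite K00 mulr0 mul0e.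
    have k0 z : k z = 0.
      apply: cmod_eq0; apply/le_anti; rewrite cmod_ge0 andbT.
      by have := hk z; rewrite K00 pmulr_lle0// wtX_gt0.
    rewrite (fG x).2 (_ : (fun _ => _) = fun=> 0) ?cintegral0//.
    by apply/funext => y; rewrite k0 mulr0.
  by rewrite gt0_muley ?leey// lte_fin mulr_gt0// lt_neqAle eq_sym Kn0.
have J0 : (0 <= \int[mu]_y (u y)%:E)%E by apply: integral_ge0 => y _; rewrite lee_fin.
have fJ : (\int[mu]_y (u y)%:E)%E \is a fin_num by rewrite ge0_fin_numE.
set J := (\int[mu]_y _)%E in Joo J0 fJ *.
rewrite -(fineK fJ) -EFinM lee_fin.
have Gz z : cmod (G z) <= 2 * (K * S `^ (1 - p) * wt (t *: (x - z)) ^+ a * fine J).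
  rewrite (fG z).2; apply: cintegral_le; first by have [] := fG z.
  rewrite EFinM (fineK fJ) /J -ge0_integralZl//; last 3 first.
  - exact/measurable_EFinP.
  - by move=> y _; rewrite lee_fin.
  - by rewrite lee_fin !mulr_ge0 ?powR_ge0 ?wtX_ge0.
  have [ig _] := fG z.
  apply: ge0_le_integral => //.
  - by move=> y _; rewrite lee_fin.
  - by apply/measurable_EFinP; apply: measurable_cmod; exact: cintegrable_cmeas.
  - by apply: measurable_funeM; exact/measurable_EFinP.
  move=> y _; rewrite -EFinM lee_fin cmodM.
  apply: (@split_power p _ S (W y) (wt (t *: (x - z)) ^+ a) (wt (t *: (y - z)) ^+ a)) => //.
  - exact: wtX_ge1.
  - exact: wtX_ge1.
  rewrite -exprMn lerXn2r ?nnegrE ?mulr_ge0//.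
  rewrite (_ : t *: (x - y) = t *: (x - z) - t *: (y - z)) ?wtB//.
  by rewrite -scalerBr opprB addrA subrK.
(* The bound of [G z] carries the factor [W z], which is exactly the
   normalisation in the definition of [S]. *)
have SJ : S <= 2 * (K * S `^ (1 - p) * fine J).
  apply: ge_sup; first by case: supQ.
  move=> _ [z _ <-]; rewrite ler_pdivrMr//; apply: le_trans (Gz z) _.
  by rewrite (_ : _ * (K * _ * _ * _) = 2 * (K * S `^ (1 - p) * fine J) * W z)//; rewrite /W; ring.
apply: (@le_trans _ _ (S `^ p)); first by rewrite ge0_ler_powR ?nnegrE ?(ltW p0).
have fJ0 : 0 <= fine J by exact: fine_ge0.
have [->|Sn0] := eqVneq S 0.
  by rewrite powR0 ?gt_eqF// mulr_ge0// mulr_ge0.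
have Sp : 0 < S by rewrite lt_neqAle eq_sym Sn0.
rewrite -(@ler_pM2l _ (S `^ (1 - p))) ?powR_gt0// -powRD; last by rewrite subrK oner_eq0.
by rewrite subrK powRr1//; apply: le_trans SJ _; rewrite le_eqVlt; apply/orP; left; apply/eqP; ring.
Qed.

End maximal_inequality.

(** * Bernstein's inequality on cubes *)

Section band_estimates.
Context (R : realType) (d : nat).
Local Notation E := ('rV[R]_d).
Local Notation C := (R[i]).
Local Notation mu := (lebesgue_rV R d).
Local Notation Q P := (@cube_set R d P).
Implicit Types (f g h : E -> C) (x y v : E) (T : dist R d).
Variables (theta0 : E -> C) (htheta : resolution theta0).
Variables (p : R) (p01 : 0 < p < 1).
Local Notation ker j := (band_kernel theta0 (2 ^- (j.+1))).

(** The kernels are the dilates of a single Schwartz function. *)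
Lemma kernel_bound (a : nat) : exists2 A, 0 <= A & forall (j : nat) z,
  cmod (ker j z) * wt (2 ^+ j *: z) ^+ a <= A * (2 ^+ j) ^+ d.
Proof.
have sF : schwartz (fun z => (((2 * pi) `^ (- (d%:R / 2)))%R : R)%:C%C * fourier theta0 z).
  by apply: schwartzZ; apply: schwartz_fourier; exact: schwartz_theta0.
have [A bA] := schwartz_dbound 0 a sF; have A0 := dbound_ge0 bA.
exists (2 ^+ d * A) => [|j z]; first by rewrite mulr_ge0// exprn_ge0.
have t0 : 0 < (2 ^- j.+1 : R) by rewrite invr_gt0 exprn_gt0.
rewrite kernel_dilate// cmodM cmod_real invrK ger0_norm ?exprn_ge0// -mulrA.
rewrite {1}exprS exprMn mulrAC -mulrA [leRHS]mulrAC -[leRHS]mulrA.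
apply: ler_wpM2l; first exact: exprn_ge0.
rewrite [leLHS]mulrC; apply: ler_wpM2l; first by rewrite !exprn_ge0.
apply: le_trans (dbound_val bA (2 ^+ j.+1 *: z)); rewrite mulrC ler_wpM2r//.
rewrite -exprnP lerXn2r ?nnegrE//.
by rewrite exprS -scalerA wt_scale// ler1n.
Qed.

(** For such [a] the weight of the maximal inequality is bounded by the one
    that [cube_weight] controls. *)
Lemma weight_power (a : nat) (t : R) v : 1 <= t -> d.+2%:R <= a%:R * p ->
  (wt (t *: v) ^+ a) `^ (- p) <= (wt v ^+ d.+2)^-1.
Proof.
move=> t1 ha; have w1 : 1 <= wt (t *: v) by [].
have w0 : 0 < wt (t *: v) by [].
rewrite powRN lef_pV2 ?posrE ?powR_gt0 ?exprn_gt0//.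
rewrite -[X in _ <= X `^ _]powR_mulrn// -powRrM.
apply: (@le_trans _ _ (wt (t *: v) ^+ d.+2)).
  by rewrite lerXn2r ?nnegrE// wt_scale.
by rewrite -powR_mulrn// ler_powR.
Qed.

Lemma measurable_cmod_powR (c : R) (f : E -> C) : cmeas f ->
  measurable_fun setT (fun x => (cmod (f x) `^ c)%:E).
Proof.
move=> mf; apply/measurable_EFinP; apply: (measurableT_comp (measurable_powR _)).
exact: measurable_cmod.
Qed.

Lemma band_mean (T : dist R d) j g (a : nat) (A : R) : tempered T ->
  represents (piece theta0 T j) g -> d.+2%:R <= a%:R * p -> 0 <= A ->
  (forall z, cmod (ker j z) * wt (2 ^+ j *: z) ^+ a <= A * (2 ^+ j) ^+ d) ->
  (exists B, forall y, cmod (band theta0 j g y) <= B * wt y ^+ a) ->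
  forall P x, 1 <= @cube_side R d P -> Q P x ->
  ((cmod (band theta0 j g x) `^ p)%:E <=
    (2 * (A * (2 ^+ j) ^+ d) * 2 ^+ d.+2)%:E *
    \int[mu]_y (cube_weight P y * (cmod (band theta0 j g y) `^ p)%:E))%E.
Proof.
move=> tT rg ha A0 hA hB P x P1 Px.
have mb := band_cmeas htheta rg.
have AK : 0 <= A * (2 ^+ j) ^+ d by rewrite mulr_ge0// !exprn_ge0.
have t1 : 1 <= (2 ^+ j : R) by rewrite exprn_ege1// ler1n.
apply: le_trans (maximal_bound p01 t1 AK mb (band_fixed htheta rg) hA hB x) _.
rewrite (EFinM (2 * _) (2 ^+ d.+2)) -muleA lee_wpmul2l ?lee_fin ?mulr_ge0//.
rewrite -ge0_integralZl//; last 2 first.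
- apply: emeasurable_funM; first exact: measurable_cube_weight.
  exact: measurable_cmod_powR.
- by move=> y _; rewrite mule_ge0 ?cube_weight_ge0// lee_fin powR_ge0.
apply: ge0_le_integral => //.
- by move=> y _; rewrite lee_fin mulr_ge0 ?powR_ge0.
- apply/measurable_EFinP; apply: measurable_funM; first by apply/measurable_EFinP; exact: measurable_cmod_powR.
  apply: (measurableT_comp (measurable_powR _)); apply: measurable_funX.
  rewrite (_ : (fun y => _) = (fun z : E => wt z) \o aff (- 2 ^+ j) (2 ^+ j *: x)).
    by apply: measurableT_comp; [exact: measurable_wt|exact: measurable_affE].
  by apply/funext => y; rewrite /aff /= scalerBr scaleNr addrC.
- apply: measurable_funeM; apply: emeasurable_funM; first exact: measurable_cube_weight.
  exact: measurable_cmod_powR.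
move=> y _; rewrite EFinM muleC muleA lee_wpmul2r ?lee_fin ?powR_ge0//.
apply: le_trans (wt_le_cube_weight y P1 Px); rewrite lee_fin.
exact: weight_power.
Qed.

(** The maximal inequality is used twice. At first its exponent has to exceed
    the growth of the band, which depends on the distribution; the resulting
    constant is useless, but it shows that the band is bounded. Then the fixed
    exponent [a0] is admissible and gives a constant that does not depend on
    the distribution. *)
Lemma band_pointwise : exists2 K : R, 0 <= K & forall (T : dist R d) j g (A : R), tempered T ->
  represents (piece theta0 T j) g -> 0 <= A ->
  (forall k, \int[mu]_(y in Q (0%R, k)) (cmod (g y) `^ p)%:E <= A%:E)%E ->
  forall P x, 1 <= @cube_side R d P -> Q P x ->
  ((cmod (band theta0 j g x) `^ p)%:E <= (K * (2 ^+ j) ^+ d)%:E *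
    \int[mu]_y (cube_weight P y * (cmod (g y) `^ p)%:E))%E.
Proof.
have /andP[p0 p1] := p01; have pn0 : p != 0 by rewrite gt_eqF.
pose a0 := Num.bound (d.+2%:R / p).
have ha0 : d.+2%:R <= a0%:R * p.
  by rewrite -ler_pdivrMr// ltW// archi_boundP// divr_ge0// ltW.
have [A0 A00 hA0] := kernel_bound a0.
exists (2 * A0 * 2 ^+ d.+2) => [|T j g A tT rg A00' hA]; first by rewrite mulr_ge0 ?exprn_ge0// mulr_ge0.
have mb := band_cmeas htheta rg.
have mg : cmeas g by case: rg => -[m1 m2 _] _; split.
have ae := band_ae htheta rg.
have eqW P : (\int[mu]_y (cube_weight P y * (cmod (band theta0 j g y) `^ p)%:E) =
              \int[mu]_y (cube_weight P y * (cmod (g y) `^ p)%:E))%E.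
  apply: ae_eq_integral => //.
  - by apply: emeasurable_funM; [exact: measurable_cube_weight|exact: measurable_cmod_powR].
  - by apply: emeasurable_funM; [exact: measurable_cube_weight|exact: measurable_cmod_powR].
  by apply: filterS ae => y ->.
(* First pass, with the exponent [N + a0]. *)
have bdd : exists B, forall y, cmod (band theta0 j g y) <= B.
  have [N [B hB]] := band_growth htheta tT rg.
  have [A1 A10 hA1] := kernel_bound (N + a0).
  exists ((2 * (A1 * (2 ^+ j) ^+ d) * 2 ^+ d.+2 * (2 ^+ d.+1 * A)) `^ p^-1) => y.
  have [k Pk] := cube_cover y 0.
  have side1 : 1 <= @cube_side R d (0, k) by rewrite /cube_side oppr0 expr0z.
  have ha : d.+2%:R <= (N + a0)%:R * p.
    by apply: le_trans ha0 _; rewrite ler_wpM2r ?(ltW p0)// ler_nat leq_addl.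
  have grow : exists B, forall y, cmod (band theta0 j g y) <= B * wt y ^+ (N + a0).
    exists `|B| => z; apply: le_trans (hB z) _.
    apply: (@le_trans _ _ (`|B| * wt z ^+ N)); first by rewrite ler_wpM2r ?wtX_ge0// ler_norm.
    by rewrite ler_wpM2l// ler_wtX// leq_addr.
  have := band_mean tT rg ha A10 (hA1 j) grow side1 Pk; rewrite eqW => h.
  have hI := @integral_cube_weight R d (0, k) (fun y => (cmod (g y) `^ p)%:E) A%:E
    (measurable_cmod_powR p mg) (fun x => _ : 0 <= (cmod (g x) `^ p)%:E)%E.
  have : ((cmod (band theta0 j g y) `^ p)%:E <=
      (2 * (A1 * (2 ^+ j) ^+ d) * 2 ^+ d.+2 * (2 ^+ d.+1 * A))%:E)%E.
    apply: le_trans h _; rewrite (EFinM (_ * 2 ^+ d.+2)) lee_wpmul2l//.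
      by rewrite lee_fin mulr_ge0 ?exprn_ge0// mulr_ge0// mulr_ge0// !exprn_ge0.
    by rewrite EFinM; apply: hI => // x; rewrite lee_fin powR_ge0.
  rewrite lee_fin => {}h.
  rewrite [leLHS](_ : _ = (cmod (band theta0 j g y) `^ p) `^ p^-1); last by rewrite -powRrM divff// powRr1.
  by rewrite ge0_ler_powR ?nnegrE ?invr_ge0 ?(ltW p0) ?powR_ge0// (le_trans _ h)// powR_ge0.
move=> P x P1 Px.
have [B hB] := bdd.
have grow : exists B, forall y, cmod (band theta0 j g y) <= B * wt y ^+ a0.
  exists `|B| => z; apply: le_trans (hB z) _; apply: le_trans (ler_norm _) _.
  by rewrite ler_peMr// wtX_ge1.
have := band_mean tT rg ha0 A00 (hA0 j) grow P1 Px; rewrite eqW.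
by rewrite (_ : 2 * A0 * _ * _ = 2 * (A0 * (2 ^+ j) ^+ d) * 2 ^+ d.+2)//; ring.
Qed.

(** Bernstein's inequality on a cube. The pointwise bound is applied to the
    factor [cmod g `^ (1 - p)] of the integrand, so that [2 ^ (j * d)] is
    raised to the power [(1 - p) / p], which gives [2 ^ (j * sigma)]. *)
Lemma band_L1 : exists2 K : R, 0 <= K & forall (T : dist R d) j g (A I : R), tempered T ->
  represents (piece theta0 T j) g -> 0 <= A ->
  (forall k, \int[mu]_(y in Q (0%R, k)) (cmod (g y) `^ p)%:E <= A%:E)%E ->
  forall P, 1 <= @cube_side R d P ->
  (\int[mu]_y (cube_weight P y * (cmod (g y) `^ p)%:E) = I%:E)%E ->
  (\int[mu]_(y in Q P) (cmod (g y))%:E <=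
    (K * (2 `^ (j%:R * sigma_ d p) * I `^ p^-1))%:E)%E.
Proof.
have /andP[p0 p1] := p01; have pn0 : p != 0 by rewrite gt_eqF.
have [K K0 hK] := band_pointwise.
pose r := (1 - p) / p.
have r0 : 0 <= r by rewrite divr_ge0 ?subr_ge0 ?(ltW p0) ?(ltW p1).
exists (K `^ r) => [|T j g A I tT rg A0 hA P P1 hI]; first exact: powR_ge0.
have mb := band_cmeas htheta rg.
have mg : cmeas g by case: rg => -[m1 m2 _] _; split.
have ae := band_ae htheta rg.
have I0 : 0 <= I.
  by rewrite -lee_fin -hI integral_ge0// => y _; rewrite mule_ge0 ?cube_weight_ge0// lee_fin powR_ge0.
set t : R := (2 ^+ j) ^+ d; have t0 : 0 <= t by rewrite !exprn_ge0.
have mQ := @cube_measurable R d P.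
have pw x : Q P x -> cmod (band theta0 j g x) <= (K * t * I) `^ r * cmod (band theta0 j g x) `^ p.
  move=> Px; have := hK T j g A tT rg A0 hA P x P1 Px.
  rewrite hI -EFinM lee_fin => h; set b := cmod _ in h *; have b0 : 0 <= b by rewrite /b.
  rewrite -{1}[b]powRr1// -{1}(subrK p 1) powRD ?subrK ?oner_eq0//.
  rewrite ler_wpM2r ?powR_ge0//.
  rewrite (_ : b `^ (1 - p) = (b `^ p) `^ r); last first.
    by rewrite -powRrM /r mulrCA divff// mulr1.
  by rewrite ge0_ler_powR ?nnegrE ?powR_ge0// !mulr_ge0.
have le1 : (\int[mu]_(y in Q P) (cmod (g y) `^ p)%:E <= I%:E)%E.
  rewrite -hI; apply: (@le_trans _ _ (\int[mu]_(y in Q P) (cube_weight P y * (cmod (g y) `^ p)%:E))%E).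
    apply: ge0_le_integral => //.
    - by move=> y _; rewrite lee_fin powR_ge0.
    - by apply: measurable_funTS; exact: measurable_cmod_powR.
    - apply: measurable_funTS; apply: emeasurable_funM; first exact: measurable_cube_weight.
      exact: measurable_cmod_powR.
    - move=> y Py; rewrite -[leLHS]mul1e lee_wpmul2r ?lee_fin ?powR_ge0//.
      exact: cube_weight_ge1.
  apply: ge0_subset_integral => //.
    by apply: emeasurable_funM; [exact: measurable_cube_weight|exact: measurable_cmod_powR].
  by move=> y _; rewrite mule_ge0 ?cube_weight_ge0// lee_fin powR_ge0.
have eQ (c : R) : (\int[mu]_(y in Q P) (cmod (g y) `^ c)%:E = \int[mu]_(y in Q P) (cmod (band theta0 j g y) `^ c)%:E)%E.
  apply: ae_eq_integral => //.
  - by apply: measurable_funTS; exact: measurable_cmod_powR.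
  - by apply: measurable_funTS; exact: measurable_cmod_powR.
  by apply: filterS ae => y ->.
have -> : (\int[mu]_(y in Q P) (cmod (g y))%:E = \int[mu]_(y in Q P) (cmod (band theta0 j g y) `^ 1)%:E)%E.
  by rewrite -eQ; apply: eq_integral => y _; rewrite powRr1.
apply: (@le_trans _ _ (\int[mu]_(y in Q P) (((K * t * I) `^ r)%:E * (cmod (band theta0 j g y) `^ p)%:E))%E).
  apply: ge0_le_integral => //.
  - by move=> y _; rewrite lee_fin powR_ge0.
  - by apply: measurable_funTS; exact: measurable_cmod_powR.
  - by apply: measurable_funTS; apply: measurable_funeM; exact: measurable_cmod_powR.
  by move=> y Py; rewrite -EFinM lee_fin powRr1// pw.
rewrite ge0_integralZl//; last 3 first.
- by apply: measurable_funTS; exact: measurable_cmod_powR.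
- by move=> y _; rewrite lee_fin powR_ge0.
- by rewrite lee_fin powR_ge0.
rewrite -eQ; apply: (@le_trans _ _ (((K * t * I) `^ r)%:E * I%:E)%E).
  by rewrite lee_wpmul2l// lee_fin powR_ge0.
rewrite -EFinM lee_fin powRM ?mulr_ge0// powRM// -!mulrA ler_wpM2l ?powR_ge0//.
rewrite le_eqVlt; apply/orP; left; apply/eqP; congr (_ * _).
  rewrite /t -exprM -powR_mulrn// -powRrM; congr (_ `^ _).
  rewrite /sigma_ max_l; last by rewrite subr_ge0 invf_ge1// ltW.
  by rewrite natrM -mulrA; congr (_ * (_ * _)); rewrite /r mulrBl divff// mul1r.
have e : r + 1 = p^-1 by rewrite /r mulrBl divff// mul1r subrK.
rewrite -e powRD ?powRr1//.
by rewrite e invr_eq0 (negbTE pn0).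
Qed.

End band_estimates.

(** * Powers of extended reals *)

Section powers.
Context (R : realType).
Implicit Types (x y : \bar R) (r p : R).

Lemma le_poweR x y r : 0 <= r -> (0 <= x)%E -> (x <= y)%E -> (x `^ r <= y `^ r)%E.
Proof.
move=> r0 x0 xy; apply: gt0_ler_poweR => //; rewrite in_itv/= leey andbT//.
exact: le_trans xy.
Qed.

Lemma poweRK x p : p != 0 -> (0 <= x)%E -> ((x `^ p) `^ p^-1 = x)%E.
Proof. by move=> p0 x0; rewrite -poweRrM divff// poweRe1. Qed.

Lemma poweRVK x p : p != 0 -> (0 <= x)%E -> ((x `^ p^-1) `^ p = x)%E.
Proof. by move=> p0 x0; rewrite -poweRrM mulVf// poweRe1. Qed.

Lemma normalized_le (c N p : R) x : 0 < c -> 0 <= N -> 0 < p -> (0 <= x)%E ->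
  ((c^-1)%:E * x `^ p^-1 <= N%:E)%E = (x <= ((c * N) `^ p)%:E)%E.
Proof.
move=> c0 N0 p0 x0; have pn0 : p != 0 by rewrite gt_eqF.
have cN : 0 <= c * N by rewrite mulr_ge0// ltW.
have -> : ((c^-1)%:E * x `^ p^-1 <= N%:E)%E = (x `^ p^-1 <= (c * N)%:E)%E.
  by rewrite lee_pdivrMl// EFinM.
apply/idP/idP => h.
  rewrite -(poweRVK pn0 x0) -poweR_EFin; apply: le_poweR => //; first exact: ltW.
  exact: poweR_ge0.
rewrite -[(c * N)%:E](poweRK pn0) ?lee_fin// poweR_EFin.
by rewrite -poweR_EFin; apply: le_poweR => //; rewrite invr_ge0 ltW.
Qed.

(** As [a j <= s], the power [r] of [a j] is at most [s `^ (r - 1) * a j]. *)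
Lemma nneseries_powR (a : nat -> R) (s r : R) : (forall j, 0 <= a j) -> 1 <= r ->
  (\sum_(j <oo) (a j)%:E <= s%:E)%E -> (\sum_(j <oo) (a j `^ r)%:E <= (s `^ r)%:E)%E.
Proof.
move=> a0 r1 hs.
have s0 : 0 <= s.
  by rewrite -lee_fin; apply: le_trans hs; apply: nneseries_ge0 => j _ _; rewrite lee_fin.
have as_ j : a j <= s.
  rewrite -lee_fin; apply: le_trans hs.
  apply: le_trans (nneseries_lim_ge j.+1 _); last by move=> n _ _; rewrite lee_fin.
  by rewrite big_nat_recr//= leeDr// sume_ge0// => i _; rewrite lee_fin.
have e (b : R) : 0 <= b -> b `^ r = b `^ (r - 1) * b.
  move=> b0; have [->|bn0] := eqVneq b 0.
    by rewrite mulr0 powR0// gt_eqF// (lt_le_trans _ r1).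
  by rewrite -{3}(powRr1 b0) -powRD ?subrK// bn0 implybT.
apply: (@le_trans _ _ (\sum_(j <oo) ((s `^ (r - 1))%:E * (a j)%:E))%E).
  apply: lee_nneseries => [j _ _|j _]; first by rewrite lee_fin powR_ge0.
  rewrite -EFinM lee_fin e// ler_wpM2r// ge0_ler_powR ?nnegrE//.
  by rewrite subr_ge0.
rewrite nneseriesZl; last by move=> j _; rewrite lee_fin.
by rewrite e// EFinM lee_wpmul2l// lee_fin powR_ge0.
Qed.

End powers.

(** * Minkowski's inequality for series *)

Section countable_minkowski.
Context (R : realType) d' (T : measurableType d') (mu : {measure set T -> \bar R}).
Variables (D : set T) (mD : measurable D) (p : R) (p1 : 1 <= p).
Variables (u : nat -> T -> R) (u0 : forall j x, 0 <= u j x).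
Hypothesis mu_ : forall j, measurable_fun setT (u j).
Local Open Scope ereal_scope.

Let p0 : (0 < p)%R. Proof. exact: lt_le_trans p1. Qed.
Let pn0 : p != 0%R. Proof. by rewrite gt_eqF. Qed.

Let w j x : R := (u j x * \1_D x)%R.

Let mw j : measurable_fun setT (w j).
Proof. by apply: measurable_funM => //; exact: measurable_indic. Qed.

Let w0 j x : (0 <= w j x)%R.
Proof. by rewrite mulr_ge0// indicE; case: (_ \in _). Qed.

Let LnormE (s : seq nat) :
  Lnorm mu p%:E (EFin \o (fun x => \sum_(j <- s) w j x)%R) =
  (\int[mu]_(x in D) ((\sum_(j <- s) u j x) `^ p)%:E) `^ p^-1.
Proof.
rewrite unlock; congr (poweR _ _); rewrite [RHS]integral_mkcond; apply: eq_integral => x _.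
rewrite patchE /w /= -mulr_suml indicE ger0_norm; last first.
  by rewrite mulr_ge0 ?sumr_ge0//; case: (_ \in _).
by case: ifPn => _; rewrite ?mulr1// mulr0 powR0.
Qed.

Lemma finite_minkowski (s : seq nat) :
  (\int[mu]_(x in D) ((\sum_(j <- s) u j x) `^ p)%:E) `^ p^-1 <=
  \sum_(j <- s) (\int[mu]_(x in D) (u j x `^ p)%:E) `^ p^-1.
Proof.
elim: s => [|j s IH].
  rewrite big_nil integral0_eq ?poweR0r ?invr_eq0// => x _.
  by rewrite big_nil powR0.
rewrite big_cons -LnormE.
have -> : (fun x => \sum_(k <- j :: s) w k x)%R = (fun x => w j x + \sum_(k <- s) w k x)%R.
  by apply/funext => x; rewrite big_cons.
have ms : measurable_fun setT (fun x => \sum_(k <- s) w k x)%R by exact: measurable_sum.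
apply: le_trans (minkowski_EFin mu (mw j) ms p1) _; apply: leeD; last by rewrite LnormE.
have := LnormE [:: j]; rewrite (_ : (fun x => \sum_(k <- [:: j]) w k x)%R = w j); last first.
  by apply/funext => x; rewrite big_seq1.
move=> ->; rewrite le_eqVlt; apply/orP; left; apply/eqP; congr (poweR _ _).
by apply: eq_integral => x _; rewrite big_seq1.
Qed.

(** Monotone convergence reduces the claim to finite sums. *)
Lemma countable_minkowski (J : nat) :
  (\int[mu]_(x in D) (\sum_(J <= j <oo) (u j x)%:E) `^ p) `^ p^-1 <=
  \sum_(J <= j <oo) (\int[mu]_(x in D) (u j x `^ p)%:E) `^ p^-1.
Proof.
set M := \sum_(J <= j <oo) _.
have M0 : 0 <= M by apply: nneseries_ge0 => j _ _; exact: poweR_ge0.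
pose F n x : R := (\sum_(j <- index_iota J n) u j x)%R.
have F0 n x : (0 <= F n x)%R by exact: sumr_ge0.
have Fnd x : {homo F^~ x : m n / (m <= n)%N >-> (m <= n)%R}.
  move=> m n mn; rewrite /F; have [Jm|mJ] := leqP J m.
    by rewrite (big_cat_nat Jm mn)/= lerDl sumr_ge0.
  by rewrite big_geq ?sumr_ge0// ltnW.
have mF n : measurable_fun setT (F n) by exact: measurable_sum.
have mFp n : measurable_fun setT (fun x => (F n x `^ p)%:E).
  by apply/measurable_EFinP; apply: (measurableT_comp (measurable_powR _)).
have IF n : \int[mu]_(x in D) (F n x `^ p)%:E <= M `^ p.
  rewrite -[leLHS](poweRVK pn0); last by apply: integral_ge0 => x _; rewrite lee_fin powR_ge0.
  apply: le_poweR; [exact: ltW|exact: poweR_ge0|].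
  apply: le_trans (finite_minkowski _) _.
  by apply: nneseries_lim_ge => j _ _; exact: poweR_ge0.
have Fp0 n x : 0 <= (F n x `^ p)%:E by rewrite lee_fin powR_ge0.
have nd x : nondecreasing_seq (fun n => (F n x `^ p)%:E).
  move=> m n mn; rewrite lee_fin ge0_ler_powR ?nnegrE// ?(ltW p0)//.
  exact: Fnd.
suff h : \int[mu]_(x in D) (\sum_(J <= j <oo) (u j x)%:E) `^ p <= M `^ p.
  apply: le_trans (le_poweR _ _ h) _; rewrite ?invr_ge0 ?(ltW p0)//.
    by apply: integral_ge0 => x _; exact: poweR_ge0.
  by rewrite poweRK.
apply: (@le_trans _ _ (\int[mu]_(x in D) limn (fun n => (F n x `^ p)%:E))).
  apply: ge0_le_integral => //.
  - by move=> x _; exact: poweR_ge0.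
  - apply: measurable_funTS; apply: (measurableT_comp (measurable_poweR _)).
    under eq_fun do rewrite eseries_cond.
    apply: ge0_emeasurable_sum => [j x _ _|j _]; first by rewrite lee_fin.
    exact/measurable_EFinP.
  - apply: measurable_funTS; apply: (emeasurable_fun_cvg (fun n x => (F n x `^ p)%:E)) => // x _.
    exact: ereal_nondecreasing_is_cvgn.
  move=> x _; have L0 : 0 <= limn (fun n => (F n x `^ p)%:E).
    by apply: lime_ge; [exact: ereal_nondecreasing_is_cvgn|exact: nearW].
  rewrite -[leRHS](poweRVK pn0)//; apply: le_poweR; first exact: ltW.
    by apply: nneseries_ge0 => j _ _; rewrite lee_fin.
  apply: lime_le; first by apply: is_cvg_nneseries => j _ _; rewrite lee_fin.
  apply: nearW => n; rewrite [leLHS](_ : _ = (F n x)%:E); last by rewrite sumEFin.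
  have -> : (F n x)%:E = (F n x `^ p)%:E `^ p^-1 by rewrite -poweR_EFin poweRK ?lee_fin.
  apply: le_poweR; [by rewrite invr_ge0 ltW|by rewrite lee_fin powR_ge0|].
  rewrite (cvg_lim _ (ereal_nondecreasing_cvgn (nd x)))//.
  by apply: ereal_sup_ubound; exists n.
rewrite monotone_convergence//; last 1 first.
- by move=> n; exact: measurable_funTS.
apply: lime_le; last exact: nearW.
apply: ereal_nondecreasing_is_cvgn => m n mn; apply: ge0_le_integral => //.
- exact: measurable_funTS.
- exact: measurable_funTS.
by move=> x _; exact: nd.
Qed.

End countable_minkowski.

(** * Norms of the sum of the pieces *)

Section space_norms.
Context (R : realType) (d : nat) (hd : (0 < d)%N).
Local Notation E := ('rV[R]_d).
Local Notation C := (R[i]).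
Local Notation mu := (lebesgue_rV R d).
Local Notation cint f := (cintegral setT f).
Local Notation cibl f := (cintegrable setT f).
Local Notation Q P := (@cube_set R d P).
Local Notation side P := (@cube_side R d P).
Implicit Types (h : E -> C) (x y v : E) (T : dist R d) (P : dyadic d) (g : nat -> E -> C).
Variables (theta0 : E -> C) (htheta : resolution theta0).
Variables (p : R) (p0 : 0 < p) (phi : R -> R) (hphi : class_G d p phi).

Let pn0 : p != 0. Proof. by rewrite gt_eqF. Qed.

Lemma phi_gt0 P : 0 < phi (side P).
Proof. by case: hphi => h _ _; apply: h; exact: side_gt0. Qed.

Lemma cube_level0 P : 1 <= side P -> cube_level P = 0%N.
Proof.
rewrite /cube_side /cube_level => h; have [P0|P1] := leP P.1 0; first by [].
have : 2 ^ (- P.1) < 1 :> R.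
  case: P.1 P1 => [[|n]|n]// _.
  by rewrite -invr_expz invf_lt1 -exprnP ?exprn_gt0// exprn_egt1 ?ltr1n.
by rewrite ltNge h.
Qed.

Lemma side_ge1 P : 1 <= @cube_vol R d P -> 1 <= side P.
Proof.
rewrite /cube_vol => h; rewrite leNgt; apply/negP => s1.
by move: h; rewrite leNgt exprn_ilt1 ?(ltW (side_gt0 R P)) ?gt_eqF//; case: d hd.
Qed.

Lemma pieces_cmeas T g : pieces theta0 T g -> forall j, cmeas (g j).
Proof. by move=> pg j; have [[m1 m2 _] _] := pg j. Qed.

Lemma measurable_weighted s g j : cmeas (g j) -> measurable_fun setT (weighted s g j).
Proof.
move=> mg; apply: (@measurable_cmod R _ _ (fun x => (2 `^ (j%:R * s))%:C%C * g j x)).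
by apply: cmeasM => //; exact: cmeas_cst.
Qed.

Lemma weightedE s g j x : weighted s g j x = 2 `^ (j%:R * s) * cmod (g j x).
Proof. by rewrite /weighted cmodM cmod_real ger0_norm ?powR_ge0. Qed.

Lemma weighted_ge0 s g j x : 0 <= weighted s g j x.
Proof. by rewrite /weighted. Qed.

(** For equal exponents the sum and the integral can be exchanged by Tonelli's
    theorem. *)
Lemma B_norm_diag s g : (forall j, cmeas (g j)) ->
  B_norm_of p p s phi g = F_norm_of p p s phi g.
Proof.
move=> mg; congr ereal_sup; apply: eq_imagel => P _; rewrite divff//.
congr (_ * _ `^ _)%E.
have mw j : measurable_fun setT (fun x => weighted s g j x `^ p).
  by apply: (measurableT_comp (measurable_powR _)); exact: measurable_weighted.
have w0 j x : 0 <= weighted s g j x `^ p by exact: powR_ge0.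
set J := cube_level P.
have eR x : ((\sum_(J <= j <oo) (weighted s g j x `^ p)%:E) `^ 1 =
    \sum_(j <oo) (if (J <= j)%N then (weighted s g j x `^ p)%:E else 0))%E.
  rewrite poweRe1; last by apply: nneseries_ge0 => j _ _; rewrite lee_fin.
  by rewrite eseries_cond eseries_mkcondr.
have eL j : ((\int[mu]_(x in Q P) (weighted s g j x `^ p)%:E) `^ 1 =
    \int[mu]_(x in Q P) (weighted s g j x `^ p)%:E)%E.
  by rewrite poweRe1//; apply: integral_ge0 => x _; rewrite lee_fin.
rewrite (eq_integral _ _ (fun x _ => eR x)) (eq_eseriesr (fun j _ => eL j)).
rewrite eseries_cond eseries_mkcondr integral_nneseries//.
- apply: eq_eseriesr => j _; case: ifPn => // _.
  by rewrite integral0_eq.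
- exact: cube_measurable.
- move=> j; case: (J <= j)%N; last exact: measurable_cst.
  by apply: measurable_funTS; exact/measurable_EFinP.
- by move=> j x _; case: ifPn => // _; rewrite lee_fin.
Qed.

Lemma F_le_B_norm g : 1 <= p -> (forall j, cmeas (g j)) ->
  (F_norm_of p 1 0 phi g <= B_norm_of p 1 0 phi g)%E.
Proof.
move=> p1 mg; apply: ge_ereal_sup => _ [P _ <-].
apply: (@le_trans _ _ (((phi (side P))^-1)%:E *
      (\sum_(cube_level P <= j <oo)
         (\int[mu]_(x in Q P) (weighted 0 g j x `^ p)%:E) `^ (1 / p))
        `^ 1^-1)%E); last by apply: ereal_sup_ubound; exists P.
rewrite lee_wpmul2l ?lee_fin ?invr_ge0 ?(ltW (phi_gt0 P))//.
rewrite invr1 mulr1 poweRe1; last by apply: nneseries_ge0 => j _ _; exact: poweR_ge0.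
under eq_eseriesr do rewrite div1r.
have mw j : measurable_fun setT (weighted 0 g j) by exact: measurable_weighted.
have := countable_minkowski mu (cube_measurable P) p1 (@weighted_ge0 0 g) mw (cube_level P).
congr (_ <= _)%E; congr (_ `^ _)%E; apply: eq_integral => x _; congr (_ `^ _)%E.
by apply: eq_eseriesr => j _; rewrite powRr1// weighted_ge0.
Qed.

Lemma L_norm_le (u : R) h (N : R) : 0 < u -> 0 <= N ->
  (forall P, (1 <= side P)%R ->
    \int[mu]_(x in Q P) (cmod (h x) `^ u)%:E <= ((phi (side P) * N) `^ u)%:E)%E ->
  (L_norm u phi h <= N%:E)%E.
Proof.
move=> u0 N0 hN; apply: ge_ereal_sup => _ [P /= P1 <-].
rewrite normalized_le//; last 2 first.
- exact: phi_gt0.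
- by apply: integral_ge0 => x _; rewrite lee_fin powR_ge0.
by apply: hN; exact: side_ge1.
Qed.

Lemma loc_integrable_of_cubes (u : R) h (N : R) : cmeas h -> 0 <= N ->
  (forall P, (1 <= side P)%R ->
    \int[mu]_(x in Q P) (cmod (h x) `^ u)%:E <= ((phi (side P) * N) `^ u)%:E)%E ->
  loc_integrable u h.
Proof.
move=> mh N0 hN.
apply: (@loc_integrable_mass R d u h ((phi 1 * N) `^ u)) => // [|k]; first exact: powR_ge0.
have s1 : side (0, k) = 1 by rewrite /cube_side oppr0 expr0z.
by have := hN (0, k); rewrite s1; apply.
Qed.

Lemma F_norm_cube (q s N : R) g P : 0 <= N -> (F_norm_of p q s phi g <= N%:E)%E -> 1 <= side P ->
  (\int[mu]_(x in Q P) (\sum_(j <oo) (weighted s g j x `^ q)%:E) `^ (p / q) <=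
    ((phi (side P) * N) `^ p)%:E)%E.
Proof.
move=> N0 hN P1; rewrite -normalized_le ?phi_gt0//; last first.
  by apply: integral_ge0 => x _; exact: poweR_ge0.
by apply: le_trans hN; apply: ereal_sup_ubound; exists P => //; rewrite cube_level0.
Qed.

(** Since [cmod (csum g x)] is at most the sum of the moduli, the norm
    estimate is immediate. *)
Lemma csum_bound_ge1 T g (N : R) : 1 <= p -> tempered T -> pieces theta0 T g -> 0 <= N ->
  (F_norm_of p 1 0 phi g <= N%:E)%E ->
  [/\ represents T (csum g), loc_integrable p (csum g) & (L_norm p phi (csum g) <= N%:E)%E].
Proof.
move=> p1 tT pg N0 hN.
have mg := pieces_cmeas pg; have mS := cmeas_csum mg; have mG := measurable_abs_sum mg.
have G0 := @abs_sum_ge0 R d g.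
have mGp : measurable_fun setT (fun x => abs_sum g x `^ p)%E.
  exact: (measurableT_comp (measurable_poweR _)).
have hG P : 1 <= side P -> (\int[mu]_(x in Q P) (abs_sum g x `^ p) <= ((phi (side P) * N) `^ p)%:E)%E.
  move=> P1; apply: le_trans (F_norm_cube N0 hN P1); rewrite le_eqVlt; apply/orP; left; apply/eqP.
  apply: eq_integral => x _; rewrite divr1; congr (_ `^ _)%E.
  by apply: eq_eseriesr => j _; rewrite powRr1 weightedE ?mulr0 ?powRr0 ?mul1r.
have hS P : 1 <= side P ->
   (\int[mu]_(x in Q P) (cmod (csum g x) `^ p)%:E <= ((phi (side P) * N) `^ p)%:E)%E.
  move=> P1; apply: le_trans (hG P P1); apply: ge0_le_integral => //.
  - exact: cube_measurable.
  - by move=> x _; rewrite lee_fin powR_ge0.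
  - by apply: measurable_funTS; exact: measurable_cmod_powR.
  - exact: measurable_funTS.
  - by move=> x _; rewrite -poweR_EFin; apply: le_poweR; rewrite ?(ltW p0) ?lee_fin// cmod_csum.
split; last 2 first.
- exact: loc_integrable_of_cubes hS.
- exact: L_norm_le.
apply: (csum_represents (A := 1 + (phi 1 * N) `^ p) htheta tT pg); first by rewrite addr_ge0 ?powR_ge0.
move=> k; have s1 : side (0, k) = 1 by rewrite /cube_side oppr0 expr0z.
have mQ := cube_measurable (0, k) : measurable (Q (0, k)).
(* On a unit cube the integral of the sum of the moduli is controlled by that
   of its [p]-th power, as [t <= 1 + t `^ p]. *)
apply: (@le_trans _ _ (\int[mu]_(x in Q (0%R, k)) (1 + abs_sum g x `^ p))%E).
  apply: ge0_le_integral => //.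
  - exact: measurable_funTS.
  - by apply: measurable_funTS; apply: emeasurable_funD => //; exact: measurable_cst.
  move=> x _; have [G1|G1] := leP (abs_sum g x) 1%E.
    by apply: le_trans G1 _; rewrite leeDl// poweR_ge0.
  apply: (@le_trans _ _ (abs_sum g x `^ p)%E); last by rewrite leeDr.
  move: (ltW G1); case: (abs_sum g x) => [r| |] //=.
    by rewrite !lee_fin => r1; rewrite -{1}(powRr1 (le_trans ler01 r1)) ler_powR.
  by rewrite (negbTE pn0).
rewrite ge0_integralD//; last 2 first.
- by move=> x _; exact: poweR_ge0.
- exact: measurable_funTS.
rewrite EFinD; apply: leeD; last by have := hG (0, k); rewrite s1; apply.
by rewrite integral_cst// mul1e; have /eqP := @unit_cube_measure R d k; rewrite eq_le => /andP[].
Qed.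

(** Let [a j] be [2 ^ (j * sigma * p)] times the integral of [cmod (g j) `^ p]
    against [cube_weight P]. Then [band_L1] bounds the integral of [cmod (g
    j)] over [P] by [a j `^ p^-1], and the sum of these is at most the
    [1/p]-th power of the sum of the [a j], which is the weighted integral of
    the integrand of the F-norm. The L^p estimate is the subadditivity of the
    [p]-th power. *)
Lemma csum_bound_lt1 : p < 1 -> exists2 K : R, 0 <= K & forall T g (N : R),
  tempered T -> pieces theta0 T g -> 0 <= N ->
  (F_norm_of p p (sigma_ d p) phi g <= N%:E)%E ->
  [/\ represents T (csum g),
      loc_integrable 1 (csum g) /\ loc_integrable p (csum g),
      (L_norm 1 phi (csum g) <= (K * N)%:E)%E & (L_norm p phi (csum g) <= N%:E)%E].
Proof.
move=> p1; have p01 : 0 < p < 1 by rewrite p0.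
have [K K0 hK] := band_L1 htheta p01.
pose s : R := sigma_ d p.
have s0 : 0 <= s by rewrite /s /sigma_ mulr_ge0// le_max lexx orbT.
pose K' := K * (2 ^+ d.+1) `^ p^-1.
exists K' => [|T g N tT pg N0 hN]; first by rewrite mulr_ge0 ?powR_ge0.
have mg := pieces_cmeas pg; have mS := cmeas_csum mg; have mG := measurable_abs_sum mg.
have G0 := @abs_sum_ge0 R d g.
pose w j x : R := weighted s g j x `^ p.
have w0 j x : 0 <= w j x by exact: powR_ge0.
have mw j : measurable_fun setT (w j).
  by apply: (measurableT_comp (measurable_powR _)); exact: measurable_weighted.
have mws : measurable_fun setT (fun x => \sum_(j <oo) (w j x)%:E)%E.
  exact: measurable_nneseries.
have ws0 x : (0 <= \sum_(j <oo) (w j x)%:E)%E by apply: nneseries_ge0 => j _ _; rewrite lee_fin.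
have t1 j : 1 <= 2 `^ (j%:R * s) :> R by rewrite -[leLHS](powRr0 2) ler_powR ?ler1n// mulr_ge0.
have gw j x : cmod (g j x) `^ p <= w j x.
  by rewrite /w ge0_ler_powR ?nnegrE ?weighted_ge0 ?(ltW p0)// weightedE ler_peMl.
have hF P : 1 <= side P ->
   (\int[mu]_(x in Q P) (\sum_(j <oo) (w j x)%:E) <= ((phi (side P) * N) `^ p)%:E)%E.
  move=> P1; apply: le_trans (F_norm_cube N0 hN P1); rewrite le_eqVlt; apply/orP; left; apply/eqP.
  by apply: eq_integral => x _; rewrite divff// poweRe1//; exact: ws0.
have hg P j : 1 <= side P ->
   (\int[mu]_(x in Q P) (cmod (g j x) `^ p)%:E <= ((phi (side P) * N) `^ p)%:E)%E.
  move=> P1; apply: le_trans (hF P P1); apply: ge0_le_integral => //.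
  - exact: cube_measurable.
  - by move=> x _; rewrite lee_fin powR_ge0.
  - by apply: measurable_funTS; exact: measurable_cmod_powR.
  - exact: measurable_funTS.
  move=> x _; apply: (@le_trans _ _ (w j x)%:E); first by rewrite lee_fin gw.
  apply: le_trans (nneseries_lim_ge j.+1 _); last by move=> n _ _; rewrite lee_fin.
  by rewrite big_nat_recr//= leeDr// sume_ge0// => i _; rewrite lee_fin.
have sk P k : 1 <= side P -> 1 <= side (P.1, k) by [].
have mW P := @measurable_cube_weight R d P.
have hG P : 1 <= side P -> (\int[mu]_(x in Q P) abs_sum g x <= (phi (side P) * (K' * N))%:E)%E.
  move=> P1; set M := (phi (side P) * N) `^ p.
  have M0 : 0 <= M by exact: powR_ge0.
  pose I j := fine (\int[mu]_y (cube_weight P y * (cmod (g j y) `^ p)%:E))%E.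
  have Ile j : (\int[mu]_y (cube_weight P y * (cmod (g j y) `^ p)%:E) <= (2 ^+ d.+1)%:E * M%:E)%E.
    apply: integral_cube_weight => //.
    - exact: measurable_cmod_powR.
    - by move=> x; rewrite lee_fin powR_ge0.
    - by move=> k; apply: (hg (P.1, k)).
  have I0 j : (0 <= \int[mu]_y (cube_weight P y * (cmod (g j y) `^ p)%:E))%E.
    by apply: integral_ge0 => y _; rewrite mule_ge0 ?cube_weight_ge0// lee_fin powR_ge0.
  have IE j : (\int[mu]_y (cube_weight P y * (cmod (g j y) `^ p)%:E) = (I j)%:E)%E.
    by rewrite /I fineK// ge0_fin_numE// (le_lt_trans (Ile j))// -EFinM ltry.
  pose a j := (2 `^ (j%:R * s)) `^ p * I j.
  have Ij0 j : 0 <= I j by rewrite -lee_fin -IE.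
  have a0 j : 0 <= a j by rewrite mulr_ge0 ?powR_ge0.
  have suma : (\sum_(j <oo) (a j)%:E <= (2 ^+ d.+1 * M)%:E)%E.
    have -> : (\sum_(j <oo) (a j)%:E = \int[mu]_y (cube_weight P y * \sum_(j <oo) (w j y)%:E))%E.
      rewrite (eq_integral (fun y => \sum_(j <oo) (cube_weight P y * (w j y)%:E))%E); last first.
        move=> y _; rewrite nneseriesZl_ge0 ?cube_weight_ge0// => j; by rewrite lee_fin.
      rewrite integral_nneseries//; last 2 first.
      + by move=> j; apply: emeasurable_funM => //; exact/measurable_EFinP.
      + by move=> j y _; rewrite mule_ge0 ?cube_weight_ge0// lee_fin.
      apply: eq_eseriesr => j _; rewrite /a EFinM -IE -ge0_integralZl//; last 2 first.
      + by apply: emeasurable_funM => //; exact: measurable_cmod_powR.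
      + by move=> y _; rewrite mule_ge0 ?cube_weight_ge0// lee_fin powR_ge0.
      apply: eq_integral => y _; rewrite muleCA; congr (_ * _)%E.
      by rewrite /w weightedE powRM ?powR_ge0.
    rewrite EFinM; apply: integral_cube_weight => // k.
    exact: (hF (P.1, k)).
  have s1 k : side (0, k) = 1 by rewrite /cube_side oppr0 expr0z.
  rewrite /abs_sum integral_nneseries//; last 3 first.
  - exact: cube_measurable.
  - by move=> j; apply: measurable_funTS; apply/measurable_EFinP; exact: measurable_cmod.
  - by move=> j x _; rewrite lee_fin.
  apply: (@le_trans _ _ (\sum_(j <oo) (K%:E * (a j `^ p^-1)%:E))%E).
    apply: lee_nneseries => [j _ _|j _]; first by apply: integral_ge0 => x _; rewrite lee_fin.
    have := hK T j (g j) ((phi 1 * N) `^ p) (I j) tT (pg j) (powR_ge0 _ _) _ P P1 (IE j).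
    move=> h; apply: le_trans (h _) _.
      by move=> k; rewrite -(s1 k); apply: (hg (0, k)); rewrite s1.
    rewrite -EFinM lee_fin /a powRM ?powR_ge0// -(powRrM _ p) divff// powRr1 ?powR_ge0//.
  rewrite nneseriesZl; last by move=> j _; rewrite lee_fin powR_ge0.
  have r1 : 1 <= p^-1 by rewrite invf_ge1// ltW.
  have := nneseries_powR a0 r1 suma => h.
  apply: (@le_trans _ _ (K%:E * ((2 ^+ d.+1 * M) `^ p^-1)%:E)%E).
    by rewrite lee_wpmul2l ?lee_fin.
  have pN : 0 <= phi (side P) * N by rewrite mulr_ge0 ?(ltW (phi_gt0 P)).
  rewrite -EFinM lee_fin powRM ?exprn_ge0// /M -powRrM divff// powRr1//.
  by rewrite le_eqVlt; apply/orP; left; apply/eqP; rewrite /K'; ring.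
have hS1 P : 1 <= side P ->
   (\int[mu]_(x in Q P) (cmod (csum g x) `^ 1)%:E <= ((phi (side P) * (K' * N)) `^ 1)%:E)%E.
  move=> P1; rewrite powRr1; last first.
    by rewrite mulr_ge0 ?(ltW (phi_gt0 P))// mulr_ge0// mulr_ge0 ?powR_ge0.
  apply: le_trans (hG P P1); apply: ge0_le_integral => //.
  - exact: cube_measurable.
  - by move=> x _; rewrite lee_fin powR_ge0.
  - by apply: measurable_funTS; exact: measurable_cmod_powR.
  - exact: measurable_funTS.
  - by move=> x _; rewrite powRr1// cmod_csum.
have hSp P : 1 <= side P ->
   (\int[mu]_(x in Q P) (cmod (csum g x) `^ p)%:E <= ((phi (side P) * N) `^ p)%:E)%E.
  move=> P1; apply: le_trans (hF P P1); apply: ge0_le_integral => //.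
  - exact: cube_measurable.
  - by move=> x _; rewrite lee_fin powR_ge0.
  - by apply: measurable_funTS; exact: measurable_cmod_powR.
  - exact: measurable_funTS.
  move=> x _; have := cmod_csum g x; have := ws0 x.
  case e : (\sum_(j <oo) (w j x)%:E)%E => [r| |] // r0; last by rewrite leey.
  have r1 : 1 <= p^-1 by rewrite invf_ge1// ltW.
  have h : (\sum_(j <oo) (cmod (g j x) `^ p)%:E <= r%:E)%E.
    rewrite -e; apply: lee_nneseries => [j _ _|j _]; first by rewrite lee_fin powR_ge0.
    by rewrite lee_fin gw.
  have := nneseries_powR (fun j => powR_ge0 _ _) r1 h.
  under eq_eseriesr do rewrite -powRrM divff// powRr1//.
  rewrite -/(abs_sum g x) => h1 h2; have := le_trans h2 h1; rewrite !lee_fin => h3.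
  rewrite -[leRHS]powRr1// -(mulVf pn0) powRrM ge0_ler_powR ?nnegrE ?powR_ge0 ?(ltW p0)//.
have KN : 0 <= K' * N by rewrite mulr_ge0// mulr_ge0 ?powR_ge0.
split; last 2 first.
- exact: L_norm_le.
- exact: L_norm_le.
- apply: (csum_represents (A := phi 1 * (K' * N)) htheta tT pg).
    by case: hphi => hh _ _; rewrite mulr_ge0 ?(ltW (hh _ ltr01)).
  move=> k; have s1 : side (0, k) = 1 by rewrite /cube_side oppr0 expr0z.
  by have := hG (0, k); rewrite s1; apply.
- by split; [exact: loc_integrable_of_cubes hS1|exact: loc_integrable_of_cubes hSp].
Qed.

End space_norms.

(** * From norm estimates to embeddings *)

Section embeddings.
Context (R : realType) (d : nat).
Local Notation E := ('rV[R]_d).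
Local Notation C := (R[i]).
Local Notation mu := (lebesgue_rV R d).
Local Notation cint f := (cintegral setT f).
Local Notation cibl f := (cintegrable setT f).
Local Notation Q P := (@cube_set R d P).
Implicit Types (h : E -> C) (x y v : E) (T : dist R d) (P : dyadic d).

Lemma schwartz_seminorm_le (M N : nat) h : (M <= N)%N ->
  (schwartz_seminorm M h <= schwartz_seminorm N h)%E.
Proof.
move=> MN; apply: ge_ereal_sup => _ [[l x] /= lM <-].
apply: (@le_trans _ _ ((1 + enorm x) ^+ N * cmod (partials l h x))%:E).
  by rewrite lee_fin ler_wpM2r// ler_weXn2l// lerDl enorm_ge0.
by apply: ereal_sup_ubound; exists (l, x) => //=; exact: leq_trans MN.
Qed.

Lemma temperedB (T T' : dist R d) : tempered T -> tempered T' -> tempered (T - T').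
Proof.
move=> [lT [N [c [c0 hT]]]] [lT' [N' [c' [c'0 hT']]]]; split.
  move=> a f g sf sg; rewrite -[LHS]/(T _ - T' _) -[(T - T') f]/(T f - T' f).
  by rewrite -[(T - T') g]/(T g - T' g) lT// lT'//; ring.
exists (N + N')%N, (c + c'); split; first exact: addr_ge0.
move=> f sf; rewrite -[(T - T') f]/(T f - T' f).
apply: (@le_trans _ _ (cmod (T f) + cmod (T' f))%:E); first by rewrite lee_fin cmodB.
rewrite EFinD EFinD ge0_muleDl ?lee_fin//.
apply: leeD.
  apply: le_trans (hT f sf) _; rewrite lee_wpmul2l ?lee_fin//.
  exact: schwartz_seminorm_le (leq_addr _ _).
apply: le_trans (hT' f sf) _; rewrite lee_wpmul2l ?lee_fin//.
exact: schwartz_seminorm_le (leq_addl _ _).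
Qed.

(** The integral identity alone passes to differences and determines the
    density. *)
Definition weakly_represents T h : Prop := forall f, schwartz f ->
  cibl (fun x => h x * f x) /\ T f = cint (fun x => h x * f x).

Lemma density_unique T h h' : weakly_represents T h -> weakly_represents T h' ->
  {ae mu, forall x, h x = h' x}.
Proof.
move=> rh rh'.
have sub f : schwartz f ->
    cibl (fun x => (h x - h' x) * f x) /\ cint (fun x => (h x - h' x) * f x) = 0.
  move=> sf; have [i1 e1] := rh f sf; have [i2 e2] := rh' f sf.
  have [i3 e3] := cintegralB i1 i2.
  rewrite (_ : (fun x => _ * _) = fun x => h x * f x - h' x * f x); last first.
    by apply/funext => x; rewrite mulrBl.
  by split=> //; rewrite e3 -e1 -e2 subrr.
have := test_unique (sub _ (schwartz_cgauss R d)).1 (fun n L => (sub _ (schwartz_test n L)).2).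
by apply: filterS => x /eqP; rewrite subr_eq0 => /eqP.
Qed.

Lemma weakly_representsB T T' h h' : weakly_represents T h -> weakly_represents T' h' ->
  weakly_represents (T - T') (h - h').
Proof.
move=> rh rh' f sf; have [i1 e1] := rh f sf; have [i2 e2] := rh' f sf.
have [i3 e3] := cintegralB i1 i2.
have e : (fun x => (h - h') x * f x) = fun x => h x * f x - h' x * f x.
  by apply/funext => x; rewrite -[(h - h') x]/(h x - h' x) mulrBl.
by rewrite e; split; [exact: i3|rewrite e3 -e1 -e2].
Qed.

Lemma L_norm_ae (u : R) (phi : R -> R) h h' : cmeas h -> cmeas h' ->
  {ae mu, forall x, h x = h' x} -> L_norm u phi h = L_norm u phi h'.
Proof.
move=> mh mh' e.
have eP P : (\int[mu]_(x in Q P) (cmod (h x) `^ u)%:E = \int[mu]_(x in Q P) (cmod (h' x) `^ u)%:E)%E.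
  apply: ae_eq_integral.
  - exact: cube_measurable.
  - by apply: measurable_funTS; exact: measurable_cmod_powR.
  - by apply: measurable_funTS; exact: measurable_cmod_powR.
  by apply: filterS e => x -> .
by apply: (congr1 (@ereal_sup R)); apply: eq_imagel => P _; rewrite eP.
Qed.

Variables (theta0 : E -> C) (p q s : R) (phi : R -> R).

Lemma F_norm_of_ge0 (g : nat -> E -> C) : (forall P, 0 < phi (@cube_side R d P)) ->
  (0 <= F_norm_of p q s phi g)%E.
Proof.
move=> phi0; pose P : dyadic d := (0, fun=> 0).
apply: (@le_trans _ _ (((phi (@cube_side R d P))^-1)%:E *
      (\int[mu]_(x in Q P)
         (\sum_(cube_level P <= j <oo) (weighted s g j x `^ q)%:E) `^ (p / q))
        `^ p^-1)%E).
  by rewrite mule_ge0 ?poweR_ge0// lee_fin invr_ge0 ltW.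
by apply: ereal_sup_ubound; exists P.
Qed.

(** The difference of two densities is a density of the difference of the
    distributions, hence agrees almost everywhere with the sum of its pieces;
    so a bound for the sum of the pieces of one distribution is a Lipschitz
    estimate. The passage from [K] to [K + 1] keeps the modulus of continuity
    positive when [K = 0]. *)
Lemma embeds_fun_of_bound (Y : qnspace R (E -> C)) (K : R) : 0 <= K ->
  (forall P, 0 < phi (@cube_side R d P)) ->
  (forall h, qset Y h -> cmeas h) ->
  (forall h h', cmeas h -> cmeas h' -> {ae mu, forall x, h x = h' x} ->
     qnorm Y h = qnorm Y h') ->
  (forall T g (N : R), tempered T -> pieces theta0 T g -> 0 <= N ->
     (F_norm_of p q s phi g <= N%:E)%E ->
     [/\ represents T (csum g), qset Y (csum g) & (qnorm Y (csum g) <= (K * N)%:E)%E]) ->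
  embeds_fun (F_space p q s phi theta0) Y.
Proof.
move=> K0 phi0 mY aeY hY.
have real_norm T (r : \bar R) : (F_norm p q s phi theta0 T < r)%E -> tempered T ->
    exists g (N : R), [/\ pieces theta0 T g, 0 <= N,
      (F_norm_of p q s phi g <= N%:E)%E & (N%:E < r)%E].
  move=> /ereal_inf_lt[_ [g pg <-] gr] tT.
  have g0 := F_norm_of_ge0 g phi0.
  have fg : F_norm_of p q s phi g \is a fin_num.
    by rewrite ge0_fin_numE// (lt_le_trans gr)// leey.
  by exists g, (fine (F_norm_of p q s phi g)); rewrite fineK// fine_ge0.
split=> [T [tT /real_norm /(_ tT) [g [N [pg N0 hN _]]]]|].
  by have [r1 r2 _] := hY T g N tT pg N0 hN; exists (csum g).
move=> T0 h0 [tT0 _] Yh0 rh0 e e0.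
have K1 : 0 < K + 1 by rewrite ltr_wpDl.
exists (e / (K + 1)) => [|T h [tT _] Yh rh hr]; first by rewrite divr_gt0.
have [g [N [pg N0 hN Nr]]] := real_norm _ _ hr (temperedB tT tT0).
have [r1 r2 r3] := hY _ g N (temperedB tT tT0) pg N0 hN.
have ae : {ae mu, forall x, (h - h0) x = csum g x}.
  apply: (@density_unique (T - T0)); last exact: r1.2.
  by apply: weakly_representsB; [exact: rh.2|exact: rh0.2].
have mh : cmeas (h - h0).
  have -> : h - h0 = fun x => h x + (-1) * h0 x by apply/funext => x; rewrite mulN1r.
  apply: cmeasD; first exact: mY.
  by apply: cmeasM; [exact: cmeas_cst|exact: mY].
rewrite (aeY _ _ mh (mY _ r2) ae); apply: le_lt_trans r3 _; rewrite lte_fin.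
apply: (@le_lt_trans _ _ ((K + 1) * N)); first by rewrite ler_wpM2r// lerDl.
by rewrite mulrC -ltr_pdivlMr// -lte_fin.
Qed.

End embeddings.

Lemma loc_integrable_cmeas (R : realType) (d : nat) (u : R) (h : 'rV[R]_d -> R[i]) :
  loc_integrable u h -> cmeas h.
Proof. by case=> m1 m2 _; split. Qed.

Unset Implicit Arguments.

Theorem proposition4p19 (R : realType) (d : nat) (hd : (0 < d)%N)
    (theta0 : 'rV[R]_d -> R[i]) (htheta : resolution theta0)
    (p : R) (hp : 0 < p) (phi : R -> R) (hphi : class_G d p phi)
    (hdecay : exists eps0 c0 : R, [/\ 0 < eps0, 0 < c0 &
       forall r t : R, 0 < r -> r <= t ->
         t `^ (eps0 - d%:R / p) * phi t <= c0 * (r `^ (eps0 - d%:R / p) * phi r)]) :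
  (1 <= p ->
     embeds (B_space p 1 0 phi theta0) (F_space p 1 0 phi theta0) /\
     embeds_fun (F_space p 1 0 phi theta0) (L_space d p phi)) /\
  (p < 1 ->
     same_space (B_space p p (sigma_ d p) phi theta0)
                (F_space p p (sigma_ d p) phi theta0) /\
     embeds_fun (F_space p p (sigma_ d p) phi theta0)
                (qcap (L_space d 1 phi) (L_space d p phi))).
Proof.
have phi0 P : 0 < phi (@cube_side R d P) by exact: phi_gt0 hphi P.
split=> p1; split.
- have FB T : (F_norm p 1 0 phi theta0 T <= B_norm p 1 0 phi theta0 T)%E.
    apply: le_ereal_inf_tmp => _ [g pg <-].
    apply: le_trans (F_le_B_norm hphi p1 (pieces_cmeas pg)).
    by apply: ereal_inf_lbound; exists g.
  split=> [T [tT Too]|T0 _ e e0]; first by split=> //; exact: le_lt_trans (FB T) Too.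
  by exists e => // T _; apply: le_lt_trans; exact: FB.
- apply: (embeds_fun_of_bound ler01 phi0).
  + by move=> h [/loc_integrable_cmeas].
  + by move=> h h' mh mh' ae; exact: L_norm_ae.
  move=> T g N tT pg N0 hN.
  have [r1 r2 r3] := csum_bound_ge1 hd htheta hp hphi p1 tT pg N0 hN.
  by rewrite mul1r; split=> //; split=> //; rewrite (le_lt_trans r3)// ltry.
- have BF : B_norm p p (sigma_ d p) phi theta0 = F_norm p p (sigma_ d p) phi theta0.
    apply/funext => T; congr ereal_inf; apply: eq_imagel => g pg.
    exact: B_norm_diag (pieces_cmeas pg).
  split; first by rewrite /= BF.
  by exists 1, 1; split=> // T _; rewrite /= BF mul1e.
- have [K K0 hK] := csum_bound_lt1 hd htheta hp hphi p1.
  have K1 : 0 <= K + 1 by rewrite addr_ge0.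
  apply: (embeds_fun_of_bound K1 phi0).
  + by move=> h [[/loc_integrable_cmeas]].
  + by move=> h h' mh mh' ae /=; rewrite !(L_norm_ae _ _ mh mh' ae).
  move=> T g N tT pg N0 hN.
  have [r1 [r2 r2'] r3 r4] := hK T g N tT pg N0 hN.
  split=> //=; first by split; split=> //; [rewrite (le_lt_trans r3)// ltry|rewrite (le_lt_trans r4)// ltry].
  rewrite ge_max; apply/andP; split.
    by apply: le_trans r3 _; rewrite lee_fin ler_wpM2r// lerDl.
  by apply: le_trans r4 _; rewrite lee_fin ler_peMl// lerDr.
Qed.
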